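(* Assume that there exists a deterministic function $\rho:\mathbb R_+\to\mathbb R_+$ with $\rho(0^+)=0$ such that, $\mathbb P$-a.s., $\langle M\rangle_t-\langle M\rangle_s\le\rho(t-s)$ for all $0\le s\le t\le T$, and that there exists $\bar K\ge0$ such that $|\alpha_t(\omega)|\le\bar K$, $(\mathbb P\otimes\langle M\rangle)$-a.e. on $\Omega\times[0,T]$. A contingent claim $\xi\in L^2(\Omega,\mathcal F_T,\mathbb P;\mathbb R)$ admits an $(\mathbb H,\mathbb F)$-optimal strategy $\Psi=(\theta,\eta)$ with $V_T(\Psi)=\xi$ $\mathbb P$-a.s. if and only if $\xi$ can be written as $$\xi=U_0+\int_0^T\beta^{\mathcal H}_t\,dS_t+A_T,\quad\mathbb P\text{-a.s.},\qquad( * )$$ with $U_0\in L^2(\Omega,\mathcal F_0,\mathbb P;\mathbb R)$, $\beta^{\mathcal H}\in\mathcal M^2_{\mathcal H}(0,T)$ and $A\in\mathcal L^2_{\mathcal F}(0,T)$ weakly orthogonal to $M$. The strategy $\Psi$ is then given by $\theta_t=\beta^{\mathcal H}_t$, $0\le t\le T$, with minimal cost $C_t(\Psi)=U_0+A_t$, $0\le t\le T$. If $( * )$ holds, the optimal portfolio value is $$V_t(\Psi)=C_t(\Psi)+\int_0^t\theta_s\,dS_s=U_0+\int_0^t\beta^{\mathcal H}_s\,dS_s+A_t,\quad 0\le t\le T,$$ and $\eta_t=V_t(\Psi)-\beta^{\mathcal H}_tS_t$, $0\le t\le T$.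
   Context: $T\in(0,\infty)$ is fixed. $(\Omega,\mathcal F,\mathbb P)$ is a probability space with two filtrations $\mathbb F=(\mathcal F_t)_{0\le t\le T}$ and $\mathbb H=(\mathcal H_t)_{0\le t\le T}$, both satisfying the usual conditions, with $\mathcal F=\mathcal F_T$ and $\mathcal H_t\subseteq\mathcal F_t$ for all $t$. $S=(S_t)_{0\le t\le T}$ is a real-valued square-integrable càdlàg $\mathbb F$-semimartingale of the form $S_t=S_0+M_t+\int_0^t\alpha_s\,d\langle M\rangle_s$, where $M$ is a real-valued square-integrable càdlàg $\mathbb F$-martingale with $M_0=0$ and $\mathbb F$-predictable quadratic variation $\langle M\rangle$, and $\alpha$ is an $\mathbb F$-predictable process with $\mathbb E[\int_0^T|\alpha_t|^2\,d\langle M\rangle_t]<\infty$. Spaces: $\mathcal M^2_{\mathcal H}(0,T)$ is the set of $\mathbb H$-predictable processes $\varphi$ with $\mathbb E[\int_0^T|\varphi_s|^2\,d\langle M\rangle_s]<\infty$; $\mathcal L^2_{\mathcal F}(0,T)$ is the set of $\mathbb F$-martingales $\psi$ with $\psi_0=0$ and $\mathbb E[\psi_T^2]<\infty$. A square-integrable $\mathbb F$-martingale $O$ is weakly orthogonal to $M$ if $\mathbb E\big[O_T\int_0^T\varphi_t\,dM_t\big]=0$ for all $\varphi\in\mathcal M^2_{\mathcal H}(0,T)$. An $(\mathbb H,\mathbb F)$-admissible strategy is a pair $\Psi=(\theta,\eta)$ with $\theta\in\mathcal M^2_{\mathcal H}(0,T)$ and $\eta$ a real-valued $\mathbb F$-adapted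 process such that the value process $V(\Psi):=\theta S+\eta$ is right-continuous and $V_t(\Psi)\in L^2(\Omega,\mathcal F_t,\mathbb P;\mathbb R)$ for each $t$. Its cost process is $C_t(\Psi)=V_t(\Psi)-\int_0^t\theta_s\,dS_s$. $\Psi$ is mean-self-financing if $C(\Psi)$ is an $\mathbb F$-martingale. An $(\mathbb H,\mathbb F)$-admissible strategy $\Psi$ with $V_T(\Psi)=\xi$ $\mathbb P$-a.s. is $(\mathbb H,\mathbb F)$-optimal for $\xi$ if $\Psi$ is mean-self-financing and the $\mathbb F$-martingale $C(\Psi)$ is weakly orthogonal to $M$. ''Minimal cost'' and ''optimal portfolio value'' are simply the names of the cost process and value process of the optimal strategy. *)

(* Defs.v *)
From HB Require Import structures.
From mathcomp Require Import all_boot all_order all_algebra.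
From mathcomp Require Import all_classical all_reals all_analysis.

Set Implicit Arguments.
Unset Strict Implicit.
Unset Printing Implicit Defensive.

Import Order.TTheory GRing.Theory Num.Theory.
Import numFieldNormedType.Exports.

Local Open Scope classical_set_scope.
Local Open Scope ring_scope.

(* A process is a function X : R -> Omega -> R of time and outcome; only its
   values at times in [0, T] matter.  Path properties (right-continuity, left
   limits, monotonicity) and equalities between processes are understood
   almost surely, as usual for complete filtrations. *)

Section Paths.
Context {R : realType}.
Implicit Types (T : R) (f : R -> R).

Definition right_continuous_path T f :=
  forall t, 0 <= t -> t < T -> f s @[s --> t^'+] --> f t.

Definition cadlag_path T f :=
  right_continuous_path T f /\
  forall t, 0 < t -> t <= T -> cvg (f s @[s --> t^'-]).

Definition increasing_path T f :=
  (forall s t, 0 <= s -> s <= t -> t <= T -> f s <= f t) /\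
  right_continuous_path T f.

(* The path f on [0, T], extended by constants to the left of 0 and to the
   right of T; paths that are not increasing and right-continuous (a null set
   of them, below) are replaced by 0, so that the result is always a cumulative
   function. *)
Definition stieltjes_path T f : R -> R := fun t =>
  if `[< increasing_path T f >] then f (Num.max 0 (Num.min t T)) else 0.

Lemma stieltjes_path_nondecreasing T f : nondecreasing (stieltjes_path T f).
Proof.
move=> s t st; rewrite /stieltjes_path; case: asboolP => [[fnd _]|_ //].
have [T0|T0] := leP 0 T; last first.
  by rewrite !(@max_l _ _ 0)// ge_min (ltW T0) orbT.
apply: fnd.
- by rewrite le_max lexx.
- by rewrite ge_max le_max lexx /= le_max le_min !ge_min st lexx !orbT.
- by rewrite ge_max T0 ge_min lexx orbT.
Qed.

Lemma stieltjes_path_right_continuous T f :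
  right_continuous (stieltjes_path T f).
Proof.
move=> t; rewrite /stieltjes_path; case: asboolP => [[_ frc]|_]; last first.
  exact: cvg_cst.
have [T0|T0] := leP T 0.
  rewrite (@max_l _ _ 0) ?ge_min ?T0 ?orbT//.
  apply: cvg_near_cst; near=> s.
  by rewrite (@max_l _ _ 0)// ge_min T0 orbT.
have [t0|t0] := ltP t 0.
  rewrite (@max_l _ _ 0) ?ge_min ?(ltW t0)//.
  apply: cvg_near_cst; near=> s.
  rewrite (@max_l _ _ 0)// ge_min; apply/orP; left.
  by near: s; exact: nbhs_right_le.
have [Tt|tT] := leP T t.
  apply: cvg_near_cst; near=> s.
  by rewrite min_r// (le_trans Tt).
rewrite (@max_r _ _ 0)//; apply: cvg_trans (frc _ t0 tT).
apply: near_eq_cvg; near=> s.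
rewrite min_l; last by near: s; exact: nbhs_right_le.
by rewrite max_r// (le_trans t0).
Unshelve. all: by end_near. Qed.

HB.instance Definition _ T f := isCumulative.Build R _ R (stieltjes_path T f)
  (@stieltjes_path_nondecreasing T f) (@stieltjes_path_right_continuous T f).

End Paths.

Section Processes.
Context {R : realType} {d : measure_display} {Omega : measurableType d}.
Variables (P : probability Omega R) (T : R).
Implicit Types (F G H : R -> set (set Omega)) (X Y M Q : R -> Omega -> R).

Definition sub_measurable (A : set (set Omega)) (X : Omega -> R) :=
  forall B, measurable B -> A (X @^-1` B).

Definition L2 (A : set (set Omega)) (X : Omega -> R) :=
  sub_measurable A X /\ X \in Lfun P 2%:E.

Definition filtration F :=
  [/\ forall t, 0 <= t <= T -> sigma_algebra setT (F t),
      forall t, 0 <= t <= T -> F t `<=` measurable &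
      forall s t, 0 <= s -> s <= t -> t <= T -> F s `<=` F t].

Definition usual_conditions F :=
  [/\ filtration F,
      forall t, 0 <= t -> t < T ->
        F t = \bigcap_(u in [set u | t < u <= T]) F u &
      forall N, P.-negligible N -> F 0 N].

Definition adapted F X := forall t, 0 <= t <= T -> sub_measurable (F t) (X t).

Definition indistinguishable X Y :=
  {ae P, forall w, forall t, 0 <= t <= T -> X t w = Y t w}.

Definition is_cond_exp (A : set (set Omega)) (X Y : Omega -> R) :=
  [/\ sub_measurable A Y, P.-integrable setT (EFin \o X),
      P.-integrable setT (EFin \o Y) &
      forall B, A B ->
        (\int[P]_(w in B) (Y w)%:E = \int[P]_(w in B) (X w)%:E)%E].

Definition martingale F X :=
  [/\ adapted F X,
      forall s t, 0 <= s -> s <= t -> t <= T -> is_cond_exp (F s) (X t) (X s) &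
      {ae P, forall w, cadlag_path T (X ^~ w)}].

Definition square_integrable X :=
  forall t, 0 <= t <= T -> X t \in Lfun P 2%:E.

Definition predictable_rectangles F : set (set (Omega * R)) :=
  [set A `*` [set 0] | A in F 0] `|`
  [set B | exists s t A, [/\ 0 <= s, s < t, t <= T, F s A &
     B = A `*` [set` `]s, t]]]].

Definition predictable F X :=
  let D : set (Omega * R) := setT `*` [set` `[0, T]] in
  forall B, measurable B ->
    <<s D, predictable_rectangles F >> (D `&` [set p | B (X p.2 p.1)]).

(* The integrator d Q(w) on ]0, T] of an increasing process Q. *)
Definition dpath Q (w : Omega) :=
  lebesgue_stieltjes_measure (stieltjes_path T (Q ^~ w)).

Definition predictable_quadratic_variation F M Q :=
  [/\ predictable F Q,
      {ae P, forall w, Q 0 w = 0},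
      {ae P, forall w, increasing_path T (Q ^~ w)} &
      martingale F (fun t w => M t w ^+ 2 - Q t w)].

(* The measure P (x) Q, B |-> E[\int_0^T 1_B dQ]. *)
Definition doleans Q (B : set (Omega * R)) : \bar R :=
  (\int[P]_w dpath Q w ([set` `]0%R, T]] `&` xsection B w))%E.

Definition doleans_ae Q (pr : R -> Omega -> Prop) :=
  exists N : set (Omega * R), [/\ measurable N, doleans Q N = 0%E &
    forall t w, 0 <= t <= T -> ~ N (w, t) -> pr t w].

(* E[\int_0^T |X_s|^2 dQ_s] *)
Definition energy Q X : \bar R :=
  (\int[P]_w \int[dpath Q w]_(s in [set` `]0%R, T]]) ((X s w) ^+ 2)%:E)%E.

Definition M2 F Q X := predictable F X /\ (energy Q X < +oo)%E.

Definition L2mart F X :=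
  [/\ martingale F X, {ae P, forall w, X 0 w = 0} & X T \in Lfun P 2%:E].

(* The simple integrand \sum_i coef i * 1_{]lo i, hi i]}. *)
Record simple_integrand := SimpleIntegrand {
  simple_size : nat ;
  coef : 'I_simple_size -> Omega -> R ;
  lo : 'I_simple_size -> R ;
  hi : 'I_simple_size -> R }.

Definition simple_predictable F (e : simple_integrand) :=
  forall i : 'I_(simple_size e),
  [/\ 0 <= lo i, lo i <= hi i, hi i <= T, sub_measurable (F (lo i)) (coef i) &
      exists c, forall w, `|coef i w| <= c].

Definition simple_process (e : simple_integrand) : R -> Omega -> R := fun t w =>
  \sum_(i < simple_size e) (if lo i < t <= hi i then coef i w else 0).

Definition simple_integral M (e : simple_integrand) : R -> Omega -> R :=
  fun t w => \sum_(i < simple_size e)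
    coef i w * (M (Num.min (hi i) t) w - M (Num.min (lo i) t) w).

(* I is (a version of) the Ito integral process \int_0^. X dM: the
   square-integrable martingale null at 0 that is the L^2-limit of the integrals
   of simple predictable integrands converging to X in L^2(P (x) Q), where Q is
   the predictable quadratic variation of M.  Such an I exists for every X in
   M2 F Q, and is unique up to indistinguishability. *)
Definition ito_integral F M Q X (I : R -> Omega -> R) :=
  [/\ martingale F I, square_integrable I, {ae P, forall w, I 0 w = 0} &
      exists e : nat -> simple_integrand,
      [/\ forall n, simple_predictable F (e n),
          (energy Q (fun t w => (simple_process (e n) t w - X t w)%R)
            @[n --> \oo] --> 0)%E &
          forall t, 0 <= t <= T ->
          (\int[P]_w (((simple_integral M (e n) t w - I t w) ^+ 2)%R)%:E
            @[n --> \oo] --> 0)%E]].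

Definition path_integral Q X : R -> Omega -> R := fun t w =>
  \int[dpath Q w]_(s in [set` `]0, t]]) X s w.

(* G is (a version of) \int_0^. theta dS for dS = dM + alpha d<M>. *)
Definition gains F M Q alpha theta (G : R -> Omega -> R) :=
  exists I, ito_integral F M Q theta I /\
    indistinguishable G (fun t w =>
      I t w + path_integral Q (fun s v => theta s v * alpha s v) t w).

Definition structure_condition F M Q alpha S :=
  [/\ adapted F S, square_integrable S,
      {ae P, forall w, cadlag_path T (S ^~ w)} &
      indistinguishable S (fun t w => S 0 w + M t w + path_integral Q alpha t w)].

(* Meant for O a square-integrable F-martingale. *)
Definition weakly_orthogonal F H M Q (O : R -> Omega -> R) :=
  forall phi I, M2 H Q phi -> ito_integral F M Q phi I ->
    ('E_P[(fun w => O T w * I T w)%R] = 0)%E.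

Definition value (S theta eta : R -> Omega -> R) : R -> Omega -> R :=
  fun t w => theta t w * S t w + eta t w.

Definition admissible F H Q S theta eta :=
  [/\ M2 H Q theta, adapted F eta,
      {ae P, forall w, right_continuous_path T ((value S theta eta) ^~ w)} &
      forall t, 0 <= t <= T -> L2 (F t) (value S theta eta t)].

Definition is_cost F M Q alpha S theta eta (C : R -> Omega -> R) :=
  exists2 G, gains F M Q alpha theta G &
    forall t w, C t w = value S theta eta t w - G t w.

Definition optimal F H M Q alpha S (xi : Omega -> R) theta eta :=
  [/\ admissible F H Q S theta eta,
      {ae P, forall w, value S theta eta T w = xi w} &
      exists C, [/\ is_cost F M Q alpha S theta eta C,
        martingale F C & weakly_orthogonal F H M Q C]].

Definition decomposition F H M Q alpha (xi U0 : Omega -> R) beta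
    (A : R -> Omega -> R) :=
  [/\ L2 (F 0) U0, M2 H Q beta, L2mart F A, weakly_orthogonal F H M Q A &
      exists2 G, gains F M Q alpha beta G &
        {ae P, forall w, xi w = U0 w + G T w + A T w}].

End Processes.

(* Main.v *)
(** A strategy is optimal exactly when its cost [C] is a martingale weakly
    orthogonal to [M], so [U0 = C_0], [A = C - C_0] and [theta = beta] translate
    optimal strategies into decompositions and back.

    For uniqueness, let [phi] be the difference of two integrands, [J] its Ito
    integral, [D] the integral of [phi * alpha] against [Q], and [N] the
    difference of the costs.  The residual [Y = N - J - D] vanishes at [T].  If
    it vanishes at [t], then weak orthogonality of [N], applied to
    [phi * 1_(]s, t])], and the Ito isometry give
      [E(Y_s^2) + E(int_s^t phi^2 dQ) <= E((D_t - D_s)^2)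
         <= K^2 rho(t - s) E(int_s^t phi^2 dQ)],
    the last step by Cauchy-Schwarz.  For [t - s] small both terms on the left
    vanish, and finitely many steps backwards from [T] give [phi = 0]. *)
Require Import Defs.
From HB Require Import structures.
From mathcomp Require Import all_boot all_order all_algebra.
From mathcomp Require Import all_classical all_reals all_analysis.
From mathcomp Require Import measurable_realfun.
From mathcomp Require Import ring lra.
Import Order.TTheory GRing.Theory Num.Theory.
Import numFieldNormedType.Exports.
Local Open Scope classical_set_scope.
Local Open Scope ring_scope.

Set Implicit Arguments.
Unset Strict Implicit.
Unset Printing Implicit Defensive.

(** * Expectations and orthogonality to a sub-sigma-algebra *)

Section CondExp.
Context {R : realType} {d : measure_display} {Omega : measurableType d}.
Variable P : probability Omega R.
Implicit Types (A : set (set Omega)) (X Y Z D : Omega -> R).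

(** The integrals are given by relations: an Ito integral is any suitable L^2-limit of simple
    integrals, and gains are fixed only up to indistinguishability. Facts about them are therefore
    proved for simple integrands and carried to the limit, or proved path by path off a null set.
    Limits are taken in the squared norms themselves, with (x + y)^2 <= (1 + e) x^2 + (1 + 1/e) y^2
    in place of a triangle inequality. The delicate point is measurability: the measure dQ(w) is
    defined path by path, yet its integrals must be measurable for F_t. The increment bound gives it
    mass at most rho(T) on ]0, T], so that after a change on a null set, harmless by completeness,
    these measures form a finite kernel. Weak orthogonality tests only terminal values against
    H-predictable integrands. The difference phi of two such integrands is itself a legitimate test
    integrand, and so is its restriction to ]s, t]; this is why the estimate can be localized. The
    length of a backward step depends on K and rho alone, hence finitely many equal steps reach
    0. *)

Definition integ X := P.-integrable setT (EFin \o X).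
Definition Ex X : R := \int[P]_w X w.

(** On [g_sigma_algebraType A] the closure properties of measurable functions become available for a
    sub-sigma-algebra [A], which is not the canonical one of [Omega]. *)
Lemma sub_measurableP A X : sigma_algebra setT A ->
  sub_measurable A X <-> measurable_fun setT (X : g_sigma_algebraType A -> R).
Proof.
move=> sA; split=> [mX _ B mB|mX B mB].
  by rewrite setTI measurable_g_measurableTypeE//; exact: mX.
by have := mX measurableT B mB; rewrite setTI measurable_g_measurableTypeE.
Qed.

Lemma sub_measurable_fun A X : A `<=` measurable -> sub_measurable A X ->
  measurable_fun setT X.
Proof. by move=> Am mX _ B mB; rewrite setTI; exact/Am/mX. Qed.

Lemma integ_measurable X : integ X -> measurable_fun setT X.
Proof. by move=> /integrableP[/measurable_EFinP]. Qed.

Lemma integD X Y : integ X -> integ Y -> integ (fun w => X w + Y w).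
Proof. by move=> iX iY; exact: (integrableD measurableT iX iY). Qed.

Lemma integB X Y : integ X -> integ Y -> integ (fun w => X w - Y w).
Proof. by move=> iX iY; exact: (integrableB measurableT iX iY). Qed.

Lemma integZ c X : integ X -> integ (fun w => c * X w).
Proof. by move=> iX; exact: (integrableZl measurableT c iX). Qed.

Lemma integ_le X Y : measurable_fun setT X -> (forall w, `|X w| <= Y w) ->
  integ Y -> integ X.
Proof.
move=> mX XY; apply: le_integrable => //; first exact/measurable_EFinP.
by move=> w _ /=; rewrite lee_fin (le_trans (XY w)) ?ler_norm.
Qed.

Lemma integ_sum n (X : 'I_n -> Omega -> R) : (forall i, integ (X i)) ->
  integ (fun w => \sum_(i < n) X i w).
Proof.
move=> iX; have := @integrable_sum _ _ _ P setT measurableT _ (index_enum 'I_n) xpredT _ (fun i _ => iX i).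
by apply: eq_integrable => // w _; rewrite /= sumEFin.
Qed.

Lemma ExD X Y : integ X -> integ Y -> Ex (fun w => X w + Y w) = Ex X + Ex Y.
Proof. by move=> *; exact: RintegralD. Qed.

Lemma ExB X Y : integ X -> integ Y -> Ex (fun w => X w - Y w) = Ex X - Ex Y.
Proof. by move=> *; exact: RintegralB. Qed.

Lemma ExZ c X : integ X -> Ex (fun w => c * X w) = c * Ex X.
Proof. by move=> *; exact: RintegralZl. Qed.

Lemma ExE X : integ X -> (\int[P]_w (X w)%:E)%E = (Ex X)%:E.
Proof. by move=> iX; rewrite /Ex /Rintegral fineK// integrable_fin_num. Qed.

Lemma Ex_cst c : Ex (fun=> c) = c.
Proof. by rewrite /Ex Rintegral_cst//= probability_setT mulr1. Qed.

Lemma integM01 D Z : measurable_fun setT Z -> (exists c, forall w, `|Z w| <= c) ->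
  integ D -> integ (fun w => Z w * D w).
Proof.
move=> mZ [c Zc] iD; apply: (@integ_le _ (fun w => c * `|D w|)).
- by apply: measurable_funM => //; exact: integ_measurable.
- by move=> w; rewrite normrM ler_wpM2r.
- by apply: integZ; exact: integrable_norm.
Qed.

Lemma eq_Ex X Y : X =1 Y -> Ex X = Ex Y.
Proof. by move=> XY; apply: eq_Rintegral => w _; rewrite XY. Qed.

Lemma eq_integ X Y : X =1 Y -> integ X -> integ Y.
Proof. by move=> /funext ->. Qed.

Lemma Ex_sum n (X : 'I_n -> Omega -> R) : (forall i, integ (X i)) ->
  Ex (fun w => \sum_(i < n) X i w) = \sum_(i < n) Ex (X i).
Proof.
elim: n X => [|n IH] X iX.
  by rewrite big_ord0; under eq_Ex do rewrite big_ord0; exact: Ex_cst.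
rewrite big_ord_recr/= -IH// -ExD//; last exact: integ_sum.
by apply: eq_Ex => w; rewrite big_ord_recr.
Qed.

Lemma ler_Ex X Y : integ X -> integ Y -> (forall w, X w <= Y w) -> Ex X <= Ex Y.
Proof. by move=> iX iY XY; exact: le_Rintegral. Qed.

Lemma normr_Ex X : integ X -> `|Ex X| <= Ex (fun w => `|X w|).
Proof. by move=> iX; exact: le_normr_Rintegral. Qed.

Lemma integ_norm X : integ X -> integ (fun w => `|X w|).
Proof. exact: integrable_norm. Qed.

Lemma ae_Ex X Y : measurable_fun setT X -> measurable_fun setT Y ->
  {ae P, forall w, X w = Y w} -> Ex X = Ex Y.
Proof.
move=> mX mY XY; congr fine; apply: ae_eq_integral => //; [exact/measurable_EFinP..|].
by apply: filterS XY => w /= -> .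
Qed.

(* [\sum_(k < n) (x >= k.+1)] is the truncation of [x] when [x <= n]. *)
Lemma sum_threshold n (x : R) : 0 <= x -> x <= n%:R ->
  `|x - \sum_(k < n) ((k.+1)%:R <= x)%R%:R| <= 1.
Proof.
move=> x0.
(* The last clause says that either all thresholds so far are passed, or the sum is already within 1
   of [x], in which case no further threshold is passed. *)
have H : forall m, let s := (\sum_(k < m) ((k.+1)%:R <= x)%R%:R : R) in
  [/\ s <= x, s <= m%:R & (s = m%:R) \/ x < s + 1].
  elim=> [|m [sx sm H]]/=; first by rewrite big_ord0; split => //; left.
  rewrite big_ord_recr/=; case: H => [sE|xs].
    rewrite sE in sx sm *; case: (leP (m.+1)%:R x) => mx /=.
      by rewrite natr1; split => //; left.
    by rewrite addr0; split => //; [rewrite ler_nat|right; rewrite natr1].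
  have -> : ((m.+1)%:R <= x) = false.
    by apply/negbTE; rewrite -ltNge (lt_le_trans xs)// -natr1 lerD2r.
  by rewrite addr0; split => //; [rewrite (le_trans sm)// ler_nat|right].
move=> xn; have [sx sn [sE|xs]] := H n.
  by rewrite ler_norml; apply/andP; split; lra.
by rewrite ler_norml; apply/andP; split; lra.
Qed.

Lemma integ_restrict (B : set Omega) D : measurable B -> integ D ->
  Ex (fun w => \1_B w * D w) = \int[P]_(w in B) D w.
Proof.
move=> mA iD; rewrite [RHS]Rintegral_mkcond; apply: eq_Ex => w.
by rewrite patchE indicE; case: ifPn; rewrite ?mul1r ?mul0r.
Qed.

(** For an indicator this is the hypothesis on [D]. A [Z] with values in [0, 1] is a uniform limit
    of step functions with steps in [A], so [|E[Z D]|] is at most [E|D| / (n + 1)] for every n. *)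
Lemma Ex_orth01 A D Z : A `<=` measurable ->
  integ D -> (forall B, A B -> \int[P]_(w in B) D w = 0) ->
  sub_measurable A Z -> (forall w, 0 <= Z w <= 1) ->
  Ex (fun w => Z w * D w) = 0.
Proof.
move=> Am iD D0 mZ Z01; have mZ' := sub_measurable_fun Am mZ.
have iZD : integ (fun w => Z w * D w).
  apply: integM01 => //; exists 1 => w.
  by have /andP[Z0 Z1] := Z01 w; rewrite ger0_norm.
(* Layers of height 1/(n+1): [Zn] below counts the levels (k+1)/(n+1) that [Z] reaches, so it rounds
   [Z] down to the grid, and [sum_threshold] bounds the error. *)
pose B n k := Z @^-1` `[(k.+1)%:R / n.+1%:R, +oo[.
have AB n k : A (B n k) by exact: mZ.
have mB n k : measurable (B n k) by exact/Am.
pose Zn n w := \sum_(k < n.+1) n.+1%:R^-1 * \1_(B n k) w : R.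
have iZnk n (k : 'I_n.+1) : integ (fun w => n.+1%:R^-1 * (\1_(B n k) w * D w)).
  apply: integZ; apply: integM01 => //; exists 1 => w.
  by rewrite indicE; case: (_ \in _); rewrite ?normr1 ?normr0.
have EZn n : Ex (fun w => Zn n w * D w) = 0.
  under eq_Ex do rewrite mulr_suml.
  under eq_Ex => w do under eq_bigr do rewrite -mulrA.
  rewrite Ex_sum//; apply: big1 => k _.
  rewrite ExZ; first by rewrite integ_restrict// D0// mulr0.
  apply: integM01 => //; exists 1 => w.
  by rewrite indicE; case: (_ \in _); rewrite ?normr1 ?normr0.
have iZn n : integ (fun w => Zn n w * D w).
  apply: eq_integ (integ_sum (iZnk n)) => w.
  by rewrite mulr_suml; apply: eq_bigr => k _; rewrite mulrA.
have ZZn n w : `|Z w - Zn n w| <= n.+1%:R^-1.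
  have n0 : 0 < n.+1%:R :> R by [].
  rewrite -(ler_pM2l n0) divff ?gt_eqF// -{1}(gtr0_norm n0) -normrM mulrBr.
  rewrite mulr_sumr.
  under eq_bigr => k _.
    rewrite mulrA divff ?gt_eqF// mul1r indicE /B.
    have -> : (w \in Z @^-1` `[k.+1%:R / n.+1%:R, +oo[) =
        (k.+1%:R <= n.+1%:R * Z w).
      by apply/idP/idP; rewrite in_setE/= in_itv/= andbT ler_pdivrMr// mulrC.
    over.
  have /andP[Z0 Z1] := Z01 w.
  by apply: sum_threshold; [rewrite mulr_ge0|rewrite ler_piMr].
apply/eqP; rewrite -normr_le0; apply/ler_addgt0Pl => e e0; rewrite addr0.
have [n ne] : exists n, n.+1%:R^-1 * Ex (fun w => `|D w|) <= e.
  have c0 : 0 <= Ex (fun w => `|D w|) by apply: Rintegral_ge0.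
  exists (Num.truncn (Ex (fun w => `|D w|) / e)).
  rewrite mulrC ler_pdivrMr// mulrC -ler_pdivrMr//.
  exact/ltW/truncnS_gt.
apply: le_trans ne; rewrite -[Ex _]subr0 -{1}(EZn n) -ExB//.
rewrite -ExZ; last exact: integ_norm.
apply: le_trans (normr_Ex (integB iZD (iZn n))) _.
apply: ler_Ex; [exact/integ_norm/integB|exact/integZ/integ_norm|move=> w].
by rewrite -mulrBl normrM ler_wpM2r.
Qed.

(** An affine change of variable brings [Z] into [0, 1]; the multiple of [D] that it leaves
    integrates to 0 because [setT] belongs to [A]. *)
Lemma Ex_orth_bounded A D Z c : A `<=` measurable -> sigma_algebra setT A ->
  integ D -> (forall B, A B -> \int[P]_(w in B) D w = 0) ->
  sub_measurable A Z -> (forall w, `|Z w| <= c) ->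
  Ex (fun w => Z w * D w) = 0.
Proof.
move=> Am sA iD D0 mZ Zc; have mZ' := sub_measurable_fun Am mZ.
(* The added 1 keeps [c'] positive when [c = 0]. *)
pose c' := `|c| + 1; have c'0 : 0 < c' by rewrite ltr_wpDl.
pose Z1 w := (2 * c')^-1 * (Z w + c').
have ZE w : Z w = 2 * c' * Z1 w - c'.
  by rewrite /Z1 mulrA divff ?mul1r ?addrK// mulf_neq0 ?gt_eqF.
have Z1D : Ex (fun w => Z1 w * D w) = 0.
  apply: (@Ex_orth01 A) => //.
    apply/sub_measurableP => //; apply: measurable_funM => //.
    by apply: measurable_funD => //; exact/sub_measurableP.
  move=> w; have := Zc w; rewrite ler_norml => /andP[Z1' Z2].
  have cc : c <= c' - 1 by rewrite addrK ler_norm.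
  rewrite /Z1 mulrC divr_ge0 ?ler_pdivrMr//=; try lra; by rewrite mulr_gt0.
have iZ1 : integ (fun w => Z1 w * D w).
  apply: integM01 => //.
    by apply: measurable_funM => //; exact: measurable_funD.
  exists ((2 * c')^-1 * (`|c| + c')) => w.
  rewrite normrM gtr0_norm ?invr_gt0 ?mulr_gt0//.
  rewrite ler_wpM2l ?invr_ge0 ?mulr_ge0 ?(ltW c'0)//.
  apply: le_trans (ler_normD _ _) _; rewrite (gtr0_norm c'0) lerD2r.
  by rewrite (le_trans (Zc w)) ?ler_norm.
under eq_Ex => w do rewrite ZE mulrBl -(mulrA (2 * c')).
rewrite ExB; [|exact: (integZ _ iZ1)|exact: (integZ _ iD)].
rewrite !ExZ// Z1D mulr0 sub0r; apply/eqP; rewrite oppr_eq0; apply/eqP.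
have -> : Ex D = \int[P]_(w in setT) D w by [].
rewrite D0 ?mulr0//; have [A0 AC _] := sA.
by have := AC _ A0; rewrite setD0.
Qed.

(** The truncations of [Z] are bounded multipliers, and [|Z D|] dominates the products.
    Integrability of the product is the common ground of a bounded [Z] with an integrable [D] and of
    two square-integrable factors. *)
Lemma Ex_orth A D Z : A `<=` measurable -> sigma_algebra setT A ->
  integ D -> integ (fun w => Z w * D w) ->
  (forall B, A B -> \int[P]_(w in B) D w = 0) ->
  sub_measurable A Z ->
  Ex (fun w => Z w * D w) = 0.
Proof.
move=> Am sA iD iZD D0 mZ; have mZ' := sub_measurable_fun Am mZ.
have sZ : measurable_fun setT (Z : g_sigma_algebraType A -> R).
  exact/sub_measurableP.
pose Zn n w := if `|Z w| <= n%:R then Z w else 0.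
have mZn n : sub_measurable A (Zn n).
  apply/sub_measurableP => //; apply: measurable_fun_ifT => //.
  apply: measurable_fun_ler => //; exact: measurableT_comp.
have Zn0 n : Ex (fun w => Zn n w * D w) = 0.
  apply: (@Ex_orth_bounded A _ _ n%:R) => // w.
  by rewrite /Zn; case: ifP => //; rewrite normr0.
have mD := integ_measurable iD.
have [|||||_ _] := @dominated_convergence _ _ _ P setT measurableT
  (fun n w => (Zn n w * D w)%:E) (fun w => (Z w * D w)%:E)
  (fun w => `|Z w * D w|%:E).
- move=> n; apply/measurable_EFinP; apply: measurable_funM => //.
  exact: sub_measurable_fun (mZn n).
- by apply/measurable_EFinP; exact: measurable_funM.
- apply: aeW => w _; apply: cvg_near_cst; near=> n; congr (_ * _)%:E.
  rewrite /Zn ifT//; near: n; exact: nbhs_infty_ger.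
- exact: integ_norm.
- apply: aeW => w n _; rewrite /= lee_fin !normrM ler_wpM2r// /Zn.
  by case: ifP => //; rewrite normr0.
under eq_fun => n.
  rewrite ExE; last first.
    apply: integM01 => //; first exact: sub_measurable_fun (mZn n).
    by exists n%:R => w; rewrite /Zn; case: ifP => //; rewrite normr0.
  rewrite Zn0; over.
move=> h; have := cvg_unique _ (cvg_cst (0%E : \bar R)) h.
by rewrite /Ex /Rintegral => <-.
Unshelve. all: by end_near. Qed.

End CondExp.

(** * Square-integrable random variables and conditional expectations *)

Section SquareIntegrable.
Context {R : realType} {d : measure_display} {Omega : measurableType d}.
Variable P : probability Omega R.
Implicit Types (A : set (set Omega)) (X Y Z : Omega -> R).
Local Notation integ := (integ P).
Local Notation Ex := (Ex P).

Definition sqi X := X \in Lfun P 2%:E.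

Lemma sqi_measurable X : sqi X -> measurable_fun setT X.
Proof. by rewrite /sqi inE => /andP[/[!inE]]. Qed.

Lemma sqi_sqr X : sqi X -> integ (fun w => X w ^+ 2).
Proof. exact: Lfun2_integrable_sqr. Qed.

Lemma sqiP X : sqi X <-> measurable_fun setT X /\ integ (fun w => X w ^+ 2).
Proof.
split=> [sX|[mX iX]]; first by split; [exact: sqi_measurable|exact: sqi_sqr].
rewrite /sqi inE; apply/andP; split; rewrite inE//=.
rewrite /finite_norm unlock poweR_lty//.
move/integrableP : iX => [_]; congr (_ < _)%E; apply: eq_integral => w _.
by rewrite /= powR_mulrn ?normr_ge0// normrX.
Qed.

Lemma sqi_mul X Y : sqi X -> sqi Y -> integ (fun w => X w * Y w).
Proof. by move=> sX sY; apply/Lfun1_integrable; exact: Lfun2_mul_Lfun1. Qed.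

Lemma sqi_cst c : sqi (fun=> c).
Proof. exact: Lfun_cst. Qed.

Lemma sqi_integ X : sqi X -> integ X.
Proof.
move=> sX; apply: eq_integ (sqi_mul (sqi_cst 1) sX) => w; exact: mul1r.
Qed.

Lemma sqiD X Y : sqi X -> sqi Y -> sqi (fun w => X w + Y w).
Proof.
move=> sX sY; apply/sqiP; split.
  by apply: measurable_funD; exact: sqi_measurable.
under eq_fun do rewrite sqrrD.
apply: integD; last exact: sqi_sqr.
apply: integD; first exact: sqi_sqr.
by apply: eq_integ (integZ 2 (sqi_mul sX sY)) => w; rewrite mulr_natl.
Qed.

Lemma sqiM X Z c : measurable_fun setT Z -> (forall w, `|Z w| <= c) -> sqi X ->
  sqi (fun w => Z w * X w).
Proof.
move=> mZ Zc sX; apply/sqiP; split.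
  by apply: measurable_funM => //; exact: sqi_measurable.
under eq_fun do rewrite exprMn.
apply: integM01 (sqi_sqr sX); first exact: measurable_funX.
by exists (c ^+ 2) => w; rewrite normrX lerXn2r// ?nnegrE// (le_trans _ (Zc w)).
Qed.

Lemma sqiZ c X : sqi X -> sqi (fun w => c * X w).
Proof. by move=> sX; apply: sqiM sX => //; exact: measurable_cst. Qed.

Lemma sqiB X Y : sqi X -> sqi Y -> sqi (fun w => X w - Y w).
Proof.
move=> sX /(sqiZ (-1)) sY; have := sqiD sX sY.
by under eq_fun do rewrite mulN1r.
Qed.

Lemma cond_exp_orth A X Y : A `<=` measurable -> is_cond_exp P A X Y ->
  integ (fun w => X w - Y w) /\
  forall B, A B -> \int[P]_(w in B) (X w - Y w) = 0.
Proof.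
move=> Am [_ iX iY XY]; split; first exact: integB.
move=> B AB; have mB := Am _ AB.
rewrite RintegralB//; try exact: integrableS measurableT _ _ _.
by rewrite /Rintegral XY// subrr.
Qed.

Lemma cond_expP A X Y : A `<=` measurable -> sub_measurable A Y -> integ X -> integ Y ->
  (forall B, A B -> Ex (fun w => \1_B w * X w) = Ex (fun w => \1_B w * Y w)) ->
  is_cond_exp P A X Y.
Proof.
move=> Am mY iX iY XY; split => // B AB; have mB := Am _ AB.
have := XY _ AB; rewrite !integ_restrict// /Rintegral => h.
rewrite -[LHS]fineK; last first.
  by apply: integrable_fin_num => //; exact: integrableS measurableT _ _ iY.
rewrite -[RHS]fineK -?h//.
by apply: integrable_fin_num => //; exact: integrableS measurableT _ _ iX.
Qed.

Lemma cond_exp_mul A X Y Z : A `<=` measurable -> sigma_algebra setT A ->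
  is_cond_exp P A X Y -> sub_measurable A Z ->
  integ (fun w => Z w * X w) -> integ (fun w => Z w * Y w) ->
  Ex (fun w => Z w * X w) = Ex (fun w => Z w * Y w).
Proof.
move=> Am sA XY mZ iX iY; have [iD D0] := cond_exp_orth Am XY.
apply/eqP; rewrite -subr_eq0 -ExB//; apply/eqP.
under eq_Ex do rewrite -mulrBr.
apply: (Ex_orth Am sA) => //.
by under eq_fun do rewrite mulrBr; exact: integB.
Qed.

(** Conditional Jensen for the square, by duality: for the truncation [Yn] of [Y], [E[Yn^2] =
    E[Yn Y] = E[Yn X] <= (E[Yn^2] + E[X^2]) / 2]. Truncation makes [E[Yn^2]] finite, so it can be
    moved across to give [E[Yn^2] <= E[X^2]], and monotone convergence concludes. *)
Lemma cond_exp_sqi A X Y : A `<=` measurable -> sigma_algebra setT A ->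
  is_cond_exp P A X Y -> sqi X -> sqi Y.
Proof.
move=> Am sA XY sX; have [mY iX iY _] := XY.
have mY' := sub_measurable_fun Am mY.
pose Yn n w := if `|Y w| <= n%:R then Y w else 0.
have Yn_le n w : `|Yn n w| <= n%:R by rewrite /Yn; case: ifP; rewrite ?normr0.
have mYn n : sub_measurable A (Yn n).
  apply/sub_measurableP => //.
  have sY : measurable_fun setT (Y : g_sigma_algebraType A -> R) by exact/sub_measurableP.
  apply: measurable_fun_ifT => //.
  by apply: measurable_fun_ler => //; exact: measurableT_comp.
have mYn' n := sub_measurable_fun Am (mYn n).
have iYnX n : integ (fun w => Yn n w * X w) by apply: integM01 => //; exists n%:R.
have iYnY n : integ (fun w => Yn n w * Y w) by apply: integM01 => //; exists n%:R.
have YnE n w : Yn n w * Y w = Yn n w ^+ 2.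
  by rewrite /Yn expr2; case: ifP => //; rewrite !mul0r.
have bound n : Ex (fun w => Yn n w ^+ 2) <= Ex (fun w => X w ^+ 2).
  have iYn2 : integ (fun w => Yn n w ^+ 2) by apply: eq_integ (iYnY n).
  have h : Ex (fun w => Yn n w ^+ 2) = Ex (fun w => Yn n w * X w).
    rewrite (cond_exp_mul Am sA XY (mYn n))//.
    by apply: eq_Ex => w; rewrite YnE.
  have : Ex (fun w => Yn n w * X w) <=
      Ex (fun w => 2^-1 * (Yn n w ^+ 2 + X w ^+ 2)).
    apply: ler_Ex => //; first exact/integZ/integD/sqi_sqr.
    by move=> w; have := sqr_ge0 (Yn n w - X w); rewrite sqrrB; lra.
  rewrite -h ExZ; last exact/integD/sqi_sqr.
  by rewrite ExD//; [lra|exact: sqi_sqr].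
apply/sqiP; split => //; apply/integrableP; split.
  by apply/measurable_EFinP; exact: measurable_funX.
apply: (@le_lt_trans _ _ (Ex (fun w => X w ^+ 2))%:E); last exact: ltry.
have -> : (\int[P]_w `|(EFin \o (fun w => (Y w ^+ 2)%R)) w|)%E =
    (\int[P]_w limn (fun n => (Yn n w ^+ 2)%:E))%E.
  apply: eq_integral => w _; apply/esym/cvg_lim => //; apply: cvg_near_cst.
  near=> n; rewrite /= ger0_norm ?sqr_ge0// /Yn ifT//.
  by near: n; exact: nbhs_infty_ger.
apply: cvge_le (@cvg_monotone_convergence _ _ _ P setT measurableT
  (fun n w => (Yn n w ^+ 2)%:E) _ _ _).
- near=> n; rewrite ExE ?lee_fin//; exact: eq_integ (iYnY n).
- by move=> n; apply/measurable_EFinP; exact: measurable_funX.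
- by move=> n w _; rewrite lee_fin sqr_ge0.
- move=> w _ m n mn; rewrite lee_fin /Yn; case: ifPn => [Ym|_]; last first.
    by rewrite expr0n/= sqr_ge0.
  by rewrite ifT// (le_trans Ym)// ler_nat.
Unshelve. all: by end_near. Qed.

End SquareIntegrable.

(** * Measurability of Stieltjes integrals *)

Section StieltjesKernel.
Context {R : realType}.

Lemma stieltjes_measure_itv (f : cumulative R R) (a b : R) : a <= b ->
  lebesgue_stieltjes_measure f `]a, b] = (f b - f a)%:E.
Proof.
move=> ab; rewrite /lebesgue_stieltjes_measure /measure_extension/=.
by rewrite measurable_mu_extE/= ?wlength_itv_bnd//; exact: is_ocitv.
Qed.

Lemma stieltjes_pathE T (f : R -> R) t : increasing_path T f -> 0 <= t <= T ->
  stieltjes_path T f t = f t.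
Proof.
move=> incf /andP[t0 tT]; rewrite /stieltjes_path; case: asboolP => // _.
by rewrite min_l// max_r.
Qed.

Lemma stieltjes_path_itv T (f : R -> R) a b : increasing_path T f ->
  0 <= a -> a <= b -> b <= T ->
  lebesgue_stieltjes_measure (stieltjes_path T f) `]a, b] = (f b - f a)%:E.
Proof.
move=> incf a0 ab bT; rewrite stieltjes_measure_itv//= !stieltjes_pathE//.
  by rewrite a0 (le_trans ab).
by rewrite (le_trans a0).
Qed.

Context {d : measure_display} {X : measurableType d}.
Variables (q : R -> X -> R) (T t r : R).
Hypotheses (t0 : 0 <= t) (tT : t <= T).
Hypothesis q_inc : forall x, increasing_path T (q ^~ x).
Hypothesis q_meas : forall u, 0 <= u <= t -> measurable_fun setT (q u).
Hypothesis q_bnd : forall x, q t x - q 0 x < r.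

(** Restriction to ]0, t] makes the total mass finite and lets the measure depend on [q] only up to
    time t, which is what adaptedness controls. *)
Definition restricted_stieltjes (x : X) : {measure set (measurableTypeR R) -> \bar R} :=
  mrestr (lebesgue_stieltjes_measure (stieltjes_path T (q ^~ x)))
    (measurable_itv `]0, t]).

Lemma restricted_stieltjes_uub : measure_fam_uub restricted_stieltjes.
Proof.
exists r => x; rewrite /restricted_stieltjes/= /mrestr/= setTI.
by rewrite stieltjes_path_itv// lte_fin.
Qed.

(** Half-open intervals form a pi-system on which the measure is a difference of values of [q] at
    times in [0, t]. The pi-lambda theorem extends measurability to all Borel sets, finiteness of
    the mass serving for complements. *)
Lemma measurable_restricted_stieltjes (U : set (measurableTypeR R)) : measurable U ->
  measurable_fun setT (restricted_stieltjes ^~ U).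
Proof.
move=> mU.
have fin A x : measurable A -> restricted_stieltjes x A \is a fin_num.
  move=> mA; rewrite ge0_fin_numE// (le_lt_trans _ (ltry r))//.
  have [r' _] := restricted_stieltjes_uub.
  apply: (@le_trans _ _ (restricted_stieltjes x setT)).
    by rewrite le_measure// inE.
  rewrite /restricted_stieltjes/= /mrestr/= setTI.
  by rewrite stieltjes_path_itv// lee_fin ltW.
have mT : measurable_fun setT (restricted_stieltjes ^~ setT).
  rewrite /restricted_stieltjes/= /mrestr/=.
  under eq_fun do rewrite setTI stieltjes_path_itv//.
  by apply/measurable_EFinP; apply: measurable_funB; apply: q_meas; rewrite ?lexx ?t0.
have := @dynkin_induction _ (measurableTypeR R) (@ocitv R)
  (fun U => measurable_fun setT (restricted_stieltjes ^~ U)) erefl (@ocitvI R).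
apply => //.
- move=> _ [[a b] _ <-] /=.
  have -> : (fun x => mrestr (lebesgue_stieltjes_measure (stieltjes_path T (q^~ x)))
        (measurable_itv `]0%R, t]) `]a, b]%classic) =
      (fun x => lebesgue_stieltjes_measure (stieltjes_path T (q^~ x))
        `]Num.max a 0, Num.min b t]%classic).
    apply/funext => x; congr (lebesgue_stieltjes_measure _ _).
    apply/seteqP; split=> s /=; rewrite !in_itv/= gt_max le_min.
      by move=> [/andP[-> ->] /andP[-> ->]].
    by move=> /andP[/andP[-> ->] /andP[-> ->]].
  have [ab|ba] := leP (Num.max a 0) (Num.min b t); last first.
    rewrite set_itv_ge -?leNgt ?bnd_simp ?ltW//.
    rewrite (_ : (fun x => _) = cst 0%E); first exact: measurable_cst.
    by apply/funext => x; rewrite /= measure0.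
  have max0 : 0 <= Num.max a 0 by rewrite le_max lexx orbT.
  have mint : Num.min b t <= t by rewrite ge_min lexx orbT.
  under eq_fun do rewrite stieltjes_path_itv// ?(le_trans mint)//.
  apply/measurable_EFinP; apply: measurable_funB; apply: q_meas.
    by rewrite (le_trans max0).
  by rewrite max0 (le_trans ab).
- move=> S mS PS; rewrite (_ : (fun x => _) = (fun x => restricted_stieltjes x setT - restricted_stieltjes x S)%E).
    by apply: emeasurable_funB.
  by apply/funext => x; rewrite -setTD measureD ?setTI// -ge0_fin_numE ?fin.
- move=> F mF tF PF.
  rewrite (_ : (fun x => _) = (fun x => \sum_(k <oo) restricted_stieltjes x (F k))%E).
    exact: ge0_emeasurable_sum.
  by apply/funext => x; rewrite measure_semi_bigcup//; exact: bigcup_measurable.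
Qed.

HB.instance Definition _ :=
  isKernel.Build _ _ _ _ R restricted_stieltjes measurable_restricted_stieltjes.

HB.instance Definition _ := Kernel_isFinite.Build _ _ _ _ R
  restricted_stieltjes restricted_stieltjes_uub.

Lemma measurable_stieltjes_integral (k : X * measurableTypeR R -> \bar R) :
  (forall z, 0 <= k z)%E ->
  measurable_fun (setT `*` [set` `]0, t]]) k ->
  measurable_fun setT (fun x =>
   (\int[lebesgue_stieltjes_measure (stieltjes_path T (q ^~ x))]_(s in [set` `]0%R, t]]) k (x, s))%E).
Proof.
move=> k0 mk.
have mD : measurable (setT `*` [set` `]0, t]] : set (X * measurableTypeR R)).
  by apply: measurableX => //; exact: measurable_itv.
(* Extending [k] by 0 outside the strip makes it measurable on the whole product, as the theorem on
   finite kernels requires. *)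
rewrite (_ : (fun x => _) = (fun x =>
  \int[restricted_stieltjes x]_s (k \_ (setT `*` [set` `]0%R, t]])) (x, s))%E).
  apply: measurable_fun_integral_finite_kernel.
    by move=> z; rewrite patchE; case: ifP.
  by have /(_ mk) := (measurable_restrictT k mD).1.
apply/funext => x.
transitivity (\int[restricted_stieltjes x]_(s in [set` `]0%R, t]]) k (x, s))%E.
  apply: eq_measure_integral => A mA A0t.
  by rewrite /restricted_stieltjes/= /mrestr setIidl.
rewrite integral_mkcond; apply: eq_integral => s _; rewrite !patchE.
by rewrite in_setX in_setT.
Qed.

End StieltjesKernel.

(** * Predictable processes and integrals adapted to a complete filtration *)

Section Predictable.
Context {R : realType} {d : measure_display} {Omega : measurableType d}.
Variables (P : probability Omega R) (T : R) (F : R -> set (set Omega)).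
Hypotheses (T0 : 0 < T) (hF : usual_conditions P T F).
Implicit Types (Q X Y : R -> Omega -> R) (t : R).

Lemma usual_sigma_algebra t : 0 <= t <= T -> sigma_algebra setT (F t).
Proof. by move=> t0T; have [[sF _ _] _ _] := hF; exact: sF. Qed.

Lemma usual_measurable t : 0 <= t <= T -> F t `<=` measurable.
Proof. by move=> t0T; have [[_ mF _] _ _] := hF; exact: mF. Qed.

Lemma usual_mono s t : 0 <= s -> s <= t -> t <= T -> F s `<=` F t.
Proof. by move=> *; have [[_ _ mF] _ _] := hF; exact: mF. Qed.

Lemma usual_negligible t N : 0 <= t <= T -> P.-negligible N -> F t N.
Proof.
move=> /andP[t0 tT] nN; have [_ _ cF] := hF.
exact/(usual_mono (lexx 0) t0 tT)/cF.
Qed.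

(** All subsets of null sets belong to [F t], so a change on a null set preserves measurability. The
    target is arbitrary since both real and extended real functions occur. *)
Lemma usual_ae_measurable d' (Y : measurableType d') (f g : Omega -> Y) t :
  0 <= t <= T -> {ae P, forall w, f w = g w} ->
  measurable_fun setT (f : g_sigma_algebraType (F t) -> Y) ->
  measurable_fun setT (g : g_sigma_algebraType (F t) -> Y).
Proof.
move=> t0T fg mf _ B mB.
pose N := [set w | f w <> g w].
have nN : P.-negligible N by [].
have sF := usual_sigma_algebra t0T.
have FN A : A `<=` N -> measurable (A : set (g_sigma_algebraType (F t))).
  move=> AN; rewrite measurable_g_measurableTypeE//.
  by apply: usual_negligible => //; exact: negligibleS nN.
rewrite setTI (_ : g @^-1` B = (f @^-1` B `\` N) `|` (g @^-1` B `&` N)).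
  apply: measurableU; last by apply: FN => w [].
  by apply: measurableD; [rewrite -[X in measurable X]setTI; exact: mf|exact: FN].
apply/seteqP; split=> w /=.
  move=> Bg; have [Nw|/contrapT fgw] := pselect (N w); first by right.
  by left; split; rewrite ?fgw// /N/= => /(_ fgw).
by case=> [[Bf /contrapT fgw]|[]//]; rewrite -fgw.
Qed.

(** The sets whose section at time t lies in [F t] form a sigma-algebra, and a rectangle over ]s, u]
    has at time t either an empty section or one from [F s] with s < t. *)
Lemma predictable_adapted X : predictable T F X -> adapted T F X.
Proof.
move=> pX t /[dup] t0T /andP[t0 tT] B mB.
have sF := usual_sigma_algebra t0T.
pose D : set (Omega * R) := setT `*` [set` `[0, T]].
pose G := [set C : set (Omega * R) | F t [set w | C (w, t)]].
suff GD : <<s D, predictable_rectangles T F >> `<=` G.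
  have := GD _ (pX B mB); rewrite /G/=.
  rewrite (_ : [set w | _] = X t @^-1` B)//; apply/seteqP; split=> w /=; first by case.
  by move=> ?; split => //; split => //=; rewrite in_itv/= t0.
have [F0 FC FU] := sF.
have FT : F t setT by have := FC _ F0; rewrite setD0.
apply: smallest_sub.
  split; rewrite /G/=.
  - by rewrite (_ : [set _ | _] = set0).
  - move=> A FA; rewrite (_ : [set _ | _] = setT `\` [set w | A (w, t)]); first exact: FC.
    apply/seteqP; split=> w /=; first by case.
    by move=> [_ ?]; split => //; split => //=; rewrite in_itv/= t0.
  - move=> A FA; rewrite (_ : [set _ | _] = \bigcup_i [set w | A i (w, t)]); first exact: FU.
    by apply/seteqP; split=> w [i _ ?]; exists i.
move=> C [[A FA <-]|[s [u [A [s0 su uT FA ->]]]]]; rewrite /G/=.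
  have [t0'|t0'] := eqVneq t 0.
    rewrite (_ : [set _ | _] = A) ?t0'//.
    by apply/seteqP; split=> w /=; [case|split].
  rewrite (_ : [set _ | _] = set0)//.
  by apply/seteqP; split=> w //= [_ t00]; rewrite t00 eqxx in t0'.
have [stu|stu] := boolP (t \in `]s, u]).
  rewrite (_ : [set _ | _] = A); last by apply/seteqP; split=> w /=; [case|split].
  by apply: usual_mono FA => //; move: stu; rewrite in_itv/= => /andP[/ltW].
rewrite (_ : [set _ | _] = set0)//.
by apply/seteqP; split=> w //= [_ tsu]; rewrite tsu in stu.
Qed.

(** Progressive measurability at time t, with time 0 left out since all integrals are over ]0,
    t]. *)
Definition joint_measurable t X := measurable_fun (setT `*` [set` `]0, t]])
  (fun p : g_sigma_algebraType (F t) * measurableTypeR R => X p.2 p.1).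

Lemma predictable_joint X t : 0 <= t <= T -> predictable T F X ->
  joint_measurable t X.
Proof.
move=> /[dup] t0T /andP[t0 tT] pX.
have sF := usual_sigma_algebra t0T.
pose D : set (Omega * R) := setT `*` [set` `[0, T]].
pose E : set (g_sigma_algebraType (F t) * measurableTypeR R) := setT `*` [set` `]0, t]].
have mE : measurable E by apply: measurableX => //; exact: measurable_itv.
have ED : E `<=` D.
  move=> [w s] [_ /=]; rewrite /D/= !in_itv/= => /andP[s0 st]; split => //.
  by rewrite ltW//= (le_trans st).
pose G := [set C : set (Omega * R) | measurable (E `&` C)].
suff GD : <<s D, predictable_rectangles T F >> `<=` G.
  move=> _ B mB; have := GD _ (pX B mB); rewrite /G/= setIA.
  by rewrite (setIidl ED).
apply: smallest_sub.
  split; rewrite /G/=.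
  - by rewrite setI0.
  - move=> A mA; rewrite setIDA (setIidl ED).
    have -> : E `\` A = E `\` (E `&` A) by rewrite setDIr setDv set0U.
    exact: measurableD.
  - by move=> A mA; rewrite setI_bigcupr; exact: bigcup_measurable.
move=> C [[A FA <-]|[s [u [A [s0 su uT FA ->]]]]]; rewrite /G/=.
  rewrite (_ : _ `&` _ = set0)//; apply/seteqP; split=> -[w s]//=.
  by rewrite /E/= in_itv/= => -[[_ /[swap] [[_ ->]]]]; rewrite ltxx.
have [ts|st] := leP t s.
  rewrite (_ : _ `&` _ = set0)//; apply/seteqP; split=> -[w v]//=.
  rewrite /E/= !in_itv/= => -[[_ /andP[_ vt]] [_ /andP[sv _]]].
  by have := lt_le_trans sv (le_trans vt ts); rewrite ltxx.
rewrite (_ : _ `&` _ = A `*` [set` `]s, Num.min t u]]); last first.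
  apply/seteqP; split=> -[w v]/=; rewrite /E/= !in_itv/= le_min.
    by move=> [[_ /andP[_ ->]] [? /andP[-> ->]]].
  move=> [Aw /andP[sv /andP[-> ->]]]; rewrite sv (le_lt_trans s0 sv); do !split => //.
apply: measurableX; last exact: measurable_itv.
by rewrite measurable_g_measurableTypeE//; apply: usual_mono FA => //; exact: ltW.
Qed.

(** The bound on the terminal value is what turns the random measures [dpath T Q w] into a finite
    kernel; in the theorem it is [rho T]. *)
Definition good_integrator Q r := [/\ adapted T F Q, {ae P, forall w, Q 0 w = 0},
  {ae P, forall w, increasing_path T (Q ^~ w)} & {ae P, forall w, Q T w <= r}].

(** Replacing [Q] by 0 on the null set of bad paths makes the path hypotheses of the kernel lemma
    hold everywhere; completeness of [F t] carries measurability back to [Q]. *)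
Lemma good_dpath_measurable Q r t
    (k : g_sigma_algebraType (F t) * measurableTypeR R -> \bar R) :
  good_integrator Q r -> 0 <= t <= T ->
  (forall z, 0 <= k z)%E ->
  measurable_fun (setT `*` [set` `]0, t]]) k ->
  measurable_fun setT (fun w : g_sigma_algebraType (F t) =>
    \int[dpath T Q w]_(s in [set` `]0%R, t]]) k (w, s))%E.
Proof.
move=> [aQ Q0 iQ Qr] /[dup] t0T /andP[t0 tT] k0 mk.
pose good := [set w | [/\ Q 0 w = 0, increasing_path T (Q ^~ w) & Q T w <= r]].
have aegood : {ae P, forall w, good w}.
  by apply: filterS3 Q0 iQ Qr => w *; split.
pose q u w := if w \in good then Q u w else 0.
have qE w : good w -> q ^~ w = Q ^~ w.
  by move=> gw; apply/funext => u; rewrite /q mem_set.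
apply: (@usual_ae_measurable _ _ (fun w =>
    \int[lebesgue_stieltjes_measure (stieltjes_path T (q ^~ w))]_(s in [set` `]0%R, t]])
      k (w, s))%E) => //.
  by apply: filterS aegood => w gw; rewrite /dpath qE.
(* The maximum with 0 accounts for the replaced paths, the added 1 for the strict inequality. *)
apply: (@measurable_stieltjes_integral _ _ _ _ _ _ (Num.max r 0 + 1)) => //.
- move=> w; have [gw|gw] := pselect (good w); first by rewrite qE//; case: gw.
  rewrite (_ : q ^~ w = cst 0); first by split => // u u0 uT; exact: cvg_cst.
  by apply/funext => u; rewrite /q memNset.
- move=> u /andP[u0 ut].
  apply: (@usual_ae_measurable _ _ (Q u)) => //.
    by apply: filterS aegood => w gw; rewrite /q mem_set.
  apply/sub_measurableP; first exact: usual_sigma_algebra.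
  have uT := le_trans ut tT.
  by move=> B mB; apply: (usual_mono u0 ut tT); apply: aQ => //; rewrite u0.
- move=> w; rewrite /q; case: ifPn => [/set_mem[-> [nd _] QTr]|_].
    rewrite subr0 (@le_lt_trans _ _ (Num.max r 0))// ?ltrDl//.
    by rewrite le_max (le_trans _ QTr)//; apply: nd.
  by rewrite subrr ltr_wpDl// le_max lexx orbT.
Qed.

Lemma path_integral_adapted Q r X t : good_integrator Q r ->
  predictable T F X -> 0 <= t <= T ->
  sub_measurable (F t) (path_integral T Q X t).
Proof.
move=> gQ pX t0T; have sF := usual_sigma_algebra t0T.
have mX := predictable_joint t0T pX.
apply/sub_measurableP => //.
rewrite /path_integral /Rintegral.
have mE : measurable (setT `*` [set` `]0, t]] : set (g_sigma_algebraType (F t) * measurableTypeR R)).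
  by apply: measurableX => //; exact: measurable_itv.
have mpos : measurable_fun setT (fun w : g_sigma_algebraType (F t) =>
    \int[dpath T Q w]_(s in [set` `]0%R, t]]) ((fun z => (X z.2 z.1)%:E)^\+ (w, s)))%E.
  apply: good_dpath_measurable gQ t0T _ _ => //.
  by apply: measurable_funepos; exact/measurable_EFinP.
have mneg : measurable_fun setT (fun w : g_sigma_algebraType (F t) =>
    \int[dpath T Q w]_(s in [set` `]0%R, t]]) ((fun z => (X z.2 z.1)%:E)^\- (w, s)))%E.
  apply: good_dpath_measurable gQ t0T _ _ => //.
  by apply: measurable_funeneg; exact/measurable_EFinP.
have mD : measurable_fun setT (fun w : g_sigma_algebraType (F t) =>
    \int[dpath T Q w]_(s in [set` `]0%R, t]]) (X s w)%:E)%E.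
  rewrite (_ : (fun w => _) = (fun w : g_sigma_algebraType (F t) =>
      \int[dpath T Q w]_(s in [set` `]0%R, t]]) ((fun z => (X z.2 z.1)%:E)^\+ (w, s)) -
      \int[dpath T Q w]_(s in [set` `]0%R, t]]) ((fun z => (X z.2 z.1)%:E)^\- (w, s)))%E).
    exact: (emeasurable_funB mpos mneg).
  by apply/funext => w; rewrite [LHS]integralE !(funepos.unlock, funeneg.unlock).
exact: measurableT_comp mD.
Qed.

End Predictable.

(** * A weighted Young inequality and its limit form *)

Section Generic.
Context {R : realType}.

Lemma ge0_integral_le_lin d (X : measurableType d) (mu : {measure set X -> \bar R})
    (D : set X) (f g h : X -> \bar R) (a b : R) : measurable D ->
  measurable_fun D f -> measurable_fun D g -> measurable_fun D h ->
  (forall x, D x -> 0 <= f x)%E -> (forall x, D x -> 0 <= g x)%E ->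
  (forall x, D x -> 0 <= h x)%E -> 0 <= a -> 0 <= b ->
  (forall x, D x -> h x <= a%:E * f x + b%:E * g x)%E ->
  (\int[mu]_(x in D) h x <=
   a%:E * \int[mu]_(x in D) f x + b%:E * \int[mu]_(x in D) g x)%E.
Proof.
move=> mD mf mg mh f0 g0 h0 a0 b0 hfg.
have maf : measurable_fun D (fun x => a%:E * f x)%E by exact: measurable_funeM.
have mbg : measurable_fun D (fun x => b%:E * g x)%E by exact: measurable_funeM.
rewrite -!ge0_integralZl//= -ge0_integralD//; last 2 first.
- by move=> x Dx; rewrite mule_ge0 ?lee_fin ?f0.
- by move=> x Dx; rewrite mule_ge0 ?lee_fin ?g0.
by apply: ge0_le_integral => //; exact: emeasurable_funD.
Qed.

(** As [e] tends to 0 the constant of the first term tends to 1, so squared norms can be compared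
    exactly in the limit. *)
Lemma sqr_add_le (e x y : R) : 0 < e ->
  (x + y) ^+ 2 <= (1 + e) * x ^+ 2 + (1 + e^-1) * y ^+ 2.
Proof.
move=> e0; rewrite -subr_ge0.
have -> : (1 + e) * x ^+ 2 + (1 + e^-1) * y ^+ 2 - (x + y) ^+ 2 =
    e^-1 * (e * x - y) ^+ 2 by field; rewrite gt_eqF.
by rewrite mulr_ge0 ?sqr_ge0 ?invr_ge0 ?ltW.
Qed.

(** Here [u n] is the squared norm of an approximation, and [v], [v'] are squared errors. For large
    n the two bounds combine to [a <= (1 + e)^2 b], and then [e] tends to 0. *)
Lemma approx_le (a b : \bar R) (u v v' : (\bar R)^nat) :
  (0 <= b)%E -> (v n @[n --> \oo] --> 0)%E -> (v' n @[n --> \oo] --> 0)%E ->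
  (forall e : R, (0 < e)%R -> forall n,
    a <= (1 + e)%:E * u n + (1 + e^-1)%:E * v n)%E ->
  (forall e : R, (0 < e)%R -> forall n,
    u n <= (1 + e)%:E * b + (1 + e^-1)%:E * v' n)%E ->
  (a <= b)%E.
Proof.
move=> b0 v0 v'0 au ub; case: b b0 ub => [b||]; [|by move=> *; exact: leey|by []].
rewrite lee_fin => b0 ub.
have key (e : R) : 0 < e -> (a <= ((1 + e) * ((1 + e) * b))%:E)%E.
  move=> e0.
  have H n : (a <= (1 + e)%:E * ((1 + e)%:E * b%:E + (1 + e^-1)%:E * v' n)
                 + (1 + e^-1)%:E * v n)%E.
    apply: le_trans (au e e0 n) _; rewrite leeD2r//.
    by apply: lee_wpmul2l (ub _ e0 n); rewrite lee_fin addr_ge0 ?(ltW e0).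
  have : ((1 + e)%:E * ((1 + e)%:E * b%:E + (1 + e^-1)%:E * v' n)
                 + (1 + e^-1)%:E * v n)%E @[n --> \oo] -->
     ((1 + e)%:E * ((1 + e)%:E * b%:E + (1 + e^-1)%:E * 0)
                 + (1 + e^-1)%:E * 0)%E.
    apply: cvgeD; first by rewrite mule0 ?fin_num_adde_defl.
      apply: cvgeZl => //; apply: cvgeD; first by rewrite mule0 ?fin_num_adde_defl.
        exact: cvg_cst.
      exact: cvgeZl.
    exact: cvgeZl.
  rewrite !mule0 !adde0 -!EFinM => cv.
  by apply: cvge_ge cv; exact: nearW.
apply/lee_addgt0Pr => e e0; rewrite -EFinD.
(* For [e' <= 1], [(1 + e')^2 b <= b + 3 e' b]; the added 1 allows [b = 0]. *)
pose e' := Num.min 1 (e / (3 * b + 1)).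
have b3 : 0 < 3 * b + 1 by rewrite ltr_wpDl// mulr_ge0.
have e'0 : 0 < e' by rewrite lt_min ltr01 divr_gt0.
apply: le_trans (key _ e'0) _; rewrite lee_fin.
have e'1 : e' <= 1 by rewrite ge_min lexx.
have : e' * (3 * b + 1) <= e by rewrite -ler_pdivlMr// ge_min lexx orbT.
nra.
Qed.

End Generic.

(** * The energy seminorm *)

Section Energy.
Context {R : realType} {d : measure_display} {Omega : measurableType d}.
Variables (P : probability Omega R) (T : R) (F : R -> set (set Omega)).
Hypotheses (T0 : 0 < T) (hF : usual_conditions P T F) (hFT : F T = measurable).
Variables (Q : R -> Omega -> R) (r : R).
Hypothesis gQ : good_integrator P T F Q r.
Implicit Types (X Y : R -> Omega -> R) (t : R).

Let T0T : 0 <= T <= T. Proof. by rewrite lexx ltW. Qed.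
Local Notation jm := (joint_measurable F T).

(** Adapted objects live on [g_sigma_algebraType (F T)], integrals against [P] on [Omega]. These are
    two measurable types with the same measurable sets. *)
Lemma measurable_terminal d' (Y : measurableType d') (f : Omega -> Y) :
  measurable_fun setT (f : g_sigma_algebraType (F T) -> Y) <->
  measurable_fun setT f.
Proof.
have mE A : measurable (A : set (g_sigma_algebraType (F T))) = measurable (A : set Omega).
  by rewrite measurable_g_measurableTypeE ?hFT//; apply: sigma_algebra_measurable.
split=> mf _ B mB; have := mf measurableT B mB; last by rewrite mE.
by rewrite -[X in _ -> X]mE.
Qed.

Lemma measurable_prod_terminal (N : set (Omega * R)) :
  measurable (N : set (g_sigma_algebraType (F T) * measurableTypeR R)) <->
  measurable N.
Proof.
have mE A : measurable (A : set (g_sigma_algebraType (F T))) = measurable (A : set Omega).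
  by rewrite measurable_g_measurableTypeE ?hFT//; apply: sigma_algebra_measurable.
rewrite [X in X N <-> _]measurable_prod_measurableType.
rewrite [X in _ <-> X N](@measurable_prod_measurableType _ _ Omega (measurableTypeR R)).
rewrite (_ : [set A `*` B | A in _ & B in _] = [set A `*` B | A in (measurable : set (set Omega)) & B in (measurable : set (set (measurableTypeR R)))])//.
apply/seteqP; split=> C [A mA [B mB <-]].
  by exists A; [rewrite -mE|exists B].
by exists A; [rewrite mE|exists B].
Qed.

Let mOT : measurable (setT `*` [set` `]0, T]] : set (g_sigma_algebraType (F T) * measurableTypeR R)).
Proof. by apply: measurableX => //; exact: measurable_itv. Qed.

Lemma joint_section X w : jm X ->
  measurable_fun ([set` `]0, T]] : set (measurableTypeR R)) (X ^~ w).
Proof.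
move=> mX _ B mB.
have := measurable_xsection (w : g_sigma_algebraType (F T)) (mX mOT B mB).
rewrite (_ : xsection _ _ = [set` `]0, T]] `&` X ^~ w @^-1` B)//.
apply/seteqP; split=> s; rewrite /xsection/= in_setE/=; first by case=> -[].
by move=> [].
Qed.

Lemma jointD X Y : jm X -> jm Y -> jm (fun t w => X t w + Y t w).
Proof. by move=> mX mY; exact: (measurable_funD mX mY). Qed.

Lemma jointM X Y : jm X -> jm Y -> jm (fun t w => X t w * Y t w).
Proof. by move=> mX mY; exact: (measurable_funM mX mY). Qed.

Lemma jointB X Y : jm X -> jm Y -> jm (fun t w => X t w - Y t w).
Proof. by move=> mX mY; exact: (measurable_funB mX mY). Qed.

Definition path_energy X w : \bar R :=
  (\int[dpath T Q w]_(s in [set` `]0%R, T]]) ((X s w) ^+ 2)%:E)%E.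

Lemma path_energy_ge0 X w : (0 <= path_energy X w)%E.
Proof. by apply: integral_ge0 => s _; rewrite lee_fin sqr_ge0. Qed.

Lemma energy_ge0 X : (0 <= energy P T Q X)%E.
Proof. by apply: integral_ge0 => w _; exact: path_energy_ge0. Qed.

Lemma measurable_path_energy X : jm X -> measurable_fun setT (path_energy X).
Proof.
move=> mX; apply/measurable_terminal.
apply: (good_dpath_measurable hF (k := fun z => ((X z.2 z.1) ^+ 2)%:E) gQ T0T).
  by move=> z; rewrite lee_fin sqr_ge0.
by apply/measurable_EFinP; exact: measurable_funX.
Qed.

Lemma path_energyD_le X Y (e : R) w : jm X -> jm Y -> 0 < e ->
  (path_energy (fun t w => (X t w + Y t w)%R) w <=
   (1 + e)%:E * path_energy X w + (1 + e^-1)%:E * path_energy Y w)%E.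
Proof.
move=> mX mY e0.
have m2 Z : jm Z -> measurable_fun ([set` `]0, T]] : set (measurableTypeR R)) (fun s => ((Z s w) ^+ 2)%:E).
  by move=> mZ; apply/measurable_EFinP/measurable_funX; exact: joint_section.
apply: (@ge0_integral_le_lin _ _ (measurableTypeR R)) => //.
- exact: m2.
- exact: m2.
- by apply: (m2 (fun t w => X t w + Y t w)); exact: jointD.
- by move=> s _; rewrite lee_fin sqr_ge0.
- by move=> s _; rewrite lee_fin sqr_ge0.
- by move=> s _; rewrite lee_fin sqr_ge0.
- by rewrite addr_ge0 ?(ltW e0).
- by rewrite addr_ge0 ?invr_ge0 ?(ltW e0).
- by move=> s _; rewrite -!EFinM -EFinD lee_fin sqr_add_le.
Qed.

Lemma energyD_le X Y (e : R) : jm X -> jm Y -> 0 < e ->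
  (energy P T Q (fun t w => (X t w + Y t w)%R) <=
   (1 + e)%:E * energy P T Q X + (1 + e^-1)%:E * energy P T Q Y)%E.
Proof.
move=> mX mY e0; apply: ge0_integral_le_lin => //.
- exact: (measurable_path_energy mX).
- exact: (measurable_path_energy mY).
- exact: (measurable_path_energy (jointD mX mY)).
- by move=> w _; exact: (path_energy_ge0 X).
- by move=> w _; exact: (path_energy_ge0 Y).
- by move=> w _; exact: (path_energy_ge0 (fun t w => X t w + Y t w)).
- by rewrite addr_ge0 ?(ltW e0).
- by rewrite addr_ge0 ?invr_ge0 ?(ltW e0).
- by move=> w _; exact: (path_energyD_le w mX mY e0).
Qed.

Lemma eq_energy X Y : (forall t w, 0 < t <= T -> X t w = Y t w) ->
  energy P T Q X = energy P T Q Y.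
Proof.
move=> XY; apply: eq_integral => w _; apply: eq_integral => s.
by rewrite inE/= in_itv/= => sT; rewrite XY.
Qed.

Lemma joint_simple (e : simple_integrand) : simple_predictable T F e ->
  jm (simple_process e).
Proof.
move=> se; rewrite /joint_measurable /simple_process.
apply: measurable_sum => i; have [lo0 lohi hiT mc _] := se i.
apply: measurable_funTS.
apply: measurable_fun_ifT => //.
  apply: measurable_and.
    by apply: measurable_fun_ltr => //; exact: measurable_snd.
  by apply: measurable_fun_ler => //; exact: measurable_snd.
apply: (measurableT_comp (f := coef i : g_sigma_algebraType (F T) -> R)) => //.
apply/sub_measurableP; first exact: (usual_sigma_algebra hF).
by move=> B mB; apply: (usual_mono hF lo0 _ (lexx T) (mc B mB)); rewrite (le_trans lohi).
Qed.

(** The increment of [Q] over the intersection of ]a, b] and ]c, e]; the outer maximum turns an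
    empty intersection into 0. *)
Definition overlap (a b c e : R) w : R :=
  Q (Num.max (Num.max a c) (Num.min b e)) w - Q (Num.max a c) w.

(** Squaring gives a double sum of indicators of intersections, each of mass [overlap]. This is the
    form that matches the expanded square of the simple integral. *)
Lemma path_energy_simple (e : simple_integrand) w : simple_predictable T F e ->
  increasing_path T (Q ^~ w) ->
  path_energy (simple_process e) w =
  (\sum_(p : 'I_(simple_size e) * 'I_(simple_size e))
    coef p.1 w * coef p.2 w * overlap (lo p.1) (hi p.1) (lo p.2) (hi p.2) w)%:E.
Proof.
move=> se iQ.
pose m (p : 'I_(simple_size e) * 'I_(simple_size e)) := Num.max (lo p.1) (lo p.2).
pose n (p : 'I_(simple_size e) * 'I_(simple_size e)) :=
  Num.max (m p) (Num.min (hi p.1) (hi p.2)).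
have m0 p : 0 <= m p by rewrite le_max; have [->] := se p.1.
have mn p : m p <= n p by rewrite le_max lexx.
have nT p : n p <= T.
  rewrite !ge_max !ge_min; have [_ h1 h2 _ _] := se p.1; have [_ h3 h4 _ _] := se p.2.
  by rewrite (le_trans h1)// (le_trans h3)// h2.
transitivity (\int[dpath T Q w]_(s in [set` `]0%R, T]])
   (\sum_(p : 'I_(simple_size e) * 'I_(simple_size e))
     ((coef p.1 w * coef p.2 w) * \1_[set` `]m p, n p]] s)%:E))%E.
  apply: eq_integral => s _; rewrite sumEFin; congr EFin.
  rewrite expr2 /simple_process big_distrlr/= pair_big/=.
  apply: eq_bigr => -[i j] _ /=; rewrite indicE /m /n/=.
  have -> : (s \in [set` `]Num.max (lo i) (lo j),
      Num.max (Num.max (lo i) (lo j)) (Num.min (hi i) (hi j))]]) =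
      (lo i < s <= hi i) && (lo j < s <= hi j).
    apply/idP/idP; rewrite in_setE/= in_itv/= !(gt_max, le_max, le_min).
      by move=> /andP[/andP[si sj]]; rewrite si sj !leNgt si sj.
    by move=> /andP[/andP[-> ->] /andP[-> ->]]; rewrite orbT.
  by case: (lo i < s <= hi i); case: (lo j < s <= hi j); rewrite /= ?(mulr1,mulr0,mul0r).
have mI (p : 'I_(simple_size e) * 'I_(simple_size e)) :
    measurable ([set` `]m p, n p]] : set (measurableTypeR R)) by exact: measurable_itv.
have sub p : [set` `]m p, n p]] `<=` [set` `]0, T]].
  move=> s /=; rewrite !in_itv/= => /andP[ms sn].
  by rewrite (le_lt_trans (m0 p) ms) (le_trans sn).
have fin : (dpath T Q w [set` `]0%R, T]] < +oo)%E.
  by rewrite /dpath stieltjes_path_itv ?lexx ?(ltW T0)// ltry.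
have Dint (k : R) p : (dpath T Q w).-integrable [set` `]0%R, T]]
    (fun s => (k * \1_[set` `]m p, n p]] s)%:E).
  apply: measurable_bounded_integrable => //.
    by apply: measurable_funM => //; exact: measurable_indic.
  exists `|k|; split; first exact: num_real.
  move=> x cx s _ /=; rewrite normrM (le_trans _ (ltW cx))// ler_piMr//.
  by rewrite indicE; case: (_ \in _); rewrite ?normr1 ?normr0.
rewrite integral_sum//.
rewrite -sumEFin; apply: eq_bigr => p _.
under eq_integral do rewrite EFinM.
rewrite integralZl//; last first.
  by apply: eq_integrable (Dint 1 p) => // s _; rewrite mul1r.
rewrite integral_indic//= setIidl// [RHS]EFinM; congr (_ * _)%E.
by rewrite /dpath stieltjes_path_itv.
Qed.

End Energy.

(** * Martingales *)

Section Martingales.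
Context {R : realType} {d : measure_display} {Omega : measurableType d}.
Variables (P : probability Omega R) (T : R) (F : R -> set (set Omega)).
Hypotheses (T0 : 0 < T) (hF : usual_conditions P T F).
Implicit Types (X Y : R -> Omega -> R) (t : R) (Z : Omega -> R).
Local Notation integ := (integ P).
Local Notation sqi := (sqi P).
Local Notation Ex := (Ex P).

Lemma sub_measurableD A Z Z' : sigma_algebra setT A ->
  sub_measurable A Z -> sub_measurable A Z' -> sub_measurable A (fun w => Z w + Z' w).
Proof.
move=> sA /(sub_measurableP _ sA) mZ /(sub_measurableP _ sA) mZ'.
by apply/sub_measurableP => //; exact: measurable_funD.
Qed.

Lemma sub_measurableB A Z Z' : sigma_algebra setT A ->
  sub_measurable A Z -> sub_measurable A Z' -> sub_measurable A (fun w => Z w - Z' w).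
Proof.
move=> sA /(sub_measurableP _ sA) mZ /(sub_measurableP _ sA) mZ'.
by apply/sub_measurableP => //; exact: measurable_funB.
Qed.

Lemma sub_measurableM A Z Z' : sigma_algebra setT A ->
  sub_measurable A Z -> sub_measurable A Z' -> sub_measurable A (fun w => Z w * Z' w).
Proof.
move=> sA /(sub_measurableP _ sA) mZ /(sub_measurableP _ sA) mZ'.
by apply/sub_measurableP => //; exact: measurable_funM.
Qed.

Lemma sub_measurableS s t Z : 0 <= s -> s <= t -> t <= T ->
  sub_measurable (F s) Z -> sub_measurable (F t) Z.
Proof. by move=> s0 st tT mZ B mB; apply: (usual_mono hF s0 st tT); exact: mZ. Qed.

Lemma usual_sub_measurable t Z : 0 <= t <= T -> sub_measurable (F t) Z ->
  measurable_fun setT Z.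
Proof. by move=> t0T; exact: sub_measurable_fun (usual_measurable hF t0T). Qed.

Lemma cond_exp_self A Z : A `<=` measurable -> sub_measurable A Z -> integ Z ->
  is_cond_exp P A Z Z.
Proof. by move=> Am mZ iZ; split. Qed.

Lemma cond_expB A (X Y X' Y' : Omega -> R) : A `<=` measurable -> sigma_algebra setT A ->
  is_cond_exp P A X Y -> is_cond_exp P A X' Y' ->
  is_cond_exp P A (fun w => X w - X' w) (fun w => Y w - Y' w).
Proof.
move=> Am sA XY XY'; have [mY iX iY _] := XY; have [mY' iX' iY' _] := XY'.
apply: cond_expP => //; [exact: sub_measurableB|exact: integB|exact: integB|].
move=> B AB; have mB := Am _ AB.
have m1 : sub_measurable A (\1_B : Omega -> R).
  apply/sub_measurableP => //; apply: measurable_indic.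
  by rewrite measurable_g_measurableTypeE.
have i1 Z : integ Z -> integ (fun w => \1_B w * Z w).
  move=> iZ; apply: integM01 => //; exists 1 => w.
  by rewrite indicE; case: (_ \in _); rewrite ?normr1 ?normr0.
under eq_Ex do rewrite mulrBr.
under [RHS]eq_Ex do rewrite mulrBr.
rewrite !ExB; try exact: i1.
by congr (_ - _); apply: (cond_exp_mul Am sA) => //; exact: i1.
Qed.

Lemma cadlagB (f g : R -> R) : cadlag_path T f -> cadlag_path T g ->
  cadlag_path T (fun t => f t - g t).
Proof.
move=> [fr fl] [gr gl]; split=> t t0 tT.
  by apply: cvgB; [exact: fr|exact: gr].
by apply: is_cvgB; [exact: fl|exact: gl].
Qed.

Lemma cadlag_stop (f : R -> R) t : cadlag_path T f -> 0 <= t <= T ->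
  cadlag_path T (fun u => f (Num.min t u)).
Proof.
move=> [fr fl] /andP[t0 tT]; split=> u u0 uT.
  have [tu|ut] := leP t u.
    apply: cvg_near_cst; near=> s.
    by rewrite min_l// (le_trans tu).
  apply: cvg_trans (fr u u0 uT).
  apply: near_eq_cvg; near=> s; rewrite min_r//.
  by near: s; exact: nbhs_right_le.
have [ut|tu] := leP u t.
  apply: cvgP; apply: cvg_trans (fl u u0 uT).
  by apply: near_eq_cvg; near=> s; rewrite min_r// (le_trans _ ut).
apply: cvgP; apply: (@cvg_near_cst _ _ (f t)); near=> s.
rewrite min_l//; near: s; exact: nbhs_left_ge.
Unshelve. all: by end_near. Qed.

Lemma martingale_integ X t : martingale P T F X -> 0 <= t <= T -> integ (X t).
Proof.
by move=> [_ cX _] /andP[t0 tT]; have [] := cX t t t0 (lexx _) tT.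
Qed.

Lemma martingaleB X Y : martingale P T F X -> martingale P T F Y ->
  martingale P T F (fun t w => X t w - Y t w).
Proof.
move=> [aX cX rX] [aY cY rY]; split.
- move=> t t0T; apply: sub_measurableB; [exact: (usual_sigma_algebra hF)|exact: aX|exact: aY].
- move=> s t s0 st tT; have s0T : 0 <= s <= T by rewrite s0 (le_trans st).
  apply: cond_expB; [exact: (usual_measurable hF)|exact: (usual_sigma_algebra hF)|exact: cX|exact: cY].
- by apply: filterS2 rX rY => w; exact: cadlagB.
Qed.

Lemma martingale_cst Z : sub_measurable (F 0) Z -> integ Z ->
  martingale P T F (fun=> Z).
Proof.
move=> mZ iZ.
have mZt t : 0 <= t <= T -> sub_measurable (F t) Z.
  by move=> /andP[t0 tT]; exact: sub_measurableS mZ.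
split=> //.
- move=> s t s0 st tT; have s0T : 0 <= s <= T by rewrite s0 (le_trans st).
  by apply: cond_exp_self => //; [exact: (usual_measurable hF)|exact: mZt].
- by apply: aeW => w; split=> u u0 uT /=; [exact: cvg_cst|exact: is_cvg_cst].
Qed.

Lemma martingale_stop X t : martingale P T F X -> 0 <= t <= T ->
  martingale P T F (fun u => X (Num.min t u)).
Proof.
move=> hX /[dup] t0T /andP[t0 tT]; have [aX cX rX] := hX.
have min0 u : 0 <= u -> 0 <= Num.min t u by move=> u0; rewrite le_min t0.
have aXt u : 0 <= u <= T -> sub_measurable (F u) (X (Num.min t u)).
  move=> /andP[u0 uT]; have mu : Num.min t u <= u by rewrite ge_min lexx orbT.
  apply: (sub_measurableS (min0 _ u0) mu uT); apply: aX.
  by rewrite min0// (le_trans mu).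
split=> //.
- move=> a b a0 ab bT; have aT := le_trans ab bT.
  have [ta|a_t] := leP t a.
    rewrite !min_l ?(le_trans ta)//; apply: cond_exp_self.
    + by apply: (usual_measurable hF); rewrite a0.
    + by apply: (sub_measurableS t0 ta aT); exact: aX.
    + exact: martingale_integ.
  apply: cX => //.
    by rewrite le_min ab (ltW a_t).
  by rewrite ge_min tT.
- by apply: filterS rX => w cw; exact: (cadlag_stop cw t0T).
Qed.

Lemma martingale_orth X s t Z : martingale P T F X -> sqi (X s) -> sqi (X t) ->
  0 <= s -> s <= t -> t <= T -> sub_measurable (F s) Z -> sqi Z ->
  Ex (fun w => Z w * (X t w - X s w)) = 0.
Proof.
move=> [_ cX _] sXs sXt s0 st tT mZ sZ.
have s0T : 0 <= s <= T by rewrite s0 (le_trans st).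
under eq_Ex do rewrite mulrBr.
rewrite ExB; [|exact: sqi_mul..].
rewrite (cond_exp_mul (usual_measurable hF s0T) (usual_sigma_algebra hF s0T) (cX s t s0 st tT) mZ) ?subrr//; exact: sqi_mul.
Qed.

(** The version for martingales that are merely integrable, such as [M^2 - Q], at the price of a
    bounded multiplier. *)
Lemma martingale_orth_bounded X s t Z c : martingale P T F X ->
  0 <= s -> s <= t -> t <= T -> sub_measurable (F s) Z -> (forall w, `|Z w| <= c) ->
  Ex (fun w => Z w * (X t w - X s w)) = 0.
Proof.
move=> hX s0 st tT mZ Zc; have [_ cX _] := hX.
have s0T : 0 <= s <= T by rewrite s0 (le_trans st).
have t0T : 0 <= t <= T by rewrite (le_trans s0)//.
have mZ' := usual_sub_measurable s0T mZ.
have iZ u : 0 <= u <= T -> integ (fun w => Z w * X u w).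
  by move=> u0T; apply: integM01 => //; [exists c|exact: martingale_integ].
under eq_Ex do rewrite mulrBr.
rewrite ExB; [|exact: iZ..].
by rewrite (cond_exp_mul (usual_measurable hF s0T) (usual_sigma_algebra hF s0T) (cX s t s0 st tT) mZ) ?subrr//; exact: iZ.
Qed.

Lemma martingale_sqi X t : martingale P T F X -> sqi (X T) -> 0 <= t <= T -> sqi (X t).
Proof.
move=> [_ cX _] sX /[dup] t0T /andP[t0 tT].
exact: (cond_exp_sqi (usual_measurable hF t0T) (usual_sigma_algebra hF t0T) (cX t T t0 tT (lexx _))).
Qed.

End Martingales.

(** * The Ito isometry *)

Section Ito.
Context {R : realType} {d : measure_display} {Omega : measurableType d}.
Variables (P : probability Omega R) (T : R) (F : R -> set (set Omega)).
Hypotheses (T0 : 0 < T) (hF : usual_conditions P T F) (hFT : F T = measurable).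
Variables (M Q : R -> Omega -> R) (r : R).
Hypotheses (gQ : good_integrator P T F Q r) (hM : martingale P T F M)
  (hM2 : square_integrable P T M)
  (hMQ : martingale P T F (fun t w => M t w ^+ 2 - Q t w)).
Implicit Types (X Y I J : R -> Omega -> R) (t : R) (f g h Z : Omega -> R).
Local Notation integ := (integ P).
Local Notation sqi := (sqi P).
Local Notation Ex := (Ex P).
Local Notation jm := (joint_measurable F T).

Let T0T : 0 <= T <= T. Proof. by rewrite lexx ltW. Qed.

Lemma integ_Q t : 0 <= t <= T -> integ (Q t).
Proof.
move=> t0T; have := integB (sqi_sqr (hM2 t0T)) (martingale_integ hMQ t0T).
by apply: eq_integ => w; rewrite opprB addrC subrK.
Qed.

(** Since [(M_t - M_s)^2] is the increment of [M^2] minus [2 M_s (M_t - M_s)], it differs from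
    [Q_t - Q_s] by an increment of the martingale [M^2 - Q] and a martingale increment with the
    factor [M_s]. Weighted by [h], both have mean 0. *)
Lemma square_increment s t h c : 0 <= s -> s <= t -> t <= T ->
  sub_measurable (F s) h -> (forall w, `|h w| <= c) ->
  Ex (fun w => h w * (M t w - M s w) ^+ 2) = Ex (fun w => h w * (Q t w - Q s w)).
Proof.
move=> s0 st tT mh hc.
have s0T : 0 <= s <= T by rewrite s0 (le_trans st).
have t0T : 0 <= t <= T by rewrite (le_trans s0).
have mh' := usual_sub_measurable hF s0T mh.
have [aM _ _] := hM.
have sMt := hM2 t0T; have sMs := hM2 s0T.
have shM : sqi (fun w => h w * M s w) by exact: sqiM mh' hc sMs.
have orth1 : Ex (fun w => (h w * M s w) * (M t w - M s w)) = 0.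
  apply: (martingale_orth hF hM) => //.
  by apply: sub_measurableM (mh) (aM _ s0T); exact: (usual_sigma_algebra hF).
have orth2 := martingale_orth_bounded hF hMQ s0 st tT mh hc.
have ih Z : integ Z -> integ (fun w => h w * Z w).
  by move=> iZ; apply: integM01 => //; exists c.
have iQt := integ_Q t0T; have iQs := integ_Q s0T.
have i1 : integ (fun w => (h w * M s w) * (M t w - M s w)).
  by apply: sqi_mul => //; exact: sqiB.
have i2 : integ (fun w => h w * ((M t w ^+ 2 - Q t w) - (M s w ^+ 2 - Q s w))).
  by apply: ih; apply: integB; apply: integB => //; exact: sqi_sqr.
have i3 : integ (fun w => h w * (Q t w - Q s w)) by apply: ih; exact: integB.
transitivity (Ex (fun w =>
  (h w * ((M t w ^+ 2 - Q t w) - (M s w ^+ 2 - Q s w)) -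
   2 * (h w * M s w * (M t w - M s w))) + h w * (Q t w - Q s w))).
  by apply: eq_Ex => w; ring.
rewrite ExD//; last by apply: integB => //; exact: integZ.
by rewrite ExB ?ExZ//; [rewrite orth1 orth2 mulr0 subr0 add0r|exact: integZ].
Qed.

(** The factor [h (M_b - M_a)] is known at time s, so it is a square-integrable test variable for
    the increment over ]s, t]. *)
Lemma increment_orth a b s t h c : 0 <= a -> a <= b -> b <= s -> s <= t -> t <= T ->
  sub_measurable (F s) h -> (forall w, `|h w| <= c) ->
  Ex (fun w => h w * ((M b w - M a w) * (M t w - M s w))) = 0.
Proof.
move=> a0 ab bs st tT mh hc; have s0 := le_trans (le_trans a0 ab) bs.
have s0T : 0 <= s <= T by rewrite s0 (le_trans st).
have t0T : 0 <= t <= T by rewrite (le_trans s0).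
have b0 := le_trans a0 ab.
have a0T : 0 <= a <= T by rewrite a0 (le_trans ab)// (le_trans bs)// (le_trans st).
have b0T : 0 <= b <= T by rewrite b0 (le_trans bs)// (le_trans st).
have sF := usual_sigma_algebra hF s0T.
have [aM _ _] := hM.
have := @martingale_orth _ _ _ P T F hF M s t (fun w => h w * (M b w - M a w)) hM
  (hM2 s0T) (hM2 t0T) s0 st tT.
under eq_Ex do rewrite -mulrA; apply.
  apply: sub_measurableM => //; apply: sub_measurableB => //.
    by apply: (sub_measurableS hF b0 bs) (aM _ b0T); case/andP: s0T.
  by apply: (sub_measurableS hF a0 (le_trans ab bs)) (aM _ a0T); case/andP: s0T.
apply: sqiM hc _; first exact: (usual_sub_measurable hF s0T).
by apply: sqiB; exact: hM2.
Qed.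

Lemma increment_integ a b s t h c : 0 <= a <= T -> 0 <= b <= T -> 0 <= s <= T ->
  0 <= t <= T -> measurable_fun setT h -> (forall w, `|h w| <= c) ->
  integ (fun w => h w * ((M b w - M a w) * (M t w - M s w))).
Proof.
move=> *; apply: integM01 => //; first by exists c.
by apply: sqi_mul; apply: sqiB; exact: hM2.
Qed.

(** The covariance form of [square_increment]. Cutting at [s] and at the smaller of [b] and [t]
    leaves the square of the common increment and products over disjoint intervals, which
    [increment_orth] kills. The weight [h] is known at [s], the later left endpoint. *)
Lemma increment_cov_le a b s t h c : 0 <= a -> a <= b -> b <= T ->
  0 <= s -> s <= t -> t <= T -> a <= s ->
  sub_measurable (F s) h -> (forall w, `|h w| <= c) ->
  Ex (fun w => h w * ((M b w - M a w) * (M t w - M s w))) =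
  Ex (fun w => h w * overlap Q a b s t w).
Proof.
move=> a0 ab bT s0 st tT a_s mh hc.
have s0T : 0 <= s <= T by rewrite s0 (le_trans st).
have t0T : 0 <= t <= T by rewrite (le_trans s0).
have a0T : 0 <= a <= T by rewrite a0 (le_trans ab).
have b0T : 0 <= b <= T by rewrite (le_trans a0).
have mh' := usual_sub_measurable hF s0T mh.
rewrite /overlap (max_r a_s).
have [bs|sb] := leP b s.
  rewrite (increment_orth a0 ab bs st tT mh hc).
  under eq_Ex => w.
    by rewrite max_l ?ge_min ?bs// subrr mulr0; over.
  by rewrite Ex_cst.
have sb' := ltW sb.
transitivity (Ex (fun w => h w * ((M b w - M s w) * (M t w - M s w)))).
  transitivity (Ex (fun w => h w * ((M b w - M s w) * (M t w - M s w)) +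
      h w * ((M s w - M a w) * (M t w - M s w)))).
    by apply: eq_Ex => w; ring.
  rewrite ExD; [|exact: increment_integ hc..].
  by rewrite (increment_orth a0 a_s (lexx _) st tT mh hc) addr0.
have mh_ u : s <= u -> u <= T -> sub_measurable (F u) h.
  by move=> su uT; exact: (sub_measurableS hF s0 su uT).
have [bt|tb] := leP b t.
  rewrite max_r//.
  rewrite -(square_increment s0 sb' bT mh hc).
  transitivity (Ex (fun w => h w * ((M b w - M s w) * (M b w - M s w)) +
      h w * ((M b w - M s w) * (M t w - M b w)))).
    by apply: eq_Ex => w; ring.
  rewrite ExD; [|exact: increment_integ hc..].
  by rewrite (increment_orth s0 sb' (lexx _) bt tT (mh_ _ sb' bT) hc) addr0.
rewrite max_r//.
rewrite -(square_increment s0 st tT mh hc).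
transitivity (Ex (fun w => h w * ((M t w - M s w) * (M t w - M s w)) +
    h w * ((M t w - M s w) * (M b w - M t w)))).
  by apply: eq_Ex => w; ring.
rewrite ExD; [|exact: increment_integ hc..].
by rewrite (increment_orth s0 st (lexx _) (ltW tb) bT (mh_ _ st tT) hc) addr0.
Qed.

Lemma overlapC a b s t w : overlap Q a b s t w = overlap Q s t a b w.
Proof. by rewrite /overlap (maxC a) (minC b). Qed.

Lemma increment_cov a b s t f g cf cg : 0 <= a -> a <= b -> b <= T ->
  0 <= s -> s <= t -> t <= T ->
  sub_measurable (F a) f -> (forall w, `|f w| <= cf) ->
  sub_measurable (F s) g -> (forall w, `|g w| <= cg) ->
  Ex (fun w => f w * g w * ((M b w - M a w) * (M t w - M s w))) =
  Ex (fun w => f w * g w * overlap Q a b s t w).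
Proof.
move=> a0 ab bT s0 st tT mf fc mg gc.
have fgc w : `|f w * g w| <= cf * cg by rewrite normrM ler_pM.
have s0T : 0 <= s <= T by rewrite s0 (le_trans st).
have a0T : 0 <= a <= T by rewrite a0 (le_trans ab).
have [a_s|sa] := leP a s.
  apply: (increment_cov_le _ _ _ _ _ _ _ _ fgc) => //.
  apply: sub_measurableM (mg); first exact: (usual_sigma_algebra hF).
  by apply: (sub_measurableS hF a0 a_s) => //; case/andP: s0T.
under eq_Ex do rewrite (mulrC (M b _ - _)).
under [RHS]eq_Ex do rewrite overlapC.
apply: (increment_cov_le _ _ _ _ _ _ _ _ fgc) => //; first exact: ltW.
apply: sub_measurableM (mf) _; first exact: (usual_sigma_algebra hF).
by apply: (sub_measurableS hF s0 (ltW sa)) => //; case/andP: a0T.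
Qed.

Lemma sqi_simple_integral (e : simple_integrand) t : simple_predictable T F e ->
  0 <= t <= T -> sqi (simple_integral M e t).
Proof.
move=> se /andP[t0 tT]; rewrite /simple_integral.
have : forall i : 'I_(simple_size e), sqi (fun w => coef i w * (M (Num.min (hi i) t) w - M (Num.min (lo i) t) w)).
  move=> i; have [lo0 lohi hiT mc [c cc]] := se i.
  apply: sqiM cc _.
    by apply: (usual_sub_measurable hF _ mc); rewrite lo0 (le_trans lohi).
  by apply: sqiB; apply: hM2; rewrite le_min t0 ge_min tT orbT// (le_trans lo0)//; rewrite lo0.
(* The fields are generalized one by one, because the induction is on the size and the record ties
   the other fields to it. *)
elim: (simple_size e) (@coef _ _ _ e) (@lo _ _ _ e) (@hi _ _ _ e) => [|n IH] c l h H.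
  by under eq_fun do rewrite big_ord0; exact: sqi_cst.
under eq_fun do rewrite big_ord_recr/=.
by apply: sqiD (H ord_max); apply: (IH (fun i => c (widen_ord _ i))) => i; exact: H.
Qed.

Lemma integ_fsum (K : finType) (X : K -> Omega -> R) : (forall i, integ (X i)) ->
  integ (fun w => \sum_i X i w).
Proof.
move=> iX; have := @integrable_sum _ _ _ P setT measurableT _ (index_enum K) xpredT _ (fun i _ => iX i).
by apply: eq_integrable => // w _; rewrite /= sumEFin.
Qed.

Lemma Ex_fsum (K : finType) (X : K -> Omega -> R) : (forall i, integ (X i)) ->
  Ex (fun w => \sum_i X i w) = \sum_i Ex (X i).
Proof.
move=> iX; apply: EFin_inj; rewrite -ExE; last exact: integ_fsum.
under eq_integral do rewrite -sumEFin.
rewrite integral_sum//; rewrite -sumEFin; apply: eq_bigr => i _.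
by rewrite ExE.
Qed.

(** Both sides expand into double sums over pairs of intervals, and [increment_cov] equates them
    pair by pair. *)
Lemma simple_isometry (e : simple_integrand) : simple_predictable T F e ->
  (\int[P]_w ((simple_integral M e T w) ^+ 2)%:E)%E =
  energy P T Q (simple_process e).
Proof.
move=> se.
pose K := ('I_(simple_size e) * 'I_(simple_size e))%type.
pose c2 (p : K) w := coef p.1 w * coef p.2 w.
pose m2 (p : K) w := (M (hi p.1) w - M (lo p.1) w) * (M (hi p.2) w - M (lo p.2) w).
pose o2 (p : K) w := overlap Q (lo p.1) (hi p.1) (lo p.2) (hi p.2) w.
have lo0T i : 0 <= lo (i : 'I_(simple_size e)) <= T.
  by have [lo0 lohi hiT _ _] := se i; rewrite lo0 (le_trans lohi).
have hi0T i : 0 <= hi (i : 'I_(simple_size e)) <= T.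
  by have [lo0 lohi hiT _ _] := se i; rewrite (le_trans lo0).
have mcoef i : measurable_fun setT (coef (i : 'I_(simple_size e))).
  by have [_ _ _ mc _] := se i; exact: (usual_sub_measurable hF (lo0T i)).
have mc2 p : measurable_fun setT (c2 p) by exact: measurable_funM.
have c2b p : exists c, forall w, `|c2 p w| <= c.
  have [_ _ _ _ [c1 cc1]] := se p.1; have [_ _ _ _ [c3 cc3]] := se p.2.
  by exists (c1 * c3) => w; rewrite normrM ler_pM.
have iM p : integ (fun w => c2 p w * m2 p w).
  by have [c cc] := c2b p; apply: increment_integ cc.
have iO p : integ (fun w => c2 p w * o2 p w).
  apply: integM01 => //; apply: integB; apply: integ_Q.
    have := lo0T p.1; have := lo0T p.2; have := hi0T p.1; have := hi0T p.2.
    by rewrite !(le_max, ge_max, ge_min) => /andP[_ ->] /andP[_ ->] /andP[-> ->] /andP[-> ->]; rewrite ?orbT.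
  by have := lo0T p.1; have := lo0T p.2; rewrite !(le_max, ge_max) => /andP[-> ->] /andP[-> ->].
transitivity (\int[P]_w (\sum_p c2 p w * m2 p w)%:E)%E.
  apply: eq_integral => w _; congr EFin.
  rewrite expr2 /simple_integral big_distrlr/= pair_big/=; apply: eq_bigr => -[i j] _ /=.
  have mT x : 0 <= x <= T -> Num.min x T = x by move=> /andP[_ ?]; rewrite min_l.
  by rewrite !mT//; rewrite /c2 /m2/=; ring.
transitivity (\int[P]_w (\sum_p c2 p w * o2 p w)%:E)%E.
  rewrite !ExE; [|exact: integ_fsum..].
  congr EFin; rewrite !Ex_fsum//; apply: eq_bigr => -[i j] _.
  have [lo0 lohi hiT mc [ci cci]] := se i; have [lo0' lohi' hiT' mc' [cj ccj]] := se j.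
  exact: increment_cov cci mc' ccj.
apply: ae_eq_integral => //.
- apply/measurable_EFinP; apply: integ_measurable; exact: integ_fsum.
- exact: (measurable_path_energy T0 hF hFT gQ (joint_simple T0 hF se)).
- have [_ _ iQ _] := gQ; apply: filterS iQ => w iQw _.
  by rewrite -(path_energy_simple T0 se iQw).
Qed.

End Ito.

(** * Isometry and linearity for L^2-limits of simple integrals *)

Section ItoIntegral.
Context {R : realType} {d : measure_display} {Omega : measurableType d}.
Variables (P : probability Omega R) (T : R) (F : R -> set (set Omega)).
Hypotheses (T0 : 0 < T) (hF : usual_conditions P T F) (hFT : F T = measurable).
Variables (M Q : R -> Omega -> R) (r : R).
Hypotheses (gQ : good_integrator P T F Q r) (hM : martingale P T F M)
  (hM2 : square_integrable P T M)
  (hMQ : martingale P T F (fun t w => M t w ^+ 2 - Q t w)).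
Implicit Types (X Y I J : R -> Omega -> R) (t : R) (f g h Z : Omega -> R).
Local Notation integ := (integ P).
Local Notation sqi := (sqi P).
Local Notation Ex := (Ex P).
Local Notation jm := (joint_measurable F T).
Local Notation norm2 Z := (\int[P]_w ((Z w) ^+ 2)%:E)%E.
Local Notation energy := (energy P T Q).

Let T0T : 0 <= T <= T. Proof. by rewrite lexx ltW. Qed.

Lemma norm2_ge0 Z : (0 <= norm2 Z)%E.
Proof. by apply: integral_ge0 => w _; rewrite lee_fin sqr_ge0. Qed.

Lemma norm2D_le f g (e : R) : measurable_fun setT f -> measurable_fun setT g ->
  0 < e -> (norm2 (fun w => (f w + g w)%R) <=
   (1 + e)%:E * norm2 f + (1 + e^-1)%:E * norm2 g)%E.
Proof.
move=> mf mg e0.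
have m2 Z : measurable_fun setT Z -> measurable_fun setT (fun w => ((Z w) ^+ 2)%:E).
  by move=> mZ; apply/measurable_EFinP/measurable_funX.
apply: ge0_integral_le_lin => //.
- exact: m2.
- exact: m2.
- by apply: (m2 (fun w => f w + g w)); exact: measurable_funD.
- by move=> w _; rewrite lee_fin sqr_ge0.
- by move=> w _; rewrite lee_fin sqr_ge0.
- by move=> w _; rewrite lee_fin sqr_ge0.
- by rewrite addr_ge0 ?(ltW e0).
- by rewrite addr_ge0 ?invr_ge0 ?(ltW e0).
- by move=> w _; rewrite -!EFinM -EFinD lee_fin sqr_add_le.
Qed.

(** The two constants 2 come from the weight [e = 1] in the Young bounds; this squeeze serves
    [norm2] and [energy] alike. *)
Lemma lin2_cvg0 (u v x : (\bar R)^nat) : (forall n, 0 <= x n)%E ->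
  (forall n, x n <= 2%:E * u n + 2%:E * v n)%E ->
  (u n @[n --> \oo] --> 0)%E -> (v n @[n --> \oo] --> 0)%E ->
  (x n @[n --> \oo] --> 0)%E.
Proof.
move=> x0 xuv u0 v0.
apply: (@squeeze_cvge _ _ _ _ (fun=> 0%E) _ (fun n => 2%:E * u n + 2%:E * v n)%E).
- by apply: nearW => n; rewrite x0 xuv.
- exact: cvg_cst.
- have -> : 0%E = (2%:E * 0 + 2%:E * 0)%E :> \bar R by rewrite !mule0 adde0.
  by apply: cvgeD; [rewrite mule0 fin_num_adde_defl|exact: cvgeZl..].
Qed.

Lemma norm2_cvg0D (f g : nat -> Omega -> R) :
  (forall n, measurable_fun setT (f n)) -> (forall n, measurable_fun setT (g n)) ->
  (norm2 (f n) @[n --> \oo] --> 0)%E -> (norm2 (g n) @[n --> \oo] --> 0)%E ->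
  (norm2 (fun w => (f n w + g n w)%R) @[n --> \oo] --> 0)%E.
Proof.
move=> mf mg; apply: lin2_cvg0 => n; first exact: norm2_ge0.
by have := norm2D_le (mf n) (mg n) ltr01; rewrite invr1.
Qed.

Lemma energy_cvg0D (X Y : nat -> R -> Omega -> R) :
  (forall n, jm (X n)) -> (forall n, jm (Y n)) ->
  (energy (X n) @[n --> \oo] --> 0)%E -> (energy (Y n) @[n --> \oo] --> 0)%E ->
  (energy (fun t w => (X n t w + Y n t w)%R) @[n --> \oo] --> 0)%E.
Proof.
move=> mX mY; apply: lin2_cvg0 => n; first exact: energy_ge0.
by have := energyD_le T0 hF hFT gQ (mX n) (mY n) ltr01; rewrite invr1.
Qed.

Lemma norm2N f : norm2 (fun w => - f w) = norm2 f.
Proof. by under eq_integral do rewrite sqrrN. Qed.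

Lemma energyN X : energy (fun t w => - X t w) = energy X.
Proof.
by apply: eq_integral => w _; under eq_integral do rewrite sqrrN.
Qed.

Lemma jointN X : jm X -> jm (fun t w => - X t w).
Proof.
move=> mX; exact: (measurableT_comp (oppr_measurable (D := setT)) mX).
Qed.

(** By the simple isometry, [norm2] and [energy] of the approximants coincide, so they can stand
    between [norm2 (I T)] and [energy X] in either direction; [approx_le] gives one inequality each
    way. *)
Theorem ito_isometry X I : jm X -> ito_integral P T F M Q X I ->
  norm2 (I T) = energy X.
Proof.
move=> mX [hI sI _ [e [se eX eI]]].
have mI : measurable_fun setT (I T) by exact: sqi_measurable (sI _ T0T).
have mS n : measurable_fun setT (simple_integral M (e n) T).
  by apply: (@sqi_measurable _ _ _ P); exact: (sqi_simple_integral hF hM2 (se n) T0T).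
have mE n := joint_simple T0 hF (se n).
have iso n := simple_isometry T0 hF hFT gQ hM hM2 hMQ (se n).
have mSI n : measurable_fun setT (fun w => simple_integral M (e n) T w - I T w).
  exact: measurable_funB.
have mEX n : jm (fun t w => simple_process (e n) t w - X t w) by exact: jointB.
have mSN n : measurable_fun setT (fun w => - (simple_integral M (e n) T w - I T w)).
  exact: (measurableT_comp (oppr_measurable (D := setT)) (mSI n)).
apply/eqP; rewrite eq_le; apply/andP; split.
- apply: (@approx_le _ _ _ (fun n => norm2 (simple_integral M (e n) T)) _ _ (energy_ge0 P T Q X) (eI T T0T) eX) => c c0 n.
  + rewrite -(norm2N (fun w => _ - _)).
    apply: le_trans (norm2D_le (mS n) (mSN n) c0); rewrite le_eqVlt; apply/orP; left.
    by apply/eqP/eq_integral => w _; congr (_ ^+ 2)%:E; ring.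
  + rewrite iso; apply: le_trans (energyD_le T0 hF hFT gQ mX (mEX n) c0).
    rewrite le_eqVlt; apply/orP; left.
    by apply/eqP/eq_energy => t w _; ring.
- apply: (@approx_le _ _ _ (fun n => energy (simple_process (e n))) _ _ (norm2_ge0 (I T)) eX (eI T T0T)) => c c0 n.
  + rewrite -(energyN (fun t w => _ - _)).
    apply: le_trans (energyD_le T0 hF hFT gQ (mE n) (jointN (mEX n)) c0).
    rewrite le_eqVlt; apply/orP; left.
    by apply/eqP/eq_energy => t w _; ring.
  + rewrite -iso; apply: le_trans (norm2D_le mI (mSI n) c0).
    rewrite le_eqVlt; apply/orP; left.
    by apply/eqP/eq_integral => w _; congr (_ ^+ 2)%:E; ring.
Qed.

(** Concatenating the two families of intervals, the second with negated coefficients, represents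
    the difference without a common refinement. *)
Lemma simple_diff (e1 e2 : @simple_integrand R d Omega) :
  simple_predictable T F e1 -> simple_predictable T F e2 ->
  exists e, [/\ simple_predictable T F e,
    simple_process e = (fun t w => simple_process e1 t w - simple_process e2 t w) &
    simple_integral M e =
      (fun t w => simple_integral M e1 t w - simple_integral M e2 t w)].
Proof.
move=> s1 s2.
exists (@SimpleIntegrand _ _ _ (simple_size e1 + simple_size e2)
  (fun i => match fintype.split i with inl j => coef j | inr j => fun w => - coef j w end)
  (fun i => match fintype.split i with inl j => lo j | inr j => lo j end)
  (fun i => match fintype.split i with inl j => hi j | inr j => hi j end)).
split.
- move=> i; rewrite /=; case: splitP => j _; first exact: s1.
  have [lo0 lohi hiT mc [c cc]] := s2 j; split => //; last first.
    by exists c => w; rewrite normrN.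
  have lo0T : 0 <= lo j <= T by rewrite lo0 (le_trans lohi).
  have sF := usual_sigma_algebra hF lo0T.
  apply/sub_measurableP => //; apply: measurableT_comp => //.
  exact/sub_measurableP.
- apply/funext => t; apply/funext => w; rewrite /simple_process/= big_split_ord/=.
  congr (_ + _); last rewrite -sumrN; apply: eq_bigr => i _.
    by rewrite (unsplitK (inl i)).
  by rewrite (unsplitK (inr i)); case: ifP => //; rewrite oppr0.
- apply/funext => t; apply/funext => w; rewrite /simple_integral/= big_split_ord/=.
  congr (_ + _); last rewrite -sumrN; apply: eq_bigr => i _.
    by rewrite (unsplitK (inl i)).
  by rewrite (unsplitK (inr i)) mulNr.
Qed.

Lemma ito_integralB X Y I J : jm X -> jm Y ->
  ito_integral P T F M Q X I -> ito_integral P T F M Q Y J ->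
  ito_integral P T F M Q (fun t w => X t w - Y t w) (fun t w => I t w - J t w).
Proof.
move=> mX mY [hI sI I0 [e [se eX eI]]] [hJ sJ J0 [e' [se' eY eJ]]].
split.
- exact: martingaleB.
- by move=> t t0T; apply: sqiB; [exact: sI|exact: sJ].
- by apply: filterS2 I0 J0 => w -> ->; rewrite subr0.
have /choice[e2 e2P] n := simple_diff (se n) (se' n).
exists e2; split.
- by move=> n; have [] := e2P n.
- have mXn n : jm (fun t w => simple_process (e n) t w - X t w).
    by apply: jointB => //; exact: (joint_simple T0 hF (se n)).
  have mYn n : jm (fun t w => - (simple_process (e' n) t w - Y t w)).
    by apply: jointN; apply: jointB => //; exact: (joint_simple T0 hF (se' n)).
  have := @energy_cvg0D _ _ mXn mYn eX _.
  under eq_fun do rewrite energyN.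
  move=> /(_ eY); apply: cvg_trans; apply: near_eq_cvg; apply: nearW => n.
  by apply: eq_energy => t w _; have [_ -> _] := e2P n; ring.
- move=> t t0T.
  have mSI n : measurable_fun setT (fun w => simple_integral M (e n) t w - I t w).
    apply: measurable_funB; last exact: sqi_measurable (sI _ t0T).
    by apply: (@sqi_measurable _ _ _ P); exact: (sqi_simple_integral hF hM2 (se n) t0T).
  have mSJ n : measurable_fun setT (fun w => - (simple_integral M (e' n) t w - J t w)).
    apply: measurableT_comp => //.
    apply: measurable_funB; last exact: sqi_measurable (sJ _ t0T).
    by apply: (@sqi_measurable _ _ _ P); exact: (sqi_simple_integral hF hM2 (se' n) t0T).
  have := @norm2_cvg0D _ _ mSI mSJ (eI t t0T) _.
  under eq_fun do rewrite norm2N.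
  move=> /(_ (eJ t t0T)); apply: cvg_trans; apply: near_eq_cvg; apply: nearW => n.
  by apply: eq_integral => w _; have [_ _ ->] := e2P n; congr (_ ^+ 2)%:E; ring.
Qed.

End ItoIntegral.

(** * Restriction of integrands to an interval *)

Section PredictableClosure.
Context {R : realType} {d : measure_display} {Omega : measurableType d}.
Variables (T : R).
Implicit Types (F H : R -> set (set Omega)) (X Y : R -> Omega -> R) (s t : R).

Local Notation DT := (setT `*` [set` `[0, T]] : set (Omega * R)).

(** [predictable] refers to a sigma-algebra on the strip over [0, T]. Its sets, extended arbitrarily
    outside the strip, form a sigma-algebra on the whole product, where the lemmas on
    [sub_measurable] apply. *)
Definition predictable_trace F : set (set (Omega * R)) :=
  [set A | <<s DT, predictable_rectangles T F >> (DT `&` A)].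

Lemma predictable_trace_sigma_algebra F : sigma_algebra setT (predictable_trace F).
Proof.
have [S0 SD SU] := smallest_sigma_algebra DT (predictable_rectangles T F).
split; rewrite /predictable_trace/=.
- by rewrite setI0.
- by move=> A /SD; rewrite setTD setDE setCI setIUr setICr set0U.
- by move=> A SA; rewrite setI_bigcupr; exact: SU.
Qed.

Lemma predictableE F X : predictable T F X <->
  sub_measurable (predictable_trace F) (fun p : Omega * R => X p.2 p.1).
Proof. by []. Qed.

Lemma predictableB F X Y : predictable T F X -> predictable T F Y ->
  predictable T F (fun t w => X t w - Y t w).
Proof.
move=> pX pY; apply/predictableE.
exact: (sub_measurableB (predictable_trace_sigma_algebra F) pX pY).
Qed.

Lemma predictableM F X Y : predictable T F X -> predictable T F Y ->
  predictable T F (fun t w => X t w * Y t w).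
Proof.
move=> pX pY; apply/predictableE.
exact: (sub_measurableM (predictable_trace_sigma_algebra F) pX pY).
Qed.

Lemma predictableS F H X : (forall t, 0 <= t <= T -> H t `<=` F t) -> 0 <= T ->
  predictable T H X -> predictable T F X.
Proof.
move=> HF T0 pX D B mB; have := pX B mB; apply: smallest_sub.
  exact: smallest_sigma_algebra.
move=> A HA; apply: sub_sigma_algebra; case: HA => [[C HC <-]|].
  by left; exists C => //; apply: HF => //; rewrite lexx.
move=> [s [t [C [s0 st tT HC ->]]]]; right; exists s, t, C; split => //.
by apply: HF HC; rewrite s0 (le_trans (ltW st)).
Qed.

Definition cut s t X u w : R := (s < u <= t)%R%:R * X u w.

Lemma predictable_cut F X s t : F s setT -> 0 <= s -> s <= t -> t <= T ->
  predictable T F X -> predictable T F (cut s t X).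
Proof.
move=> Fs s0 st tT pX; apply: predictableM => //.
have sS := predictable_trace_sigma_algebra F.
apply/predictableE; apply/sub_measurableP => //.
pose E : set (Omega * R) := setT `*` [set` `]s, t]].
rewrite (_ : (fun p => _) = (\1_E : g_sigma_algebraType (predictable_trace F) -> R)).
  apply: measurable_indic; rewrite measurable_g_measurableTypeE//.
  rewrite /predictable_trace/= setIidr; last first.
    move=> [w u] [_ /=]; rewrite !in_itv/= => /andP[su ut]; split => //=.
    by rewrite (ltW (le_lt_trans s0 su)) (le_trans ut).
  have [s_t|ts] := ltP s t.
    by apply: sub_sigma_algebra; right; exists s, t, setT; split.
  have -> : E = set0.
    apply/seteqP; split=> -[w u]//= [_ /=]; rewrite in_itv/= => /andP[su ut].
    by have := lt_le_trans su (le_trans ut ts); rewrite ltxx.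
  by have [] := smallest_sigma_algebra DT (predictable_rectangles T F).
apply/funext => -[w u] /=; rewrite indicE; congr (_%:R); congr nat_of_bool.
by apply/idP/idP; rewrite in_setE /E/= in_itv/=; [move=> ?; split|case].
Qed.

End PredictableClosure.

(** * Ito integrals of integrands cut to a subinterval *)

Section ItoCut.
Context {R : realType} {d : measure_display} {Omega : measurableType d}.
Variables (P : probability Omega R) (T : R) (F : R -> set (set Omega)).
Hypotheses (T0 : 0 < T) (hF : usual_conditions P T F) (hFT : F T = measurable).
Variables (M Q : R -> Omega -> R) (r : R).
Hypotheses (gQ : good_integrator P T F Q r) (hM : martingale P T F M)
  (hM2 : square_integrable P T M)
  (hMQ : martingale P T F (fun t w => M t w ^+ 2 - Q t w)).
Implicit Types (X Y I J : R -> Omega -> R) (s t : R) (f g h Z : Omega -> R).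
Local Notation sqi := (sqi P).
Local Notation jm := (joint_measurable F T).
Local Notation norm2 Z := (\int[P]_w ((Z w) ^+ 2)%:E)%E.
Local Notation energy := (energy P T Q).

Let T0T : 0 <= T <= T. Proof. by rewrite lexx ltW. Qed.

Lemma joint_cut X s t : jm X -> jm (cut s t X).
Proof.
move=> mX; apply: jointM => //; rewrite /joint_measurable; apply: measurable_funTS.
rewrite (_ : (fun p => _) = (\1_([set` `]s, t]]) \o snd)).
  apply: measurableT_comp; last exact: measurable_snd.
  by apply: measurable_indic; exact: measurable_itv.
apply/funext => -[w u] /=; rewrite indicE; congr (_%:R); congr nat_of_bool.
by apply/idP/idP; rewrite in_setE/= in_itv/=.
Qed.

Lemma energy_le X Y : jm X -> jm Y -> (forall t w, (X t w) ^+ 2 <= (Y t w) ^+ 2) ->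
  (energy X <= energy Y)%E.
Proof.
move=> mX mY XY; apply: ge0_le_integral => //.
- by move=> w _; exact: (path_energy_ge0 T Q X).
- exact: (measurable_path_energy T0 hF hFT gQ mX).
- exact: (measurable_path_energy T0 hF hFT gQ mY).
move=> w _; apply: (@ge0_le_integral _ (measurableTypeR R)) => //.
- by move=> u _; rewrite lee_fin sqr_ge0.
- by apply/measurable_EFinP/measurable_funX; exact: (joint_section w mX).
- by apply/measurable_EFinP/measurable_funX; exact: (joint_section w mY).
- by move=> u _; rewrite lee_fin XY.
Qed.

Lemma cut_sqr_le X s t u w : (cut s t X u w) ^+ 2 <= (X u w) ^+ 2.
Proof.
by rewrite /cut; case: (s < u <= t); rewrite ?mul1r// mul0r expr0n sqr_ge0.
Qed.

(** For the single interval ]a, b] this is the identity between the integral over ]s, t] and a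
    difference of stopped integrals. The outer maximum yields 0 when ]a, b] and ]s, t] are
    disjoint. *)
Lemma increment_clamp (f : R -> R) a b s t v : a <= b -> s <= t ->
  f (Num.min (Num.max (Num.max a s) (Num.min b t)) v) - f (Num.min (Num.max a s) v) =
  (f (Num.min b (Num.min t v)) - f (Num.min a (Num.min t v))) -
  (f (Num.min b (Num.min s v)) - f (Num.min a (Num.min s v))).
Proof.
move=> ab st; rewrite !minA.
have [bs|sb] := leP b s.
  have as_ := le_trans ab bs; have bt := le_trans bs st; have a_t := le_trans ab bt.
  rewrite (max_r as_) (min_l bt) (max_l bs) (min_l a_t) (min_l as_).
  by rewrite !subrr.
have [as_|sa] := leP a s.
  rewrite (min_l (le_trans as_ st)).
  have -> : Num.max s (Num.min b t) = Num.min b t.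
    by rewrite max_r// le_min (ltW sb).
  by rewrite opprB addrA subrK.
have [ta|a_t] := leP t a.
  rewrite (min_r (le_trans ta ab)) (max_l ta).
  by rewrite !subrr.
have -> : Num.max a (Num.min b t) = Num.min b t.
  by rewrite max_r// le_min ab ltW.
by rewrite subrr subr0.
Qed.

Lemma simple_cut (e : @simple_integrand R d Omega) s t : 0 <= s -> s <= t -> t <= T ->
  simple_predictable T F e ->
  exists e', [/\ simple_predictable T F e',
    simple_process e' = cut s t (simple_process e) &
    simple_integral M e' = (fun u w => simple_integral M e (Num.min t u) w -
                                       simple_integral M e (Num.min s u) w)].
Proof.
move=> s0 st tT se.
(* Each interval is intersected with ]s, t]. Left endpoints only move to the right, so the
   coefficients stay measurable there; the outer maximum keeps the endpoints in order. *)
exists (@SimpleIntegrand _ _ _ (simple_size e) (@coef _ _ _ e)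
  (fun i => Num.max (lo i) s)
  (fun i => Num.max (Num.max (lo i) s) (Num.min (hi i) t))).
split.
- move=> /= i; have [lo0 lohi hiT mc cb] := se i.
  have loT : Num.max (lo i) s <= T.
    by rewrite ge_max (le_trans lohi hiT) (le_trans st).
  split => //.
  + by rewrite le_max lo0.
  + by rewrite le_max lexx.
  + by rewrite ge_max loT ge_min hiT.
  + by apply: (sub_measurableS hF lo0 _ loT mc); rewrite le_max lexx.
- apply/funext => u; apply/funext => w; rewrite /simple_process /cut/= mulr_sumr.
  apply: eq_bigr => i _; have [lo0 lohi hiT _ _] := se i.
  have -> : (Num.max (lo i) s < u <= Num.max (Num.max (lo i) s) (Num.min (hi i) t)) =
      (lo i < u <= hi i) && (s < u <= t).
    rewrite !(gt_max, le_max, le_min); apply/idP/idP.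
      by move=> /andP[/andP[a1 a2]]; rewrite a1 a2 !leNgt a1 a2.
    by move=> /andP[/andP[-> ->] /andP[-> ->]]; rewrite orbT.
  by case: (lo i < u <= hi i); case: (s < u <= t); rewrite /= ?(mul1r,mul0r,mulr0).
- apply/funext => u; apply/funext => w; rewrite /simple_integral/= -sumrB.
  apply: eq_bigr => i _; have [lo0 lohi hiT _ _] := se i.
  by rewrite (increment_clamp (M ^~ w))// mulrBr.
Qed.

(** At time T this exhibits [I t - I s] as the terminal value of an Ito integral, the only kind of
    value that weak orthogonality tests. The cut approximants converge because cutting does not
    increase the energy. *)
Lemma ito_integral_cut X I s t : 0 <= s -> s <= t -> t <= T -> jm X ->
  ito_integral P T F M Q X I ->
  ito_integral P T F M Q (cut s t X) (fun u w => I (Num.min t u) w - I (Num.min s u) w).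
Proof.
move=> s0 st tT mX [hI sI I0 [e [se eX eI]]].
have t0T : 0 <= t <= T by rewrite (le_trans s0).
have s0T : 0 <= s <= T by rewrite s0 (le_trans st).
have min0T a u : 0 <= a <= T -> 0 <= u <= T -> 0 <= Num.min a u <= T.
  by move=> /andP[a0 aT] /andP[u0 uT]; rewrite le_min a0 u0 ge_min aT.
split.
- by apply: martingaleB => //; exact: martingale_stop.
- by move=> u u0T; apply: sqiB; apply: sI; exact: min0T.
- by apply: filterS I0 => w Iw; rewrite (min_r s0) (min_r (le_trans s0 st)) subrr.
have /choice[e' e'P] n := simple_cut s0 st tT (se n).
exists e'; split.
- by move=> n; have [] := e'P n.
- apply: (@squeeze_cvge _ _ _ _ (fun=> 0%E) _ _ _ _ (cvg_cst _) eX).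
  apply: nearW => n; rewrite energy_ge0/=.
  have mE : jm (fun u w => simple_process (e n) u w - X u w).
    by apply: jointB => //; exact: (joint_simple T0 hF (se n)).
  have -> : energy (fun u w => simple_process (e' n) u w - cut s t X u w) =
      energy (cut s t (fun u w => simple_process (e n) u w - X u w)).
    by apply: eq_energy => u w _; have [_ -> _] := e'P n; rewrite /cut mulrBr.
  by apply: energy_le => //; [exact: joint_cut|move=> u w; exact: cut_sqr_le].
- move=> u u0T.
  have mm n a : 0 <= a <= T ->
      measurable_fun setT (fun w => simple_integral M (e n) (Num.min a u) w - I (Num.min a u) w).
    move=> a0T; apply: measurable_funB; last exact: sqi_measurable (sI _ (min0T _ _ a0T u0T)).
    by apply: (@sqi_measurable _ _ _ P); exact: (sqi_simple_integral hF hM2 (se n) (min0T _ _ a0T u0T)).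
  have mN n : measurable_fun setT (fun w => - (simple_integral M (e n) (Num.min s u) w - I (Num.min s u) w)).
    by apply: measurableT_comp => //; exact: mm.
  have := @norm2_cvg0D _ _ _ P _ _ (fun n => mm n t t0T) mN (eI _ (min0T _ _ t0T u0T)) _.
  under eq_fun do rewrite norm2N.
  move=> /(_ (eI _ (min0T _ _ s0T u0T))); apply: cvg_trans; apply: near_eq_cvg; apply: nearW => n.
  by apply: eq_integral => w _; have [_ _ ->] := e'P n; congr (_ ^+ 2)%:E; ring.
Qed.

Lemma norm2_eq0 Z : measurable_fun setT Z -> norm2 Z = 0%E -> {ae P, forall w, Z w = 0}.
Proof.
move=> mZ Z0.
have m2 : measurable_fun setT (fun w => ((Z w) ^+ 2)%:E).
  by apply/measurable_EFinP; exact: measurable_funX.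
have /(ae_eq_integral_abs P measurableT m2) : (\int[P]_w `|((Z w) ^+ 2)%:E| = 0)%E.
  by rewrite -[RHS]Z0; apply: eq_integral => w _; rewrite gee0_abs// lee_fin sqr_ge0.
apply: filterS => w /(_ I)[] /eqP; rewrite sqrf_eq0 => /eqP; exact.
Qed.

End ItoCut.

(** * Pathwise integrals and gains *)

Section PathIntegral.
Context {R : realType}.

(** Cauchy-Schwarz against the constant 1, from the nonnegativity of the integral of [(|f| - c)^2]
    for all real [c]. *)
Lemma square_mean_le d (X : measurableType d) (mu : {measure set X -> \bar R})
    (D : set X) (f : X -> R) : measurable D -> (mu D < +oo)%E ->
  measurable_fun D f -> (\int[mu]_(x in D) ((f x) ^+ 2)%:E < +oo)%E ->
  mu.-integrable D (EFin \o f) /\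
  (\int[mu]_(x in D) `|f x|) ^+ 2 <=
    fine (mu D) * \int[mu]_(x in D) (f x) ^+ 2.
Proof.
move=> mD muD mf f2.
have if2 : mu.-integrable D (EFin \o (fun x => (f x) ^+ 2)).
  apply/integrableP; split; first by apply/measurable_EFinP; exact: measurable_funX.
  rewrite (eq_integral (fun x => ((f x) ^+ 2)%:E))// => x _.
  by rewrite /= ger0_norm ?sqr_ge0.
have ic c : mu.-integrable D (EFin \o (fun=> c)).
  apply: measurable_bounded_integrable => //.
  by exists `|c|; split; [exact: num_real|move=> x cx y _; exact: ltW].
have iD (g h : X -> R) : mu.-integrable D (EFin \o g) -> mu.-integrable D (EFin \o h) ->
    mu.-integrable D (EFin \o (fun x => g x + h x)).
  by move=> ig ih; exact: (integrableD mD ig ih).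
(* [|f| <= f^2 + 1], and constants are integrable on a set of finite measure. *)
have iabs : mu.-integrable D (EFin \o (fun x => `|f x|)).
  apply: (le_integrable mD _ _ (iD _ _ if2 (ic 1))).
    by apply/measurable_EFinP; exact: measurableT_comp.
  move=> x Dx /=; rewrite lee_fin normr_id (@ger0_norm _ (_ + _)) ?addr_ge0 ?sqr_ge0//.
  rewrite -(real_normK (num_real (f x))); have := normr_ge0 (f x); nra.
split.
  by apply: le_integrable iabs => //; [exact/measurable_EFinP|move=> x _ /=; rewrite lee_fin normr_id].
set a := Rintegral _ _ _; set b := Rintegral _ _ _; set m := fine _.
have key c : 0 <= b - 2 * c * a + c ^+ 2 * m.
  have : 0 <= \int[mu]_(x in D) ((f x) ^+ 2 + (- (2 * c) * `|f x| + c ^+ 2)).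
    apply: Rintegral_ge0 => x _; have -> : (f x) ^+ 2 + (- (2 * c) * `|f x| + c ^+ 2) = (`|f x| - c) ^+ 2.
      by rewrite -(real_normK (num_real (f x))); ring.
    exact: sqr_ge0.
  have i1 : mu.-integrable D (EFin \o (fun x => - (2 * c) * `|f x|)).
    exact: (integrableZl mD (- (2 * c)) iabs).
  rewrite RintegralD//; last exact: iD.
  rewrite RintegralD// RintegralZl// Rintegral_cst// -/a -/b -/m; lra.
have a0 : 0 <= a by apply: Rintegral_ge0.
have b0 : 0 <= b by apply: Rintegral_ge0 => x _; exact: sqr_ge0.
have m0 : 0 <= m by exact: fine_ge0.
have [mE|mN] := eqVneq m 0.
  have : a <= 0.
    apply/ler_addgt0Pl => e e0; rewrite addr0.
    (* For [m = 0] the polynomial in [c] is affine, and at this [c] it would be negative if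
       [a > e]. *)
    have := key ((b + 1) / (2 * e)); rewrite mE mulr0 addr0.
    have -> : 2 * ((b + 1) / (2 * e)) * a = (b + 1) * (a / e) by field; rewrite gt_eqF.
    rewrite subr_ge0 => H; rewrite leNgt; apply/negP => ea.
    have : 1 < a / e by rewrite ltr_pdivlMr// mul1r.
    nra.
  by move=> a0'; rewrite mE mul0r (_ : a = 0) ?expr0n//; apply/eqP; rewrite eq_le a0' a0.
have m1 : 0 < m by rewrite lt_neqAle eq_sym mN.
have := key (a / m).
have -> : b - 2 * (a / m) * a + (a / m) ^+ 2 * m = b - a ^+ 2 / m by field.
by rewrite subr_ge0 ler_pdivrMr// mulrC.
Qed.

Lemma weighted_square_le d (X : measurableType d) (mu : {measure set X -> \bar R})
    (D : set X) (f g : X -> R) (K : R) : measurable D -> (mu D < +oo)%E -> 0 <= K ->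
  measurable_fun D f -> measurable_fun D g ->
  (\int[mu]_(x in D) ((f x) ^+ 2)%:E < +oo)%E ->
  {ae mu, forall x, D x -> `|g x| <= K} ->
  mu.-integrable D (EFin \o (fun x => f x * g x)) /\
  (\int[mu]_(x in D) (f x * g x)) ^+ 2 <=
    K ^+ 2 * (fine (mu D) * \int[mu]_(x in D) (f x) ^+ 2).
Proof.
move=> mD muD K0 mf mg f2 gK.
have [if_ fle] := square_mean_le mD muD mf f2.
have mfg : measurable_fun D (fun x => f x * g x) by exact: measurable_funM.
have iabs := integrable_norm if_.
have iKf : mu.-integrable D (EFin \o (fun x => K * `|f x|)).
  exact: (integrableZl mD K iabs).
have fgK : (\int[mu]_(x in D) `|f x * g x|%:E <= \int[mu]_(x in D) (K * `|f x|)%:E)%E.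
  apply: ae_ge0_le_integral => //.
  - by apply/measurable_EFinP; exact: measurableT_comp.
  - by move=> x _; rewrite lee_fin mulr_ge0.
  - exact: measurable_int iKf.
  apply: filterS gK => x gx Dx.
  by rewrite lee_fin normrM mulrC ler_wpM2r// gx.
have ifg : mu.-integrable D (EFin \o (fun x => f x * g x)).
  apply/integrableP; split; first exact/measurable_EFinP.
  by apply: le_lt_trans fgK _; exact: integrable_lty.
split=> //.
rewrite -(real_normK (num_real (Rintegral _ _ _))).
have ifg' := integrable_norm ifg.
have h1 : `|\int[mu]_(x in D) (f x * g x)| <= K * \int[mu]_(x in D) `|f x|.
  apply: le_trans (le_normr_Rintegral mD ifg) _.
  rewrite -RintegralZl//; apply: fine_le fgK; exact: integrable_fin_num.
apply: (@le_trans _ _ ((K * \int[mu]_(x in D) `|f x|) ^+ 2)).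
  by rewrite lerXn2r// nnegrE ?mulr_ge0// Rintegral_ge0.
by rewrite exprMn ler_wpM2l ?sqr_ge0.
Qed.

End PathIntegral.

(** * Indistinguishability of right-continuous processes and of Ito integrals *)

Section Uniqueness.
Context {R : realType} {d : measure_display} {Omega : measurableType d}.
Variables (P : probability Omega R) (T : R) (F : R -> set (set Omega)).
Hypotheses (T0 : 0 < T) (hF : usual_conditions P T F) (hFT : F T = measurable).
Implicit Types (X Y N : R -> Omega -> R).

(** Rationals approach every t < T from the right. The value at T is a separate hypothesis, since
    right-continuity before T does not reach it and T may be irrational. *)
Lemma right_continuous_eq (f g : R -> R) :
  right_continuous_path T f -> right_continuous_path T g -> f T = g T ->
  (forall q : rat, 0 <= (ratr q : R) <= T -> f (ratr q) = g (ratr q)) ->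
  forall t, 0 <= t <= T -> f t = g t.
Proof.
move=> rf rg fgT fgq t /andP[t0]; rewrite le_eqVlt => /predU1P[->//|tT].
apply/eqP; rewrite -subr_eq0 -normr_le0; apply/ler_addgt0Pl => e e0; rewrite addr0.
have cv : (f s - g s) @[s --> t^'+] --> f t - g t.
  by apply: cvgB; [exact: rf|exact: rg].
have /cvgrPdist_lt/(_ _ e0) := cv => -[eps /= eps0 H].
have tm : t < Num.min T (t + eps) by rewrite lt_min tT ltrDl.
have [q] := rat_in_itvoo tm; rewrite in_itv/= lt_min => /andP[tq /andP[qT qe]].
have := H (ratr q); rewrite /ball/= ltr0_norm ?subr_lt0//.
rewrite opprB ltrBlDl => /(_ qe tq).
rewrite fgq ?subrr ?subr0; first exact: ltW.
by rewrite (ltW qT) (le_trans t0)// ltW.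
Qed.

Lemma indistinguishable_right_continuous X Y :
  {ae P, forall w, right_continuous_path T (X ^~ w)} ->
  {ae P, forall w, right_continuous_path T (Y ^~ w)} ->
  (forall t, 0 <= t <= T -> {ae P, forall w, X t w = Y t w}) ->
  indistinguishable P T X Y.
Proof.
move=> rX rY XY.
have XYT : {ae P, forall w, X T w = Y T w} by apply: XY; rewrite lexx ltW.
(* [pickle] enumerates the rationals, so the exceptional sets form a countable union. *)
have XYq : {ae P, forall w, forall n, forall q : rat, unpickle n = Some q ->
    0 <= (ratr q : R) <= T -> X (ratr q) w = Y (ratr q) w}.
  apply/ae_foralln => n; case: (unpickle n) => [q|]; last by apply: aeW => w q.
  have [q0T|q0T] := boolP (0 <= (ratr q : R) <= T); last first.
    by apply: aeW => w _ [<-] h; rewrite h in q0T.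
  by apply: filterS (XY _ q0T) => w XYw _ [<-].
apply: filterS3 rX rY (filterI XYT XYq) => w rXw rYw [XYTw XYqw].
apply: right_continuous_eq => //= q q0T.
by apply: (XYqw (pickle q)) => //; rewrite pickleK.
Qed.

(** [N t] is orthogonal to [N T - N t], which is almost surely [- N t]. *)
Lemma martingale_eq0 N : martingale P T F N -> sqi P (N T) ->
  {ae P, forall w, N T w = 0} -> forall t, 0 <= t <= T -> {ae P, forall w, N t w = 0}.
Proof.
move=> hN sN N0 t /[dup] t0T /andP[t0 tT].
have sNt := martingale_sqi hF hN sN t0T.
have [aN _ _] := hN.
have mNt := sqi_measurable sNt; have mNT := sqi_measurable sN.
have := martingale_orth hF hN sNt sN t0 tT (lexx T) (aN _ t0T) sNt.
have -> : Ex P (fun w => N t w * (N T w - N t w)) = Ex P (fun w => - (N t w ^+ 2)).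
  apply: ae_Ex.
  - by apply: measurable_funM => //; exact: measurable_funB.
  - by apply: measurableT_comp => //; exact: measurable_funX.
  by apply: filterS N0 => w ->; ring.
move=> N20; apply: norm2_eq0 => //.
rewrite (ExE (sqi_sqr sNt)); congr EFin.
apply/eqP; rewrite -oppr_eq0 -mulN1r -ExZ; last exact: sqi_sqr.
by rewrite -N20; apply/eqP; apply: eq_Ex => w; rewrite mulN1r.
Qed.

Lemma martingale_indistinguishable X Y : martingale P T F X -> martingale P T F Y ->
  sqi P (X T) -> sqi P (Y T) -> {ae P, forall w, X T w = Y T w} ->
  indistinguishable P T X Y.
Proof.
move=> hX hY sX sY XYT.
have [_ _ rX] := hX; have [_ _ rY] := hY.
apply: indistinguishable_right_continuous.
- by apply: filterS rX => w [].
- by apply: filterS rY => w [].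
move=> t t0T; have hXY := martingaleB hF hX hY.
have := martingale_eq0 hXY (sqiB sX sY) _ t0T.
have XY0 : {ae P, forall w, X T w - Y T w = 0}.
  by apply: filterS XYT => w ->; rewrite subrr.
by move=> /(_ XY0); apply: filterS => w /eqP; rewrite subr_eq0 => /eqP.
Qed.

Variables (M Q : R -> Omega -> R) (r : R).
Hypotheses (gQ : good_integrator P T F Q r) (hM : martingale P T F M)
  (hM2 : square_integrable P T M)
  (hMQ : martingale P T F (fun t w => M t w ^+ 2 - Q t w)).
Implicit Types (I J : R -> Omega -> R) (s t : R).
Local Notation jm := (joint_measurable F T).
Local Notation energy := (energy P T Q).

Lemma ito_integral_eq X Y I J : jm X -> jm Y ->
  energy (fun t w => X t w - Y t w) = 0%E ->
  ito_integral P T F M Q X I -> ito_integral P T F M Q Y J ->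
  indistinguishable P T I J.
Proof.
move=> mX mY XY0 iI iJ.
have T0T : 0 <= T <= T by rewrite lexx ltW.
have [hI sI _ _] := iI; have [hJ sJ _ _] := iJ.
apply: martingale_indistinguishable => //; [exact: sI|exact: sJ|].
have iIJ := ito_integralB T0 hF hFT gQ hM2 mX mY iI iJ.
have := ito_isometry T0 hF hFT gQ hM hM2 hMQ (jointB mX mY) iIJ.
rewrite XY0 => /norm2_eq0 h.
have : {ae P, forall w, I T w - J T w = 0}.
  by apply: h; exact/sqi_measurable/sqiB/sJ/T0T/sI.
by apply: filterS => w /eqP; rewrite subr_eq0 => /eqP.
Qed.

Lemma energy0 X : (forall t w, X t w = 0) -> energy X = 0%E.
Proof.
move=> X0; rewrite /Defs.energy.
under eq_integral do under eq_integral do rewrite X0 expr0n.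
by under eq_integral do rewrite integral0; rewrite integral0.
Qed.

End Uniqueness.

(** * The drift part and the gains process *)

Section Gains.
Context {R : realType} {d : measure_display} {Omega : measurableType d}.
Variables (P : probability Omega R) (T : R) (F : R -> set (set Omega)).
Hypotheses (T0 : 0 < T) (hF : usual_conditions P T F) (hFT : F T = measurable).
Variables (M Q alpha : R -> Omega -> R) (r K : R).
Hypotheses (gQ : good_integrator P T F Q r) (hM : martingale P T F M)
  (hM2 : square_integrable P T M)
  (hMQ : martingale P T F (fun t w => M t w ^+ 2 - Q t w)).
Hypotheses (palpha : predictable T F alpha) (K0 : 0 <= K)
  (alphaK : doleans_ae P T Q (fun t w => `|alpha t w| <= K)).
Implicit Types (X Y I J G theta : R -> Omega -> R) (s t : R).
Local Notation jm := (joint_measurable F T).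
Local Notation norm2 Z := (\int[P]_w ((Z w) ^+ 2)%:E)%E.
Local Notation energy := (energy P T Q).
Local Notation path_energy := (path_energy T Q).

Let T0T : 0 <= T <= T. Proof. by rewrite lexx ltW. Qed.

Lemma measurable_dpath_xsection (N : set (Omega * R)) : measurable N ->
  measurable_fun setT (fun w => dpath T Q w ([set` `]0%R, T]] `&` xsection N w)).
Proof.
move=> mN; apply/(measurable_terminal hFT).
rewrite (_ : (fun w => _) = (fun w : g_sigma_algebraType (F T) =>
    \int[dpath T Q w]_(s in [set` `]0%R, T]]) (\1_N (w, s))%:E)%E).
  apply: (good_dpath_measurable hF (k := fun z => (\1_N z)%:E) gQ T0T).
    by move=> z; rewrite lee_fin.
  apply/measurable_EFinP; apply: measurable_funTS; apply: measurable_indic.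
  exact/(measurable_prod_terminal hFT).
apply/funext => w.
have mNw : measurable (xsection N w : set (measurableTypeR R)).
  exact: (@measurable_xsection _ _ Omega (measurableTypeR R)).
transitivity (\int[dpath T Q w]_(s in [set` `]0%R, T]]) (\1_(xsection N w) s)%:E)%E.
  by rewrite integral_indic//= setIC.
apply: eq_integral => s _; rewrite !indicE; congr (_%:R%:E); congr nat_of_bool.
by apply/idP/idP; rewrite !in_setE /xsection/= in_setE.
Qed.

Lemma doleans_eq0P (N : set (Omega * R)) : measurable N ->
  doleans P T Q N = 0%E <->
  {ae P, forall w, dpath T Q w ([set` `]0%R, T]] `&` xsection N w) = 0%E}.
Proof.
move=> mN; have mf := measurable_dpath_xsection mN.
have := ae_eq_integral_abs P measurableT mf.
rewrite (eq_integral (fun w => dpath T Q w ([set` `]0%R, T]] `&` xsection N w))); last first.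
  by move=> w _; rewrite gee0_abs.
move=> [h1 h2]; split=> [/h1|h]; first by apply: filterS => w /(_ I).
by apply: h2; apply: filterS h => w.
Qed.

Definition alpha_bounded w := (dpath T Q w).-negligible
  (~` [set s | [set` `]0, T]] s -> `|alpha s w| <= K]).

(** A null set of the measure [doleans P T Q] has null sections for almost every path, and the times
    in ]0, T] at which the bound on [alpha] fails lie in such a section. *)
Lemma ae_alpha_bounded : {ae P, forall w, alpha_bounded w}.
Proof.
have [N [mN /(doleans_eq0P mN) N0 aK]] := alphaK.
apply: filterS N0 => w N0; exists ([set` `]0, T]] `&` xsection N w); split => //.
  apply: measurableI; first exact: measurable_itv.
  exact: (@measurable_xsection _ _ Omega (measurableTypeR R)).
move=> s /= /not_implyP[s0T]; rewrite /xsection/= in_setE => asK; split => //.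
apply: contrapT => nN; apply: asK; apply: aK => //.
by move: s0T; rewrite /= in_itv/= => /andP[/ltW -> ->].
Qed.

(** Collects the almost sure properties under which the estimates on the drift become
    deterministic. *)
Definition good_path theta w := [/\ increasing_path T (Q ^~ w),
  (path_energy theta w < +oo)%E & alpha_bounded w].

Lemma ae_good_path theta : jm theta -> (energy theta < +oo)%E ->
  {ae P, forall w, good_path theta w}.
Proof.
move=> mt et; have [_ _ iQ _] := gQ.
have ie : P.-integrable setT (path_energy theta).
  apply/integrableP; split; first exact: (measurable_path_energy T0 hF hFT gQ mt).
  apply: le_lt_trans et; rewrite le_eqVlt; apply/orP; left; apply/eqP.
  by apply: eq_integral => w _; rewrite gee0_abs// path_energy_ge0.
have := integrable_ae measurableT ie.
move=> h; apply: filterS3 iQ h ae_alpha_bounded => w ? /(_ I) fw ?; split => //.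
by rewrite -ge0_fin_numE// path_energy_ge0.
Qed.

Lemma path_energy_cut theta s t w : 0 <= s -> t <= T ->
  path_energy (cut s t theta) w =
  (\int[dpath T Q w]_(u in [set` `]s, t]]) ((theta u w) ^+ 2)%:E)%E.
Proof.
move=> s0 tT; rewrite -[in RHS](@setIidr _ [set` `]0, T]] [set` `]s, t]]); last first.
  move=> u /=; rewrite !in_itv/= => /andP[su ut].
  by rewrite (le_lt_trans s0 su) (le_trans ut).
rewrite integral_mkcondr; apply: eq_integral => u _; rewrite patchE /cut.
have -> : (u \in [set` `]s, t]]) = (s < u <= t).
  by apply/idP/idP; rewrite in_setE/= in_itv/=.
by case: (s < u <= t); rewrite ?mul1r// mul0r expr0n.
Qed.

Lemma path_energy_cut_le theta s t w : jm theta -> 0 <= s -> t <= T ->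
  (path_energy (cut s t theta) w <= path_energy theta w)%E.
Proof.
move=> mt s0 tT; rewrite path_energy_cut//; apply: ge0_subset_integral => //.
- by apply/measurable_EFinP/measurable_funX; exact: (joint_section w mt).
- by move=> u _; rewrite lee_fin sqr_ge0.
move=> u /=; rewrite !in_itv/= => /andP[su ut].
by rewrite (le_lt_trans s0 su) (le_trans ut).
Qed.

Definition drift theta := path_integral T Q (fun s v => theta s v * alpha s v).

Let jalpha : jm alpha := predictable_joint hF T0T palpha.

Lemma drift_integrable theta s t w : jm theta -> good_path theta w ->
  0 <= s -> s <= t -> t <= T ->
  (dpath T Q w).-integrable [set` `]s, t]] (EFin \o (fun u => theta u w * alpha u w)) /\
  (\int[dpath T Q w]_(u in [set` `]s, t]]) (theta u w * alpha u w)) ^+ 2 <=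
    K ^+ 2 * ((Q t w - Q s w) * fine (path_energy (cut s t theta) w)).
Proof.
move=> mt [iQ eQ aK] s0 st tT.
have sub : [set` `]s, t]] `<=` [set` `]0, T]].
  move=> u /=; rewrite !in_itv/= => /andP[su ut].
  by rewrite (le_lt_trans s0 su) (le_trans ut).
have mD : measurable ([set` `]s, t]] : set (measurableTypeR R)) by exact: measurable_itv.
have mD' : measurable ([set` `]0, T]] : set (measurableTypeR R)) by exact: measurable_itv.
have dE : dpath T Q w [set` `]s, t]] = (Q t w - Q s w)%:E.
  by rewrite /dpath stieltjes_path_itv.
have eE := path_energy_cut theta w s0 tT.
have [||||||h1 h2] := @weighted_square_le _ _ (measurableTypeR R)
  (lebesgue_stieltjes_measure (stieltjes_path T (Q ^~ w))) [set` `]s, t]]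
  (theta ^~ w) (alpha ^~ w) K mD.
- by have := ltry (Q t w - Q s w); rewrite -dE.
- exact: K0.
- exact: (measurable_funS mD' sub (joint_section w mt)).
- exact: (measurable_funS mD' sub (joint_section w jalpha)).
- by apply: le_lt_trans eQ; rewrite -[leLHS]eE path_energy_cut_le.
- by apply: negligibleS aK => u /= h1 h2; apply: h1 => ust; apply: h2; exact: sub.
split; first exact: h1.
apply: le_trans h2 _; rewrite le_eqVlt; apply/orP; left; apply/eqP.
congr (_ * (_ * _)); last by rewrite eE.
exact: (congr1 fine dE).
Qed.

Lemma driftB_incr theta s t w : jm theta -> good_path theta w ->
  0 <= s -> s <= t -> t <= T ->
  drift theta t w - drift theta s w =
  \int[dpath T Q w]_(u in [set` `]s, t]]) (theta u w * alpha u w).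
Proof.
move=> mt gw s0 st tT.
have E : [set` `]0, t]] = [set` `]0, s]] `|` [set` `]s, t]].
  apply/seteqP; split=> u /=; rewrite !in_itv/=.
    by move=> /andP[u0 ut]; case: (leP u s) => us; [left|right]; rewrite ?u0// us.
  by case=> /andP[u1 u2]; rewrite ?u1 ?u2 ?(le_lt_trans s0 u1) ?(le_trans u2).
rewrite /drift /path_integral E Rintegral_setU//.
- by rewrite addrC addKr.
- by rewrite -E; have [] := drift_integrable mt gw (lexx 0) (le_trans s0 st) tT.
- apply/disj_setPS => u [] /=; rewrite !in_itv/= => /andP[_ us] /andP[su _].
  by have := lt_le_trans su us; rewrite ltxx.
Qed.

Lemma drift_incr_le theta s t w : jm theta -> good_path theta w ->
  0 <= s -> s <= t -> t <= T ->
  (drift theta t w - drift theta s w) ^+ 2 <=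
  K ^+ 2 * ((Q t w - Q s w) * fine (path_energy (cut s t theta) w)).
Proof.
move=> mt gw s0 st tT; rewrite driftB_incr//.
by have [] := drift_integrable mt gw s0 st tT.
Qed.

Lemma drift0 theta w : drift theta 0 w = 0.
Proof.
rewrite /drift /path_integral (_ : [set` `]0, 0]] = set0) ?Rintegral_set0//.
by apply/seteqP; split=> u //=; rewrite in_itv/= => /andP[u0 /(lt_le_trans u0)]; rewrite ltxx.
Qed.

(** By Cauchy-Schwarz the squared increments of the drift are at most a constant times those of [Q],
    so right-continuity is inherited from [Q]. *)
Lemma drift_right_continuous theta w : jm theta -> good_path theta w ->
  right_continuous_path T (drift theta ^~ w).
Proof.
move=> mt gw t t0 tT; have [[_ rQ] eQ _] := gw.
(* The added 1 makes [C] positive, hence a legitimate divisor. *)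
pose C := K ^+ 2 * fine (path_energy theta w) + 1.
have C0 : 0 < C.
  by rewrite ltr_wpDl// mulr_ge0 ?sqr_ge0// fine_ge0// path_energy_ge0.
have bound s : t <= s -> s <= T ->
    (drift theta s w - drift theta t w) ^+ 2 <= C * (Q s w - Q t w).
  move=> ts sT; apply: le_trans (drift_incr_le mt gw t0 ts sT) _.
  have [[nQ _] _ _] := gw.
  have Q0 : 0 <= Q s w - Q t w by rewrite subr_ge0 nQ.
  have : fine (path_energy (cut t s theta) w) <= fine (path_energy theta w).
    have le := path_energy_cut_le w mt t0 sT.
    rewrite fine_le//; rewrite ge0_fin_numE ?path_energy_ge0//.
    exact: le_lt_trans le eQ.
  move=> h.
  apply: (@le_trans _ _ (K ^+ 2 * ((Q s w - Q t w) * fine (path_energy theta w)))).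
    by apply: ler_wpM2l; [exact: sqr_ge0|exact: ler_wpM2l].
  rewrite -subr_ge0 (_ : _ - _ = Q s w - Q t w)//.
  by rewrite /C; ring.
apply/cvgrPdist_lt => e e0.
have /cvgrPdist_lt/(_ (e ^+ 2 / C)) := rQ t t0 tT.
rewrite divr_gt0 ?exprn_gt0// => /(_ isT) H.
near=> s.
have ts : t <= s by near: s; exact: nbhs_right_ge.
have sT : s <= T by near: s; exact: nbhs_right_le.
have : `|Q t w - Q s w| < e ^+ 2 / C by near: s; exact: H.
rewrite ltr_pdivlMr// mulrC => h.
rewrite -(ltr_pXn2r (n := 2))// ?nnegrE ?(ltW e0)// real_normK ?num_real//.
rewrite -sqrrN opprB; apply: le_lt_trans (bound s ts sT) _.
apply: le_lt_trans h; rewrite ler_wpM2l ?(ltW C0)// distrC ler_norm//.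
Unshelve. all: by end_near. Qed.

Lemma drift_adapted theta t : predictable T F theta -> 0 <= t <= T ->
  sub_measurable (F t) (drift theta t).
Proof.
by move=> pt t0T; apply: (path_integral_adapted hF gQ _ t0T); exact: predictableM.
Qed.

(** The almost sure bound on the increment of [Q] leaves the expectation as the constant [c]. What
    remains is the energy over ]s, t] with a factor that a short interval makes small. *)
Lemma drift_incr_norm2_le theta s t c : predictable T F theta ->
  (energy theta < +oo)%E ->
  0 <= s -> s <= t -> t <= T -> 0 <= c ->
  {ae P, forall w, Q t w - Q s w <= c} ->
  (norm2 (fun w => (drift theta t w - drift theta s w)%R) <=
   (K ^+ 2 * c)%:E * energy (cut s t theta))%E.
Proof.
move=> pt et s0 st tT c0 Qc.
have t0T : 0 <= t <= T by rewrite (le_trans s0).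
have s0T : 0 <= s <= T by rewrite s0 (le_trans st).
have mt := predictable_joint hF T0T pt.
have mc := joint_cut s t mt.
have mD u : 0 <= u <= T -> measurable_fun setT (drift theta u).
  by move=> u0T; exact: (usual_sub_measurable hF u0T (drift_adapted pt u0T)).
have mpe := measurable_path_energy T0 hF hFT gQ mc.
rewrite -ge0_integralZl//; last 2 first.
- by move=> w _; exact: path_energy_ge0.
- by rewrite lee_fin mulr_ge0 ?sqr_ge0.
apply: ae_ge0_le_integral => //.
- by move=> w _; rewrite lee_fin sqr_ge0.
- by apply/measurable_EFinP; apply: measurable_funX; apply: measurable_funB; exact: mD.
- by move=> w _; rewrite mule_ge0 ?lee_fin ?mulr_ge0 ?sqr_ge0// path_energy_ge0.
- exact: measurable_funeM.
apply: filterS2 (ae_good_path mt et) Qc => w gw Qcw _.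
have [iQ eQ _] := gw.
have fe : path_energy (cut s t theta) w \is a fin_num.
  rewrite ge0_fin_numE ?path_energy_ge0//.
  exact: le_lt_trans (path_energy_cut_le w mt s0 tT) eQ.
rewrite -[leRHS](_ : (K ^+ 2 * c * fine (path_energy (cut s t theta) w))%:E = _)%E; last first.
  by rewrite EFinM fineK.
rewrite lee_fin; apply: le_trans (drift_incr_le mt gw s0 st tT) _.
rewrite -mulrA ler_wpM2l ?sqr_ge0// ler_wpM2r// fine_ge0// path_energy_ge0//.
Qed.

Lemma drift_sqi theta t : predictable T F theta -> (energy theta < +oo)%E ->
  0 <= t <= T -> sqi P (drift theta t).
Proof.
move=> pt et /[dup] t0T /andP[t0 tT].
have mt := predictable_joint hF T0T pt.
have mD : measurable_fun setT (drift theta t).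
  exact: (usual_sub_measurable hF t0T (drift_adapted pt t0T)).
apply/sqiP; split => //; apply/integrableP; split.
  by apply/measurable_EFinP; exact: measurable_funX.
have r0 : 0 <= Num.max r 0 by rewrite le_max lexx orbT.
have Qr : {ae P, forall w, Q t w - Q 0 w <= Num.max r 0}.
  have [_ Q0 iQ Qr] := gQ; apply: filterS3 Q0 iQ Qr => w -> [nQ _] Qr.
  by rewrite subr0 le_max (le_trans (nQ _ _ t0 tT (lexx _)) Qr).
have := drift_incr_norm2_le pt et (lexx 0) t0 tT r0 Qr.
move=> h; apply: (@le_lt_trans _ _ (norm2 (fun w => (drift theta t w - drift theta 0 w)%R))).
  rewrite le_eqVlt; apply/orP; left; apply/eqP; apply: eq_integral => w _.
  by rewrite drift0 subr0 /= ger0_norm ?sqr_ge0.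
apply: le_lt_trans h _; rewrite lte_mul_pinfty ?lee_fin ?mulr_ge0 ?sqr_ge0//.
apply: le_lt_trans et; apply: (energy_le T0 hF hFT gQ) => //; first exact: joint_cut.
by move=> u w; exact: cut_sqr_le.
Qed.

Lemma usual_ae_sub_measurable X Y t : 0 <= t <= T -> {ae P, forall w, X t w = Y t w} ->
  sub_measurable (F t) (X t) -> sub_measurable (F t) (Y t).
Proof.
move=> t0T XY; have sF := usual_sigma_algebra hF t0T.
move=> /(sub_measurableP _ sF) mX; apply/(sub_measurableP _ sF).
exact: (usual_ae_measurable hF t0T XY mX).
Qed.

Lemma indistinguishable_at X Y t : indistinguishable P T X Y -> 0 <= t <= T ->
  {ae P, forall w, X t w = Y t w}.
Proof. by move=> XY t0T; apply: filterS XY => w; exact. Qed.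

Lemma indistinguishable_sym X Y : indistinguishable P T X Y -> indistinguishable P T Y X.
Proof. by apply: filterS => w h t /h. Qed.

Lemma indistinguishable_trans X Y Z : indistinguishable P T X Y ->
  indistinguishable P T Y Z -> indistinguishable P T X Z.
Proof. by apply: filterS2 => w h1 h2 t t0T; rewrite h1// h2. Qed.

Section OneIntegrand.
Variables theta G : R -> Omega -> R.
Hypotheses (ptheta : predictable T F theta) (etheta : (energy theta < +oo)%E).
Hypothesis hG : gains P T F M Q alpha theta G.

(** [G] agrees with an adapted process only off a null set; completeness of the filtration makes [G]
    itself adapted. *)
Lemma gains_adapted : adapted T F G.
Proof.
have [I [[hI _ _ _] GI]] := hG => t t0T; have [aI _ _] := hI.
apply: (usual_ae_sub_measurable t0T (X := fun t w => I t w + drift theta t w)).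
  exact: (indistinguishable_at (indistinguishable_sym GI) t0T).
by apply: sub_measurableD; [exact: (usual_sigma_algebra hF)|exact: aI|exact: drift_adapted].
Qed.

Lemma gains_sqi t : 0 <= t <= T -> sqi P (G t).
Proof.
move=> t0T; have [I [[_ sI _ _] GI]] := hG.
have mG := usual_sub_measurable hF t0T (gains_adapted t0T).
have sID : sqi P (fun w => I t w + drift theta t w).
  by apply: sqiD; [exact: sI|exact: drift_sqi].
apply/sqiP; split => //; apply/integrableP; split.
  by apply/measurable_EFinP; exact: measurable_funX.
have /integrableP[_] := sqi_sqr sID; apply: le_lt_trans.
rewrite le_eqVlt; apply/orP; left; apply/eqP; apply: ae_eq_integral => //.
- by apply: measurableT_comp => //; apply/measurable_EFinP; exact: measurable_funX.
- by apply: measurableT_comp => //; apply/measurable_EFinP; apply: measurable_funX;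
    exact: sqi_measurable sID.
- by apply: filterS (indistinguishable_at GI t0T) => w GIw _ /=; rewrite GIw.
Qed.

Lemma gains_right_continuous : {ae P, forall w, right_continuous_path T (G ^~ w)}.
Proof.
have [I [[[_ _ cI] _ _ _] GI]] := hG.
have mt := predictable_joint hF T0T ptheta.
apply: filterS3 cI (ae_good_path mt etheta) GI => w [rI _] gw Gw t t0 tT.
rewrite Gw ?t0 ?ltW//.
apply: cvg_trans (cvgD (rI t t0 tT) (drift_right_continuous mt gw t0 tT)).
apply: near_eq_cvg; near=> s; rewrite /= Gw//; apply/andP; split.
  by apply: le_trans t0 _; near: s; exact: nbhs_right_ge.
by near: s; exact: nbhs_right_le.
Unshelve. all: by end_near. Qed.

End OneIntegrand.

Lemma driftB theta theta' w t : jm theta -> jm theta' ->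
  good_path theta w -> good_path theta' w -> 0 <= t <= T ->
  drift (fun t w => theta t w - theta' t w) t w = drift theta t w - drift theta' t w.
Proof.
move=> mt mt' gw gw' /andP[t0 tT].
have [i1 _] := drift_integrable mt gw (lexx 0) t0 tT.
have [i2 _] := drift_integrable mt' gw' (lexx 0) t0 tT.
rewrite /drift /path_integral -RintegralB//.
by apply: eq_Rintegral => s _; rewrite mulrBl.
Qed.

Lemma drift_eq0 theta w t : jm theta -> good_path theta w -> path_energy theta w = 0%E ->
  0 <= t <= T -> drift theta t w = 0.
Proof.
move=> mt gw e0 /andP[t0 tT].
have := drift_incr_le mt gw (lexx 0) t0 tT.
rewrite drift0 subr0 (_ : path_energy (cut 0 t theta) w = 0%E).
  by rewrite /= !mulr0 => h; apply/eqP; rewrite -sqrf_eq0 eq_le h sqr_ge0.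
apply/eqP; rewrite eq_le path_energy_ge0 andbT -e0; exact: path_energy_cut_le.
Qed.

Lemma energy_eq0 theta : jm theta -> energy theta = 0%E ->
  {ae P, forall w, path_energy theta w = 0%E}.
Proof.
move=> mt e0.
have mp := measurable_path_energy T0 hF hFT gQ mt.
have /(ae_eq_integral_abs P measurableT mp) : (\int[P]_w `|path_energy theta w| = 0)%E.
  by rewrite -[RHS]e0; apply: eq_integral => w _; rewrite gee0_abs// path_energy_ge0.
by apply: filterS => w /(_ I).
Qed.

(** Since [gains] is a relation, even two gains of the same integrand have to be identified. Zero
    energy of the difference kills the Ito part by the isometry and the drift path by path. *)
Lemma gains_eq theta theta' G G' :
  predictable T F theta -> (energy theta < +oo)%E ->
  predictable T F theta' -> (energy theta' < +oo)%E ->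
  energy (fun t w => theta t w - theta' t w) = 0%E ->
  gains P T F M Q alpha theta G -> gains P T F M Q alpha theta' G' ->
  indistinguishable P T G G'.
Proof.
move=> pt et pt' et' d0 [I [iI GI]] [J [iJ GJ]].
have mt := predictable_joint hF T0T pt.
have mt' := predictable_joint hF T0T pt'.
have IJ := ito_integral_eq T0 hF hFT gQ hM hM2 hMQ mt mt' d0 iI iJ.
have ed : (energy (fun t w => (theta t w - theta' t w)%R) < +oo)%E by rewrite d0.
have gd : {ae P, forall w, good_path (fun t w => theta t w - theta' t w) w /\
    path_energy (fun t w => theta t w - theta' t w) w = 0%E}.
  by apply: filterS2 (ae_good_path (jointB mt mt') ed) (energy_eq0 (jointB mt mt') d0).
have gg : {ae P, forall w, good_path theta w /\ good_path theta' w}.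
  by apply: filterS2 (ae_good_path mt et) (ae_good_path mt' et').
apply: indistinguishable_trans (GI) _.
apply: indistinguishable_trans _ (indistinguishable_sym GJ).
apply: filterS3 IJ gd gg => w IJw [g0 e0] [g1 g2] t t0T.
rewrite IJw//; congr (_ + _); apply/eqP; rewrite -subr_eq0.
have := driftB mt mt' g1 g2 t0T; rewrite (drift_eq0 _ g0 e0 t0T); last exact: jointB.
by rewrite /drift => <-.
Qed.

End Gains.

(** * Backward energy estimate *)

Section Optimality.
Context {R : realType} {d : measure_display} {Omega : measurableType d}.
Variables (P : probability Omega R) (T : R) (F H : R -> set (set Omega)).
Hypotheses (T0 : 0 < T) (hF : usual_conditions P T F) (hH : usual_conditions P T H)
  (hFT : F T = measurable) (hHF : forall t, 0 <= t <= T -> H t `<=` F t).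
Variables (M Q alpha : R -> Omega -> R) (r K : R).
Hypotheses (gQ : good_integrator P T F Q r) (hM : martingale P T F M)
  (hM2 : square_integrable P T M)
  (hMQ : martingale P T F (fun t w => M t w ^+ 2 - Q t w)).
Hypotheses (palpha : predictable T F alpha) (K0 : 0 <= K)
  (alphaK : doleans_ae P T Q (fun t w => `|alpha t w| <= K)).
Implicit Types (X Y I J G theta : R -> Omega -> R) (s t : R).
Local Notation jm := (joint_measurable F T).
Local Notation norm2 Z := (\int[P]_w ((Z w) ^+ 2)%:E)%E.
Local Notation energy := (energy P T Q).
Local Notation drift := (drift T Q alpha).
Local Notation gains := (gains P T F M Q alpha).
Local Notation ito := (ito_integral P T F M Q).
Local Notation weakly_orthogonal := (weakly_orthogonal P T F H M Q).
Local Notation sqi := (sqi P).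
Local Notation Ex := (Ex P).

Let T0T : 0 <= T <= T. Proof. by rewrite lexx ltW. Qed.
Let z0T : 0 <= (0 : R) <= T. Proof. by rewrite lexx ltW. Qed.

Lemma expectation_Ex (X : Omega -> R) : integ P X -> ('E_P[X] = (Ex X)%:E)%E.
Proof. by move=> iX; rewrite unlock /= ExE. Qed.

Lemma M2_predictable theta : M2 P T H Q theta -> predictable T F theta.
Proof. by move=> [pt _]; apply: predictableS pt => //; exact: ltW. Qed.

Lemma energyB_lty X Y : jm X -> jm Y -> (energy X < +oo)%E -> (energy Y < +oo)%E ->
  (energy (fun t w => (X t w - Y t w)%R) < +oo)%E.
Proof.
move=> mX mY eX eY.
apply: le_lt_trans (energyD_le T0 hF hFT gQ mX (jointN mY) ltr01) _.
by rewrite invr1 energyN lte_add_pinfty// lte_mul_pinfty// ?lee_fin.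
Qed.

Lemma M2_B X Y : M2 P T H Q X -> M2 P T H Q Y -> M2 P T H Q (fun t w => X t w - Y t w).
Proof.
move=> hX hY; have pX := M2_predictable hX; have pY := M2_predictable hY.
move: hX hY => [pX' eX] [pY' eY]; split; first exact: predictableB.
by apply: energyB_lty => //; exact: (predictable_joint hF T0T).
Qed.

Lemma M2_cut X s t : 0 <= s -> s <= t -> t <= T -> M2 P T H Q X ->
  M2 P T H Q (cut s t X).
Proof.
move=> s0 st tT hX; have pX := M2_predictable hX; have mX := predictable_joint hF T0T pX.
move: hX => [pX' eX]; split.
  apply: predictable_cut => //.
  have s0T : 0 <= s <= T by rewrite s0 (le_trans st).
  have [H0 HC _] := usual_sigma_algebra hH s0T.
  by have := HC _ H0; rewrite setD0.
apply: le_lt_trans eX; apply: (energy_le T0 hF hFT gQ) => //; first exact: joint_cut.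
by move=> u w; exact: cut_sqr_le.
Qed.

(* The initial value [Z] drops out because the stochastic integral is a
   martingale null at 0. *)
Lemma initial_orth (Z : Omega -> R) X I : sqi Z -> sub_measurable (F 0) Z -> ito X I ->
  Ex (fun w => Z w * I T w) = 0.
Proof.
move=> sZ mZ [hI sI I0 _].
rewrite -(martingale_orth hF hI (sI _ z0T) (sI _ T0T) (lexx 0) (ltW T0) (lexx T) mZ sZ).
have mI t : 0 <= t <= T -> measurable_fun setT (I t).
  by move=> t0T; exact: sqi_measurable (sI _ t0T).
have mZ' := sqi_measurable sZ.
apply: ae_Ex.
- by apply: measurable_funM => //; exact: mI.
- by apply: measurable_funM => //; apply: measurable_funB; exact: mI.
by apply: filterS I0 => w ->; rewrite subr0.
Qed.

Lemma weakly_orthogonalP X : sqi (X T) -> weakly_orthogonal X <->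
  forall phi I, M2 P T H Q phi -> ito phi I -> Ex (fun w => X T w * I T w) = 0.
Proof.
move=> sX; split=> h phi I hphi iI; have [_ sI _ _] := iI; have := h phi I hphi iI;
  rewrite expectation_Ex; try exact: (sqi_mul sX (sI _ T0T)).
  by move=> [].
by move=> ->.
Qed.

Section Step.
Variables (N phi J : R -> Omega -> R).
Hypotheses (hN : martingale P T F N) (sN : sqi (N T)) (oN : weakly_orthogonal N)
  (hphi : M2 P T H Q phi) (iJ : ito phi J).
Let pphi := M2_predictable hphi.
Let mphi := predictable_joint hF T0T pphi.
Let ephi : (energy phi < +oo)%E. Proof. by case: hphi. Qed.

Let residual t w := N t w - J t w - drift phi t w.

(* With [Y] the residual, [Y_t = 0] makes [Y_s] equal to the increment over
   [s, t] of [drift - N + J]; the cross terms vanish by weak orthogonality and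
   because [Y_s] is orthogonal to the martingale increments, whence
   [E[Y_s^2] + E[dN^2] + E[dJ^2] = E[d(drift)^2]]. *)
Lemma energy_step s t c : 0 <= s -> s <= t -> t <= T ->
  0 <= c -> {ae P, forall w, Q t w - Q s w <= c} -> K ^+ 2 * c <= 2^-1 ->
  {ae P, forall w, residual t w = 0} ->
  energy (cut s t phi) = 0%E /\ {ae P, forall w, residual s w = 0}.
Proof.
move=> s0 st tT c0 Qc Kc Yt.
have t0T : 0 <= t <= T by rewrite (le_trans s0).
have s0T : 0 <= s <= T by rewrite s0 (le_trans st).
have [hJ sJ _ _] := iJ; have [aN _ _] := hN; have [aJ _ _] := hJ.
have sNt u : 0 <= u <= T -> sqi (N u) by move=> u0T; exact: (martingale_sqi hF hN).
have sD u : 0 <= u <= T -> sqi (drift phi u).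
  by move=> u0T; exact: (drift_sqi T0 hF hFT gQ palpha K0 alphaK pphi ephi u0T).
have sY u : 0 <= u <= T -> sqi (residual u).
  by move=> u0T; apply: sqiB; [apply: sqiB; [exact: sNt|exact: sJ]|exact: sD].
have mYs : sub_measurable (F s) (residual s).
  have sF := usual_sigma_algebra hF s0T.
  apply: sub_measurableB => //; last exact: (drift_adapted hF gQ palpha pphi s0T).
  by apply: sub_measurableB => //; [exact: aN|exact: aJ].
pose dN w := N t w - N s w; pose dJ w := J t w - J s w.
pose dD w := drift phi t w - drift phi s w.
have sdN : sqi dN by apply: sqiB; exact: sNt.
have sdJ : sqi dJ by apply: sqiB; exact: sJ.
have sdD : sqi dD by apply: sqiB; exact: sD.
have YN : Ex (fun w => residual s w * dN w) = 0.
  exact: (martingale_orth hF hN (sNt _ s0T) (sNt _ t0T) s0 st tT mYs (sY _ s0T)).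
have YJ : Ex (fun w => residual s w * dJ w) = 0.
  exact: (martingale_orth hF hJ (sJ _ s0T) (sJ _ t0T) s0 st tT mYs (sY _ s0T)).
have icut := ito_integral_cut T0 hF hFT gQ hM2 s0 st tT mphi iJ.
have cutT w : J (Num.min t T) w - J (Num.min s T) w = dJ w.
  by rewrite !min_l// (le_trans st).
(* [dJ] is the terminal value of the integral of [cut s t phi], so weak orthogonality gives
   [E[N_T dJ] = 0]. Replacing [N_T] by [N_t] changes nothing as [dJ] is [F t]-measurable, and [N_s]
   is orthogonal to the martingale increment [dJ]. *)
have dNdJ : Ex (fun w => dN w * dJ w) = 0.
  have oT : Ex (fun w => N T w * dJ w) = 0.
    have /(weakly_orthogonalP sN)/(_ _ _ (M2_cut s0 st tT hphi) icut) := oN.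
    by under eq_Ex do rewrite cutT.
  have mdJ : sub_measurable (F t) dJ.
    apply: sub_measurableB; [exact: (usual_sigma_algebra hF)|exact: aJ|].
    by apply: (sub_measurableS hF s0 st tT); exact: aJ.
  have o1 := martingale_orth hF hN (sNt _ t0T) sN (le_trans s0 st) tT (lexx T) mdJ sdJ.
  have o2 := martingale_orth hF hJ (sJ _ s0T) (sJ _ t0T) s0 st tT (aN _ s0T) (sNt _ s0T).
  transitivity (Ex (fun w => N T w * dJ w - dJ w * (N T w - N t w) - N s w * dJ w)).
    by apply: eq_Ex => w; rewrite /dN; ring.
  have iNJ u : 0 <= u <= T -> integ P (fun w => N u w * dJ w).
    by move=> u0T; apply: sqi_mul => //; exact: sNt.
  have iJN : integ P (fun w => dJ w * (N T w - N t w)).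
    by apply: sqi_mul => //; apply: sqiB => //; exact: sNt.
  rewrite ExB; [|exact: (integB (iNJ _ T0T) iJN)|exact: (iNJ _ s0T)].
  by rewrite (ExB (iNJ _ T0T) iJN) oT o1 o2 !subr0.
have sYs := sY _ s0T.
have dDE : {ae P, forall w, dD w = dN w - dJ w + residual s w}.
  apply: filterS Yt => w Yw; apply/eqP; rewrite -subr_eq0 -oppr_eq0 -Yw.
  by rewrite /dD /dN /dJ /residual; apply/eqP; ring.
have i2 (X Y : Omega -> R) : sqi X -> sqi Y -> integ P (fun w => X w * Y w) by exact: sqi_mul.
have key : Ex (fun w => dD w ^+ 2) =
    Ex (fun w => dN w ^+ 2) + Ex (fun w => dJ w ^+ 2) + Ex (fun w => residual s w ^+ 2).
  transitivity (Ex (fun w => (dN w ^+ 2 + dJ w ^+ 2 + residual s w ^+ 2) +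
      2 * ((residual s w * dN w - residual s w * dJ w) - dN w * dJ w))).
    apply: ae_Ex.
    - by apply: measurable_funX; exact: (sqi_measurable sdD).
    - apply: (@integ_measurable _ _ _ P).
      apply: integD; first by apply: integD; [apply: integD|]; exact: sqi_sqr.
      by apply: integZ; apply: integB; [apply: integB|]; apply: i2.
    by apply: filterS dDE => w ->; ring.
  rewrite ExD; last 2 first.
  - by apply: integD; [apply: integD|]; apply: sqi_sqr.
  - by apply: integZ; apply: integB; [apply: integB|]; apply: i2.
  rewrite ExZ; last by apply: integB; [apply: integB|]; apply: i2.
  rewrite ExB; [|by apply: integB; apply: i2|exact: i2].
  rewrite ExB; [|exact: i2..].
  rewrite YN YJ dNdJ !subr0 mulr0 addr0.
  rewrite ExD; [|by apply: integD; exact: sqi_sqr|exact: sqi_sqr].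
  by rewrite ExD//; exact: sqi_sqr.
have isoJ : norm2 dJ = energy (cut s t phi).
  rewrite -(ito_isometry T0 hF hFT gQ hM hM2 hMQ (joint_cut s t mphi) icut).
  by apply: eq_integral => w _; rewrite cutT.
have dDle := drift_incr_norm2_le T0 hF hFT gQ palpha K0 alphaK pphi ephi s0 st tT c0 Qc.
have dDle' : Ex (fun w => dD w ^+ 2) <= 2^-1 * Ex (fun w => dJ w ^+ 2).
  move: dDle; rewrite -isoJ.
  rewrite (ExE (sqi_sqr sdD)) (ExE (sqi_sqr sdJ)) -EFinM lee_fin => /le_trans; apply.
  by rewrite ler_wpM2r// Rintegral_ge0// => w _; exact: sqr_ge0.
have sq0 (X : Omega -> R) : 0 <= Ex (fun w => X w ^+ 2) by apply: Rintegral_ge0 => w _; exact: sqr_ge0.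
have h1 := sq0 dN; have h2 := sq0 dJ; have h3 := sq0 (residual s).
(* [key] and [dDle'] combine to [E[dN^2] + E[dJ^2] / 2 + E[Y_s^2] <= 0] with [Y] the residual, and
   each term is nonnegative. *)
have J0 : Ex (fun w => dJ w ^+ 2) = 0 by lra.
have Y0 : Ex (fun w => residual s w ^+ 2) = 0 by lra.
split; first by rewrite -isoJ (ExE (sqi_sqr sdJ)) J0.
by apply: norm2_eq0; [exact/(@sqi_measurable _ _ _ P)/sY|rewrite (ExE (sqi_sqr (sY _ s0T))) Y0].
Qed.

Lemma energy_vanishes (rho : R -> R) : (forall x, 0 <= x -> 0 <= rho x) ->
  rho x @[x --> 0^'+] --> (0 : R) ->
  {ae P, forall w, forall s t, 0 <= s -> s <= t -> t <= T ->
            Q t w - Q s w <= rho (t - s)} ->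
  {ae P, forall w, residual T w = 0} -> energy phi = 0%E.
Proof.
move=> rho_ge0 rho0 hrho YT.
have [n [hn Kn]] : exists n : nat, (0 < n)%N /\ K ^+ 2 * rho (T / n%:R) <= 2^-1.
  (* Values of [rho] below this threshold satisfy [K^2 rho <= 1/2]; the added 1 covers [K = 0]. *)
  have K1 : 0 < (2 * (K ^+ 2 + 1))^-1 by rewrite invr_gt0 mulr_gt0// ltr_wpDl// sqr_ge0.
  have /cvgrPdist_lt/(_ _ K1) := rho0; move=> [e /= e0 He].
  exists (Num.truncn (T / e)).+1; split => //.
  set x := T / _.
  have x0 : 0 < x by rewrite divr_gt0.
  have xe : x < e.
    rewrite /x ltr_pdivrMr// mulrC -ltr_pdivrMr//; exact: truncnS_gt.
  have := He x; rewrite /ball/= !sub0r !normrN gtr0_norm// => /(_ xe x0).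
  rewrite (ger0_norm (rho_ge0 _ (ltW x0))) => h.
  have K2 : 0 < 2 * (K ^+ 2 + 1) by rewrite mulr_gt0// ltr_wpDl// sqr_ge0.
  move: h; rewrite -[X in _ < X]mul1r ltr_pdivlMr// => h.
  have := rho_ge0 _ (ltW x0); have := sqr_ge0 K; nra.
have n0 : 0 < n%:R :> R by rewrite ltr0n.
(* The grid runs backwards from [tk 0 = T], where the residual is known to vanish, to [tk n = 0]. *)
pose tk k := T - k%:R * (T / n%:R).
have step0 : 0 <= T / n%:R by rewrite divr_ge0// ltW.
have tk0 k : (k <= n)%N -> 0 <= tk k.
  move=> kn; rewrite /tk subr_ge0 mulrCA ler_piMr ?(ltW T0)//.
  by rewrite ler_pdivrMr// mul1r ler_nat.
have tkT k : tk k <= T by rewrite /tk gerBl mulr_ge0.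
have tkS k : tk k - tk k.+1 = T / n%:R by rewrite /tk -natr1; ring.
have tkm k : tk k.+1 <= tk k by rewrite -subr_ge0 tkS.
have rec k : (k <= n)%N -> energy (cut (tk k) T phi) = 0%E /\
    {ae P, forall w, residual (tk k) w = 0}.
  elim: k => [_|k IH kn].
    rewrite /tk mul0r subr0; split => //; apply: energy0 => u w.
    by rewrite /cut; case: (ltP T u) => [Tu|]; rewrite /= ?mul0r// leNgt Tu mul0r.
  have [e1 Y1] := IH (ltnW kn).
  have Qk : {ae P, forall w, Q (tk k) w - Q (tk k.+1) w <= rho (T / n%:R)}.
    by apply: filterS hrho => w h; rewrite -(tkS k); apply: h => //; exact: tk0.
  have [e2 Y2] := energy_step (tk0 _ kn) (tkm k) (tkT k) (rho_ge0 _ step0) Qk Kn Y1.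
  split => //.
  apply/eqP; rewrite eq_le energy_ge0 andbT.
  (* The restriction to ]tk (k+1), T] is the sum of two pieces of zero energy, so the Young bound
     with weight 1 gives it zero energy. *)
  have := energyD_le T0 hF hFT gQ (joint_cut (tk k.+1) (tk k) mphi) (joint_cut (tk k) T mphi) ltr01.
  rewrite e1 e2 !mule0 adde0; apply: le_trans.
  rewrite le_eqVlt; apply/orP; left; apply/eqP/eq_energy => u w _.
  rewrite /cut -mulrDl; congr (_ * _).
  have := tkm k; have := tkT k.
  case: (ltP (tk k.+1) u) => h1; case: (leP u (tk k)) => h2; case: (leP u T) => h3 /= h4 h5;
    rewrite ?addr0 ?add0r//; exfalso; lra.
have tkn : tk n = 0 by rewrite /tk mulrC divfK ?subrr// gt_eqF.
have [en _] := rec n (leqnn n).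
rewrite -en; apply: eq_energy => u w u0T.
by rewrite tkn /cut u0T mul1r.
Qed.

End Step.

End Optimality.

(** * Optimal strategies and decompositions *)

Section Characterization.
Context {R : realType} {d : measure_display} {Omega : measurableType d}.
Variables (P : probability Omega R) (T : R) (F H : R -> set (set Omega)).
Hypotheses (T0 : 0 < T) (hF : usual_conditions P T F) (hH : usual_conditions P T H)
  (hFT : F T = measurable) (hHF : forall t, 0 <= t <= T -> H t `<=` F t).
Variables (M Q alpha S : R -> Omega -> R) (r K : R).
Hypotheses (gQ : good_integrator P T F Q r) (hM : martingale P T F M)
  (hM2 : square_integrable P T M)
  (hMQ : martingale P T F (fun t w => M t w ^+ 2 - Q t w)).
Hypotheses (palpha : predictable T F alpha) (K0 : 0 <= K)
  (alphaK : doleans_ae P T Q (fun t w => `|alpha t w| <= K)) (aS : adapted T F S).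
Variable xi : Omega -> R.
Implicit Types (A G theta beta eta C : R -> Omega -> R) (s t : R).
Local Notation jm := (joint_measurable F T).
Local Notation energy := (energy P T Q).
Local Notation gains := (gains P T F M Q alpha).
Local Notation ito := (ito_integral P T F M Q).
Local Notation sqi := (sqi P).
Local Notation Ex := (Ex P).
Local Notation optimal := (optimal P T F H M Q alpha S xi).
Local Notation decomposition := (decomposition P T F H M Q alpha xi).
Local Notation weakly_orthogonal := (weakly_orthogonal P T F H M Q).

Let T0T : 0 <= T <= T. Proof. by rewrite lexx ltW. Qed.
Let z0T : 0 <= (0 : R) <= T. Proof. by rewrite lexx ltW. Qed.

Let woP X (sX : sqi (X T)) := @weakly_orthogonalP R d Omega P T F H T0 M Q X sX.

Lemma martingaleDcst (U0 : Omega -> R) A : sub_measurable (F 0) U0 -> integ P U0 ->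
  martingale P T F A -> martingale P T F (fun t w => U0 w + A t w).
Proof.
move=> mU iU hA.
have mU' : sub_measurable (F 0) (fun w => - U0 w).
  have sF := usual_sigma_algebra hF z0T.
  apply/sub_measurableP => //; apply: measurableT_comp => //; exact/sub_measurableP.
have iU' : integ P (fun w => - U0 w).
  by apply: eq_integ (integZ (-1) iU) => w; rewrite mulN1r.
have := martingaleB hF hA (martingale_cst hF mU' iU').
by under eq_fun do under eq_fun do rewrite opprK addrC.
Qed.

Lemma weakly_orthogonalDcst (U0 : Omega -> R) A : sqi U0 -> sub_measurable (F 0) U0 -> sqi (A T) ->
  weakly_orthogonal (fun t w => U0 w + A t w) <-> weakly_orthogonal A.
Proof.
move=> sU mU sA.
have sUA : sqi (fun w => U0 w + A T w) by exact: sqiD.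
have E phi I : ito phi I ->
    Ex (fun w => (U0 w + A T w) * I T w) = Ex (fun w => A T w * I T w).
  move=> iI; have [_ sI _ _] := iI.
  under eq_Ex do rewrite mulrDl.
  rewrite ExD; [|exact: sqi_mul sU (sI _ T0T)|exact: sqi_mul sA (sI _ T0T)].
  by rewrite (initial_orth T0 hF sU mU iI) add0r.
split=> [/(woP (X := fun t w => U0 w + A t w) sUA)|/(woP (X := A) sA)] h.
  by apply/(woP (X := A) sA) => phi I hphi iI; rewrite -(E phi I iI) (h phi).
apply/(woP (X := fun t w => U0 w + A t w) sUA) => phi I hphi iI.
by rewrite (E phi I iI) (h phi).
Qed.

(** The prescribed [eta] makes [V] the value process, hence [U0 + A] is the cost exactly. The
    decomposition may rest on another version [G'] of the gains, which [gains_eq] identifies with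
    [G] for the terminal condition. *)
Lemma optimal_of_decomposition U0 beta A G :
  decomposition U0 beta A -> gains beta G ->
  let V t w := U0 w + G t w + A t w in
  optimal beta (fun t w => V t w - beta t w * S t w).
Proof.
move=> [[mU sU] hb [hA A0 sA] oA [G' hG' xiE]] hG V.
have pb := M2_predictable T0 hHF hb; have [pbH eb] := hb.
have mb := predictable_joint hF T0T pb.
have aG := gains_adapted hF gQ palpha pb hG.
have sG := gains_sqi T0 hF hFT gQ palpha K0 alphaK pb eb hG.
have rG := gains_right_continuous T0 hF hFT gQ palpha K0 alphaK pb eb hG.
have [aA _ rA] := hA.
have ab := predictable_adapted hF pb.
have mUt t : 0 <= t <= T -> sub_measurable (F t) U0.
  by move=> /andP[t0 tT]; exact: (sub_measurableS hF (lexx 0) t0 tT).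
have aV : adapted T F V.
  move=> t t0T; have sF := usual_sigma_algebra hF t0T.
  by apply: sub_measurableD => //; [apply: sub_measurableD => //; [exact: mUt|exact: aG]|exact: aA].
have vE : value S beta (fun t w => V t w - beta t w * S t w) = V.
  by apply/funext => t; apply/funext => w; rewrite /value addrC subrK.
split.
- split => //.
  + move=> t t0T; have sF := usual_sigma_algebra hF t0T.
    by apply: sub_measurableB => //; [exact: aV|apply: sub_measurableM => //; [exact: ab|exact: aS]].
  + rewrite vE; apply: filterS2 rG rA => w rGw [rAw _] t t0 tT.
    by apply: cvgD; [apply: cvgD; [exact: cvg_cst|exact: rGw]|exact: rAw].
  + move=> t t0T; rewrite vE; split; first exact: aV.
    by apply: sqiD; [apply: sqiD => //; exact: sG|exact: (martingale_sqi hF hA)].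
- rewrite vE.
  have GG' : indistinguishable P T G G'.
    apply: (gains_eq T0 hF hFT gQ hM hM2 hMQ palpha K0 alphaK pb eb pb eb _ hG hG').
    by apply: energy0 => t w; rewrite subrr.
  by apply: filterS2 xiE (indistinguishable_at GG' T0T) => w -> GT; rewrite /V GT.
- exists (fun t w => U0 w + A t w); split.
  + by exists G => // t w; rewrite vE /V; ring.
  + by apply: martingaleDcst => //; exact: sqi_integ.
  + exact/weakly_orthogonalDcst.
Qed.

Section OptimalStrategy.
Variables theta eta C G : R -> Omega -> R.
Hypotheses (hadm : admissible P T F H Q S theta eta)
  (VT : {ae P, forall w, value S theta eta T w = xi w})
  (hG : gains theta G) (CE : forall t w, C t w = value S theta eta t w - G t w)
  (hC : martingale P T F C) (oC : weakly_orthogonal C).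

Let hth : M2 P T H Q theta. Proof. by case: hadm. Qed.
Let pth : predictable T F theta. Proof. exact: (M2_predictable T0 hHF hth). Qed.
Let eth : (energy theta < +oo)%E. Proof. by case: hth. Qed.

Lemma cost_sqi t : 0 <= t <= T -> sqi (C t).
Proof.
move=> t0T; have [_ _ _ sV] := hadm.
rewrite (_ : C t = fun w => value S theta eta t w - G t w); last exact/funext/CE.
apply: sqiB; first by have [] := sV _ t0T.
exact: (gains_sqi T0 hF hFT gQ palpha K0 alphaK pth eth hG).
Qed.

Lemma decomposition_of_optimal :
  decomposition (C 0) theta (fun t w => C t w - C 0 w).
Proof.
have [aC _ _] := hC; have mC0 := aC _ z0T; have sC0 := cost_sqi z0T.
have sC := cost_sqi T0T.
have hA : martingale P T F (fun t w => C t w - C 0 w).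
  by apply: martingaleB => //; apply: martingale_cst => //; exact: sqi_integ.
split => //.
- by split => //; [apply: aeW => w; rewrite subrr|exact: sqiB].
- apply/(weakly_orthogonalDcst sC0 mC0); first exact: sqiB.
  by under eq_fun do under eq_fun do rewrite addrC subrK.
- exists G => //; apply: filterS VT => w <-.
  by rewrite (CE T); ring.
Qed.

Lemma strategy_unique (rho : R -> R) U0 beta A G1 :
  (forall x, 0 <= x -> 0 <= rho x) -> rho x @[x --> 0^'+] --> (0 : R) ->
  {ae P, forall w, forall s t, 0 <= s -> s <= t -> t <= T ->
            Q t w - Q s w <= rho (t - s)} ->
  decomposition U0 beta A -> gains beta G1 ->
  [/\ energy (fun t w => beta t w - theta t w) = 0%E,
      indistinguishable P T C (fun t w => U0 w + A t w) &
      indistinguishable P T G G1].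
Proof.
move=> rho_ge0 rho0 hrho [[mU sU] hb [hA A0 sA] oA [G' hG' xiE]] hG1.
have pb := M2_predictable T0 hHF hb; have [pbH eb] := hb.
have mb := predictable_joint hF T0T pb; have mth := predictable_joint hF T0T pth.
pose N t w := C t w - (U0 w + A t w).
have hUA := martingaleDcst mU (sqi_integ sU) hA.
have hN : martingale P T F N by exact: martingaleB.
have sUA : sqi (fun w => U0 w + A T w) by exact: sqiD.
have sC := cost_sqi T0T.
have sN : sqi (N T) by exact: sqiB.
have oN : weakly_orthogonal N.
  apply/(woP sN) => phi I hphi iI; have [_ sI _ _] := iI.
  have := (woP sC).1 oC phi I hphi iI.
  have oUA : weakly_orthogonal (fun t w => U0 w + A t w) by exact/weakly_orthogonalDcst.
  have := (woP (X := fun t w => U0 w + A t w) sUA).1 oUA phi I hphi iI.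
  move=> h1 h2; under eq_Ex do rewrite mulrBl.
  rewrite ExB; [|exact: sqi_mul sC (sI _ T0T)|exact: sqi_mul sUA (sI _ T0T)].
  by rewrite h1 h2 subr0.
have [I [iI GI]] := hG; have [J [iJ GJ]] := hG1.
have hphi := M2_B T0 hF hFT hHF gQ hb hth.
have iphi := ito_integralB T0 hF hFT gQ hM2 mb mth iJ iI.
have G'G1 : indistinguishable P T G' G1.
  apply: (gains_eq T0 hF hFT gQ hM hM2 hMQ palpha K0 alphaK pb eb pb eb _ hG' hG1).
  by apply: energy0 => t w; rewrite subrr.
have e0 : energy (fun t w => beta t w - theta t w) = 0%E.
  apply: (energy_vanishes T0 hF hH hFT hHF gQ hM hM2 hMQ palpha K0 alphaK hN sN oN hphi iphi
    rho_ge0 rho0 hrho).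
  (* Both [C_T + G_T] and [U0 + A_T + G1_T] equal [xi] almost surely; this is the vanishing of the
     residual at T. *)
  have gg : {ae P, forall w, good_path T Q alpha K beta w /\ good_path T Q alpha K theta w}.
    by apply: filterS2 (ae_good_path T0 hF hFT gQ alphaK mb eb)
      (ae_good_path T0 hF hFT gQ alphaK mth eth).
  have GT : {ae P, forall w, G T w = I T w + drift T Q alpha theta T w}.
    exact: (indistinguishable_at GI T0T).
  have G1T : {ae P, forall w, G1 T w = J T w + drift T Q alpha beta T w}.
    exact: (indistinguishable_at GJ T0T).
  have xiE' : {ae P, forall w, value S theta eta T w = U0 w + G1 T w + A T w}.
    by apply: filterS3 xiE VT (indistinguishable_at G'G1 T0T) => w -> -> ->.
  apply: filterS3 gg GT (filterS2 _ (fun w => @conj _ _) G1T xiE') => w [g1 g2] Gw [G1w VE].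
  rewrite (driftB T0 hF palpha K0 mb mth g1 g2 T0T) /N CE VE Gw.
  by rewrite G1w; ring.
have GG1 : indistinguishable P T G1 G.
  exact: (gains_eq T0 hF hFT gQ hM hM2 hMQ palpha K0 alphaK pb eb pth eth e0 hG1 hG).
split => //; last exact: indistinguishable_sym.
(* Equal gains force equal terminal costs, and a square-integrable martingale is determined by its
   terminal value. *)
apply: (martingale_indistinguishable T0 hF hC hUA sC sUA).
have xiE' : {ae P, forall w, value S theta eta T w = U0 w + G1 T w + A T w}.
  by apply: filterS3 xiE VT (indistinguishable_at G'G1 T0T) => w -> -> ->.
apply: filterS2 xiE' (indistinguishable_at GG1 T0T) => w VE Gw.
by rewrite CE VE Gw; ring.
Qed.

End OptimalStrategy.

Lemma doleans_aeS (p q u : R -> Omega -> Prop) : doleans_ae P T Q p -> doleans_ae P T Q q ->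
  (forall t w, 0 <= t <= T -> p t w -> q t w -> u t w) -> doleans_ae P T Q u.
Proof.
move=> [N1 [mN1 D1 pN1]] [N2 [mN2 D2 pN2]] pqu.
exists (N1 `|` N2); split; first exact: measurableU.
  apply/(doleans_eq0P T0 hF hFT gQ); first exact: measurableU.
  move/(doleans_eq0P T0 hF hFT gQ mN1) : D1 => D1.
  move/(doleans_eq0P T0 hF hFT gQ mN2) : D2 => D2.
  apply: filterS2 D1 D2 => w D1 D2.
  have mx (N : set (Omega * R)) : measurable N ->
      measurable ([set` `]0, T]] `&` xsection N w : set (measurableTypeR R)).
    move=> mN; apply: measurableI; first exact: measurable_itv.
    exact: (@measurable_xsection _ _ Omega (measurableTypeR R)).
  apply: measure_negligible; first exact: (mx _ (measurableU _ _ mN1 mN2)).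
  rewrite (_ : xsection _ w = xsection N1 w `|` xsection N2 w); last first.
    by apply/seteqP; split=> s; rewrite /xsection/= !in_setE.
  rewrite setIUr; apply: negligibleU.
    by apply/negligibleP => //; exact: mx.
  by apply/negligibleP => //; exact: mx.
move=> t w t0T nN; apply: pqu => //; [apply: pN1|apply: pN2] => // h; apply: nN; [left|right]; exact: h.
Qed.

Lemma doleans_ae_indistinguishable X Y : indistinguishable P T X Y ->
  doleans_ae P T Q (fun t w => X t w = Y t w).
Proof.
move=> [N [mN N0 XY]].
have mNT : measurable (N `*` setT : set (Omega * R)) by exact: measurableX.
exists (N `*` setT); split => //.
  apply/(doleans_eq0P T0 hF hFT gQ mNT); exists N; split => //.
  move=> w /= h; apply: contrapT => Nw; apply: h.
  rewrite (_ : xsection _ w = set0) ?setI0 ?measure0//.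
  by apply/seteqP; split=> s //; rewrite /xsection/= in_setE => -[].
move=> t w t0T nN; apply: contrapT => XYw; apply: nN; split => //=.
by apply: XY => /(_ t t0T).
Qed.

Lemma doleans_ae_energy0 phi : jm phi -> energy phi = 0%E ->
  doleans_ae P T Q (fun t w => phi t w = 0).
Proof.
move=> mphi e0.
pose E : set (Omega * R) := (setT `*` [set` `]0, T]]) `&` [set p | phi p.2 p.1 <> 0].
have mE : measurable E.
  apply/(measurable_prod_terminal hFT).
  apply: (mphi _ (~` [set 0])) => //.
    by apply: measurableX => //; exact: measurable_itv.
  exact: measurableC.
have mZ : measurable (setT `*` [set 0] : set (Omega * R)) by exact: measurableX.
(* Zero energy gives no information at time 0, which lies outside ]0, T] and so carries no mass; it
   joins the exceptional set. *)
exists (E `|` (setT `*` [set 0])); split; first exact: measurableU.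
  apply/(doleans_eq0P T0 hF hFT gQ); first exact: measurableU.
  apply: filterS (energy_eq0 T0 hF hFT gQ mphi e0) => w pe0.
  have ms := joint_section w mphi.
  have m2 : measurable_fun ([set` `]0, T]] : set (measurableTypeR R)) (fun s => ((phi s w) ^+ 2)%:E).
    by apply/measurable_EFinP; exact: measurable_funX.
  have mx : measurable ([set` `]0, T]] `&` xsection (E `|` (setT `*` [set 0])) w : set (measurableTypeR R)).
    apply: measurableI; first exact: measurable_itv.
    by apply: (@measurable_xsection _ _ Omega (measurableTypeR R)); exact: measurableU.
  apply: measure_negligible => //.
  have := ae_eq_integral_abs (lebesgue_stieltjes_measure (stieltjes_path T (Q ^~ w)))
    (measurable_itv `]0, T]) m2.
  have -> : (\int[lebesgue_stieltjes_measure (stieltjes_path T (Q ^~ w))]_(s in [set` `]0%R, T]])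
      `|((phi s w) ^+ 2)%:E| = 0)%E.
    by rewrite -[RHS]pe0; apply: eq_integral => s _; rewrite gee0_abs// lee_fin sqr_ge0.
  move=> [/(_ erefl) h _]; apply: negligibleS h => s /= [s0T].
  rewrite /xsection/= in_setE => -[[_ /= ns] h|[_ /= s0]].
    by have /eqP := h s0T; rewrite eqe sqrf_eq0 => /eqP.
  by move: s0T; rewrite s0 in_itv/= ltxx.
move=> t w /andP[t0 tT] nE; apply: contrapT => pt; apply: nE.
move: t0; rewrite le_eqVlt => /predU1P[<-|t0]; first by right.
by left; split => //=; split => //=; rewrite in_itv/= t0.
Qed.

End Characterization.

Lemma good_integrator_bounded (R : realType) (d : measure_display)
    (Omega : measurableType d) (P : probability Omega R) (T : R)
    (F : R -> set (set Omega)) (M Q : R -> Omega -> R) (rho : R -> R) :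
  0 < T -> usual_conditions P T F -> predictable_quadratic_variation P T F M Q ->
  {ae P, forall w, forall s t, 0 <= s -> s <= t -> t <= T ->
            Q t w - Q s w <= rho (t - s)} ->
  good_integrator P T F Q (rho T).
Proof.
move=> T0 hF [pQ Q0 iQ _] hrho; split => //; first exact: (predictable_adapted hF pQ).
apply: filterS2 Q0 hrho => w Q0w h.
by have := h 0 T (lexx 0) (ltW T0) (lexx T); rewrite Q0w !subr0.
Qed.

Unset Implicit Arguments.

(** [G] stands for any version of the gains of [beta]. Cost and value are determined up to
    indistinguishability, whereas [theta], and with it [eta], is determined up to [doleans]-null
    sets, which is all that the energy detects. *)
Theorem proposition3p10 (R : realType) (d : measure_display)
  (Omega : measurableType d) (P : probability Omega R) (T : R) (hT : 0 < T)
  (F H : R -> set (set Omega))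
  (hF : usual_conditions P T F) (hH : usual_conditions P T H)
  (hFT : F T = measurable)
  (hHF : forall t, 0 <= t <= T -> H t `<=` F t)
  (M Q alpha S : R -> Omega -> R)
  (hM : martingale P T F M) (hM2 : square_integrable P T M)
  (hM0 : {ae P, forall w, M 0 w = 0})
  (hQ : predictable_quadratic_variation P T F M Q)
  (halpha : M2 P T F Q alpha)
  (hS : structure_condition P T F M Q alpha S)
  (rho : R -> R) (hrho_ge0 : forall x, 0 <= x -> 0 <= rho x)
  (hrho0 : rho x @[x --> 0^'+] --> (0 : R))
  (hrho : {ae P, forall w, forall s t, 0 <= s -> s <= t -> t <= T ->
            Q t w - Q s w <= rho (t - s)})
  (K : R) (hK : 0 <= K)
  (halphaK : doleans_ae P T Q (fun t w => `|alpha t w| <= K))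
  (xi : Omega -> R) (hxi : L2 P (F T) xi) :
  ((exists theta eta, optimal P T F H M Q alpha S xi theta eta) <->
   (exists U0 beta A, decomposition P T F H M Q alpha xi U0 beta A))
  /\
  (forall U0 beta A G,
     decomposition P T F H M Q alpha xi U0 beta A ->
     gains P T F M Q alpha beta G ->
     let V : R -> Omega -> R := fun t w => U0 w + G t w + A t w in
     optimal P T F H M Q alpha S xi
       beta (fun t w => V t w - beta t w * S t w) /\
     forall theta eta C,
       optimal P T F H M Q alpha S xi theta eta ->
       is_cost P T F M Q alpha S theta eta C ->
       [/\ doleans_ae P T Q (fun t w => theta t w = beta t w),
           indistinguishable P T C (fun t w => U0 w + A t w),
           indistinguishable P T (value S theta eta) V &
           doleans_ae P T Q (fun t w => eta t w = V t w - beta t w * S t w)]).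
Proof.
have gQ := good_integrator_bounded hT hF hQ hrho.
have hMQ : martingale P T F (fun t w => M t w ^+ 2 - Q t w) by case: hQ.
have [palpha _] := halpha.
have [aS _ _ _] := hS.
have opt := @optimal_of_decomposition R d Omega P T F H hT hF hFT hHF M Q alpha S _ K
  gQ hM hM2 hMQ palpha hK halphaK aS xi.
split.
  split=> [[theta [eta [hadm VT [C [[G hG CE] hC oC]]]]]|[U0 [beta [A hdec]]]].
    exists (C 0), theta, (fun t w => C t w - C 0 w).
    exact: (decomposition_of_optimal hT hF hFT hHF gQ palpha hK halphaK hadm VT hG CE hC oC).
  have [_ _ _ _ [G hG _]] := hdec.
  exists beta, (fun t w => U0 w + G t w + A t w - beta t w * S t w).
  exact: opt hdec hG.
move=> U0 beta A G hdec hG V; split; first exact: opt hdec hG.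
move=> theta eta C hopt [G1 hG1 CE].
have [hadm VT [C' [[G' hG' CE'] hC oC]]] := hopt.
have [e0 CU GG] := strategy_unique hT hF hH hFT hHF gQ hM hM2 hMQ palpha hK halphaK
  hadm VT hG' CE' hC oC hrho_ge0 hrho0 hrho hdec hG.
have [hth _ _ _] := hadm.
have pth := M2_predictable hT hHF hth; have [_ eth] := hth.
(* The given cost [C] may be built on another version [G1] of the gains than the [C'] supplied by
   optimality. *)
have GG1 : indistinguishable P T G' G1.
  apply: (gains_eq hT hF hFT gQ hM hM2 hMQ palpha hK halphaK pth eth pth eth _ hG' hG1).
  by apply: energy0 => t w; rewrite subrr.
have VV : indistinguishable P T (value S theta eta) V.
  apply: filterS2 CU GG => w CUw GGw t t0T.
  have -> : value S theta eta t w = C' t w + G' t w by rewrite CE' subrK.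
  by rewrite CUw// GGw// /V; ring.
have [_ hb _ _ _] := hdec.
have T0T : 0 <= T <= T by rewrite lexx ltW.
have mphi := jointB (predictable_joint hF T0T (M2_predictable hT hHF hb))
  (predictable_joint hF T0T pth).
have tb : doleans_ae P T Q (fun t w => theta t w = beta t w).
  have d0 := doleans_ae_energy0 hT hF hFT gQ mphi e0.
  apply: (doleans_aeS hT hF hFT gQ d0 d0) => t w _ h _.
  by apply/esym/eqP; rewrite -subr_eq0 h.
split => //.
- apply: filterS2 CU GG1 => w CUw GGw t t0T.
  by rewrite -CUw// CE CE' GGw.
- apply: (doleans_aeS hT hF hFT gQ tb (doleans_ae_indistinguishable hT hF hFT gQ VV)).
  by move=> t w _ <- <-; rewrite /value addrC addKr.
Qed.
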